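(* Let $i\in\mathbb{N}_+$ and $\tilde w\in\mathbb{C}_i$. Write $x=v-v^{-1}$. (1) If $\ell(\mathbb{C}_i)\leq\ell(\tilde w)\leq6i+1$, then $$f_{\tilde w,\mathbb{O}}=\begin{cases}x,&\mathbb{O}=\mathbb{O}_{j\alpha_1+i\alpha_2}\ \bigl(\lfloor\frac i2\rfloor+1\leq j\leq\frac{\ell(\tilde w)-1}{2}-i\bigr),\\ 1,&\mathbb{O}=\mathbb{C}_i,\\ 0,&\text{otherwise.}\end{cases}$$ (2) If $\ell(\tilde w)=6i-1+4k$ with $k\geq1$, then $$f_{\tilde w,\mathbb{O}}=\begin{cases}x,&\mathbb{O}=\mathbb{O}_{2i\alpha_1+i\alpha_2},\\ kx,&\mathbb{O}=\mathbb{O}_2,\\ kx^2,&\mathbb{O}\in\bigl(\mathbb{O}^{\leqslant}_{t^{2i\alpha_1+i\alpha_2}s_1}\cup\mathbb{O}'^{\leqslant}_{t^{2i\alpha_1+i\alpha_2}s_2}\bigr)\setminus\{\mathbb{C}_i\},\\ kx^3,&\mathbb{O}=\mathbb{O}_\lambda,\ \lambda\in Q_{2i\alpha_1+i\alpha_2}\setminus E_{2i\alpha_1+i\alpha_2},\\ kx^3+x,&\mathbb{O}=\mathbb{O}_\lambda,\ \lambda\in E_{2i\alpha_1+i\alpha_2},\\ (k-j)x^2,&\mathbb{O}=\mathbb{C}(t^{(2i+j+1)\alpha_1+(i+j)\alpha_2}s_1)\text{ or }\mathbb{C}'(t^{(2i+j)\alpha_1+(i+j)\alpha_2}s_2)\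 (1\leq j\leq k-1),\\ (k-j)x^3,&\mathbb{O}=\mathbb{O}_\lambda,\ \lambda\in E_{(2i+j)\alpha_1+(i+j)\alpha_2}\cup E'_{(2i+j)\alpha_1+(i+j)\alpha_2}\ (1\leq j\leq k-1),\\ (k-j)x^3+x,&\mathbb{O}=\mathbb{O}_{(2i+j)\alpha_1+(i+j)\alpha_2}\ (1\leq j\leq k-1),\\ kx^2+1,&\mathbb{O}=\mathbb{C}_i,\\ 0,&\text{otherwise.}\end{cases}$$ (3) If $\ell(\tilde w)=6i+1+4k$ with $k\geq1$, then $$f_{\tilde w,\mathbb{O}}=\begin{cases}x,&\mathbb{O}=\mathbb{O}_{2i\alpha_1+i\alpha_2},\\ kx,&\mathbb{O}=\mathbb{O}_2,\\ kx^2,&\mathbb{O}\in\bigl(\mathbb{O}^{\leqslant}_{t^{2i\alpha_1+i\alpha_2}s_1}\cup\mathbb{O}'^{\leqslant}_{t^{2i\alpha_1+i\alpha_2}s_2}\bigr)\setminus\{\mathbb{C}_i\},\\ kx^3,&\mathbb{O}=\mathbb{O}_\lambda,\ \lambda\in Q_{2i\alpha_1+i\alpha_2}\setminus E_{2i\alpha_1+i\alpha_2},\\ kx^3+x,&\mathbb{O}=\mathbb{O}_\lambda,\ \lambda\in E_{2i\alpha_1+i\alpha_2},\\ (k-j)x^2,&\mathbb{O}=\mathbb{C}(t^{(2i+j+1)\alpha_1+(i+j)\alpha_2}s_1)\text{ or }\mathbb{C}'(t^{(2i+j)\alpha_1+(i+j)\alpha_2}s_2)\ (1\leq j\leq k-1),\\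 (k-j)x^3,&\mathbb{O}=\mathbb{O}_\lambda,\ \lambda\in E_{(2i+j)\alpha_1+(i+j)\alpha_2}\cup E'_{(2i+j)\alpha_1+(i+j)\alpha_2}\ (1\leq j\leq k-1),\\ (k-j)x^3+x,&\mathbb{O}=\mathbb{O}_{(2i+j)\alpha_1+(i+j)\alpha_2}\ (1\leq j\leq k-1),\\ kx^2+1,&\mathbb{O}=\mathbb{C}_i,\\ x,&\mathbb{O}=\mathbb{O}_{(2i+k)\alpha_1+(i+k)\alpha_2},\\ 0,&\text{otherwise.}\end{cases}$$
   Context: $W=\langle s_1,s_2\rangle$ is the finite Weyl group of type $A_2$; $\alpha_1,\alpha_2$ are the simple roots, identified with the simple coroots ($\langle\alpha_i,\alpha_i\rangle=2$, $\langle\alpha_1,\alpha_2\rangle=-1$); $Q=\mathbb{Z}\alpha_1\oplus\mathbb{Z}\alpha_2$; $P$ is the coweight lattice, $P_+$ its dominant elements; $\widetilde W=P\rtimes W$ with translations $t^\lambda$. $W_a=Q\rtimes W$ is the Coxeter group generated by $s_0=t^{\alpha_1+\alpha_2}s_1s_2s_1$, $s_1$, $s_2$; $\widetilde W=W_a\rtimes\langle\tau\rangle$ with $\tau^3=1$, $\tau s_0\tau^{-1}=s_1$, $\tau s_1\tau^{-1}=s_2$, $\tau s_2\tau^{-1}=s_0$; $\ell(w\tau^j)=\ell(w)$ for $w\in W_a$. $\mathbb{N}_+$ is the set of positive integers. Class polynomials: $\widetilde H$ is the algebra over $\mathbb{Z}[v,v^{-1}]$ with basis $T_{\tilde w}$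 ($\tilde w\in\widetilde W$), $T_{\tilde x}T_{\tilde y}=T_{\tilde x\tilde y}$ if $\ell(\tilde x)+\ell(\tilde y)=\ell(\tilde x\tilde y)$, and $(T_s-v)(T_s+v^{-1})=0$ for $s\in\{s_0,s_1,s_2\}$. $[\widetilde H,\widetilde H]$ is the submodule spanned by commutators. For a conjugacy class $\mathbb{O}$ of $\widetilde W$, $\ell(\mathbb{O})$ is its minimal length and $T_{\mathbb{O}}$ is the image in $\widetilde H/[\widetilde H,\widetilde H]$ of $T_{w}$ for any minimal length $w\in\mathbb{O}$; by He–Nie this is well defined and the $T_{\mathbb{O}}$ form a basis. The class polynomials $f_{\tilde w,\mathbb{O}}$ are the unique coefficients with $T_{\tilde w}\equiv\sum_{\mathbb{O}}f_{\tilde w,\mathbb{O}}T_{\mathbb{O}}\bmod[\widetilde H,\widetilde H]$. Conjugacy classes of $\widetilde W$ in $W_a$: $\mathbb{O}_2=\{t^\lambda s_1s_2,\ t^\lambda s_2s_1\mid\lambda\in Q\}$; for $\lambda\in Q\cap P_+$, $\mathbb{O}_\lambda$ is the class of $t^\lambda$; for $i\in\mathbb{N}_+$, $\mathbb{C}_i=\{t^{k\alpha_1+i\alpha_2}s_1,\ t^{-i\alpha_1+k\alpha_2}s_2,\ t^{k\alpha_1+(k-i)\alpha_2}s_1s_2s_1\mid k\in\mathbb{Z}\}$, $\mathbb{C}'_i=\{t^{k\alpha_1-i\alpha_2}s_1,\ t^{i\alpha_1+k\alpha_2}s_2,\ t^{(k-i)\alpha_1+k\alpha_2}s_1s_2s_1\mid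 k\in\mathbb{Z}\}$. For $\lambda\in Q\cap P_+$: $\mathbb{C}(t^\lambda s_1)$ and $\mathbb{C}'(t^\lambda s_2)$ are the conjugacy classes of $t^\lambda s_1$ and $t^\lambda s_2$; $\mathbb{O}^{\leqslant}_{t^\lambda s_1}$ is the set of all $\mathbb{C}_i$ ($i\in\mathbb{N}_+$) with $\ell(\mathbb{C}_i)\leq\ell(\mathbb{C}(t^\lambda s_1))$; $\mathbb{O}'^{\leqslant}_{t^\lambda s_2}$ is the set of all $\mathbb{C}'_i$ with $\ell(\mathbb{C}'_i)\leq\ell(\mathbb{C}'(t^\lambda s_2))$. $Q_{sh}=Q\setminus\{k(\alpha_1+2\alpha_2),k(2\alpha_1+\alpha_2),k(\alpha_1-\alpha_2)\mid k\in\mathbb{Z}\}$; for $\alpha\in Q$, $Q_\alpha=\{\lambda\in Q\cap P_+\mid\lambda<\alpha\}\cap Q_{sh}$, where $\lambda<\alpha$ means $\alpha-\lambda$ is a nonzero combination of $\alpha_1,\alpha_2$ with nonnegative integer coefficients. For $\lambda\in Q\cap P_+$, $E_\lambda=\{\lambda-i\alpha_1\mid i\in\mathbb{N}_+\}\cap P_+\cap Q_{sh}$ and $E'_\lambda=\{\lambda-i\alpha_2\mid i\in\mathbb{N}_+\}\cap P_+\cap Q_{sh}$. *)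

(* Defs.v *)
From HB Require Import structures.
From mathcomp Require Import all_boot all_order all_algebra all_fingroup.
From mathcomp Require Import all_classical.
From mathcomp Require Import zify.

Set Implicit Arguments.
Unset Strict Implicit.
Unset Printing Implicit Defensive.

Import GRing.Theory.

Local Open Scope classical_set_scope.
Local Open Scope ring_scope.

(* Z[v, v^-1], as the subring of the fractions p / v^n inside Q(v). *)
Definition laurent_pred : {pred {fraction {poly int}}} :=
  [pred x | `[< exists (p : {poly int}) (n : nat),
                x = tofrac p / tofrac 'X ^+ n >]].

Lemma laurent_subring : subring_closed laurent_pred.
Proof.
have X0 n : tofrac ('X : {poly int}) ^+ n != 0.
  by rewrite expf_neq0 // tofrac_eq0 polyX_eq0.
split=> [|_ _ /asboolP[p [m ->]] /asboolP[q [n ->]]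
         |_ _ /asboolP[p [m ->]] /asboolP[q [n ->]]]; apply/asboolP.
- by exists 1, 0%N; rewrite tofrac1 expr0 divr1.
- exists (p * 'X ^+ n - q * 'X ^+ m), (m + n)%N.
  rewrite tofracB !tofracM !tofracXn exprD mulrBl; congr (_ - _).
    by rewrite invfM mulrACA divff // mulr1.
  by rewrite invfM [_^-1 / _]mulrC mulrACA divff // mulr1.
- by exists (p * q), (m + n)%N; rewrite tofracM exprD invfM mulrACA.
Qed.

HB.instance Definition _ :=
  GRing.isSubringClosed.Build _ laurent_pred laurent_subring.

Record laurent := Laurent {
  laurent_val :> {fraction {poly int}};
  laurentP : laurent_val \in laurent_pred }.

HB.instance Definition _ := [isSub for laurent_val].
HB.instance Definition _ := [Choice of laurent by <:].
HB.instance Definition _ := [SubChoice_isSubComNzRing of laurent by <:].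

Fact v_subproof : tofrac ('X : {poly int}) \in laurent_pred.
Proof. by apply/asboolP; exists 'X, 0%N; rewrite expr0 divr1. Qed.

Fact vinv_subproof : (tofrac ('X : {poly int}))^-1 \in laurent_pred.
Proof. by apply/asboolP; exists 1, 1%N; rewrite expr1 tofrac1 div1r. Qed.

Definition v : laurent := Laurent v_subproof.
Definition vinv : laurent := Laurent vinv_subproof.

Lemma v_vinv : v * vinv = 1.
Proof. by apply/val_inj; rewrite /= divff // tofrac_eq0 polyX_eq0. Qed.

(* The coweight lattice P in the basis of fundamental coweights, i.e. lambda is
   the pair (<lambda, alpha_1>, <lambda, alpha_2>). *)
Definition coweight : Type := (int * int)%type.
HB.instance Definition _ := GRing.Zmodule.copy coweight (int * int)%type.

Definition alpha1 : coweight := (2, -1).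
Definition alpha2 : coweight := (-1, 2).

Definition root_comb (a b : int) : coweight := alpha1 *~ a + alpha2 *~ b.

Definition coroot_lattice : set coweight :=
  [set l | exists a b, l = root_comb a b].

Definition dominant : set coweight := [set l | 0 <= l.1 /\ 0 <= l.2].

(* The finite Weyl group is 'S_3, acting on P = Z^3 / Z(1,1,1) by permuting
   coordinates; (a, b) is represented by (a + b, b, 0).  Products in 'S_3 are
   composed from left to right, so that (s.x)_i = x_(s i) is a left action. *)
Definition z3_coord (l : coweight) (i : 'I_3) : int := [:: l.1 + l.2; l.2; 0]`_i.

Definition weyl_act (s : 'S_3) (l : coweight) : coweight :=
  (z3_coord l (s 0) - z3_coord l (s 1), z3_coord l (s 1) - z3_coord l (s 2%:R)).

Lemma z3_coord_act s l i :
  z3_coord (weyl_act s l) i = z3_coord l (s i) - z3_coord l (s 2%:R).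
Proof.
have [->|->|->] : [\/ i = 0, i = 1 | i = 2%:R].
  by case: i => [[|[|[|//]]] ?]; [constructor 1|constructor 2|constructor 3];
     apply: val_inj.
- by rewrite {1}/z3_coord /= subrKA.
- by rewrite {1}/z3_coord.
- by rewrite {1}/z3_coord /= subrr.
Qed.

Lemma weyl_act1 l : weyl_act 1%g l = l.
Proof.
by case: l => a b; rewrite /weyl_act !perm1 /z3_coord /= addrK subr0.
Qed.

Lemma weyl_actM s t l : weyl_act (s * t)%g l = weyl_act s (weyl_act t l).
Proof.
by rewrite [RHS]/weyl_act !z3_coord_act /weyl_act !permM !opprB !subrKA.
Qed.

Lemma weyl_actD s l m : weyl_act s (l + m) = weyl_act s l + weyl_act s m.
Proof.
have cD i : z3_coord (l + m) i = z3_coord l i + z3_coord m i.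
  case: i => [[|[|[|//]]] ?]; rewrite /z3_coord //= ?addr0 //.
  by rewrite addrACA.
by rewrite /weyl_act !cD !opprD; congr (_, _); rewrite /= addrACA.
Qed.

Lemma coweight_mulrz (l : coweight) (n : int) : l *~ n = (l.1 *~ n, l.2 *~ n).
Proof.
have mulrn m : l *+ m = (l.1 *+ m, l.2 *+ m).
  by elim: m => [|m IHm]; rewrite ?mulr0n // !mulrS IHm.
by case: n => m; rewrite /intmul !mulrn.
Qed.

Lemma weyl_act_s1 l : weyl_act (tperm 0 1) l = l - alpha1 *~ l.1.
Proof.
case: l => a b; rewrite coweight_mulrz /weyl_act /z3_coord !permE /=.
by congr (_, _); rewrite /= ?mulrzz; lia.
Qed.

Lemma weyl_act_s2 l : weyl_act (tperm 1 2%:R) l = l - alpha2 *~ l.2.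
Proof.
case: l => a b; rewrite coweight_mulrz /weyl_act /z3_coord !permE /=.
by congr (_, _); rewrite /= ?mulrzz; lia.
Qed.

(* P ><| W, the pair (l, u) being t^l u. *)
Definition ext_weyl : Type := (coweight * 'S_3)%type.
HB.instance Definition _ := Choice.copy ext_weyl (coweight * 'S_3)%type.

Definition ext_mul (x y : ext_weyl) : ext_weyl :=
  (x.1 + weyl_act x.2 y.1, (x.2 * y.2)%g).
Definition ext_one : ext_weyl := (0, 1%g).
Definition ext_inv (x : ext_weyl) : ext_weyl :=
  (- weyl_act x.2^-1%g x.1, x.2^-1%g).

Lemma weyl_act0 s : weyl_act s 0 = 0.
Proof. by apply: (addrI (weyl_act s 0)); rewrite -weyl_actD !addr0. Qed.

Lemma weyl_actN s l : weyl_act s (- l) = - weyl_act s l.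
Proof. by apply: (addrI (weyl_act s l)); rewrite -weyl_actD !subrr weyl_act0. Qed.

Fact ext_mulA : associative ext_mul.
Proof. by move=> x y z; rewrite /ext_mul /= weyl_actD weyl_actM addrA mulgA. Qed.

Fact ext_mul1 : left_id ext_one ext_mul.
Proof. by case=> l u; rewrite /ext_mul /= weyl_act1 add0r mul1g. Qed.

Fact ext_mulr1 : right_id ext_one ext_mul.
Proof. by case=> l u; rewrite /ext_mul /= weyl_act0 addr0 mulg1. Qed.

Fact ext_mulV : left_inverse ext_one ext_inv ext_mul.
Proof. by case=> l u; rewrite /ext_mul /= addNr mulVg. Qed.

Fact ext_mulrV : right_inverse ext_one ext_inv ext_mul.
Proof.
by case=> l u; rewrite /ext_mul /= weyl_actN -weyl_actM mulgV weyl_act1 subrr.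
Qed.

HB.instance Definition _ := isGroup.Build ext_weyl
  ext_mulA ext_mul1 ext_mulr1 ext_mulV ext_mulrV.

Definition transl (l : coweight) : ext_weyl := (l, 1%g).
Definition s1 : ext_weyl := (0, tperm 0 1).
Definition s2 : ext_weyl := (0, tperm 1 2%:R).
Definition s0 : ext_weyl := (transl (alpha1 + alpha2) * s1 * s2 * s1)%g.
Definition omega1 : coweight := (1, 0).
Definition tau : ext_weyl := (transl omega1 * s1 * s2)%g.
Definition simple_refls : seq ext_weyl := [:: s0; s1; s2].

Lemma tau_relations :
  [/\ tau ^+ 3 = 1, tau * s0 * tau^-1 = s1, tau * s1 * tau^-1 = s2
    & tau * s2 * tau^-1 = s0]%g.
Proof.
have ext (x y : ext_weyl) : x.1 = y.1 ->
    [/\ x.2 0 = y.2 0, x.2 1 = y.2 1 & x.2 2%:R = y.2 2%:R] -> x = y.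
  case: x y => [l p] [m q] /= -> [h0 h1 h2]; congr (_, _); apply/permP.
  by case=> [[|[|[|//]]] ?]; rewrite -?[Ordinal _]/0; [move: h0|move: h1|move: h2];
    congr (_ = _); congr (_ _); apply: val_inj.
have conj (x y z : ext_weyl) : (x * y = z * x -> x * y * x^-1 = z)%g.
  by move=> ->; rewrite mulgK.
split; [|apply: conj..]; apply: ext => //=;
  by rewrite /weyl_act /z3_coord /= ?permM ?perm1 ?permE.
Qed.

(* 0 if S is empty *)
Definition least (S : set nat) : nat :=
  xget 0%N [set n | S n /\ forall m, S m -> (n <= m)%N].

(* w is a product of n simple reflections times a power of tau. *)
Definition has_word (w : ext_weyl) (n : nat) : Prop :=
  exists (c : seq ext_weyl) (j : nat),
    [/\ {subset c <= simple_refls}, size c = n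
      & w = (\prod_(s <- c) s * tau ^+ j)%g].

Definition len (w : ext_weyl) : nat := least (has_word w).

Definition conj_class (w : ext_weyl) : set ext_weyl := [set (w ^ g)%g | g in setT].

Definition conj_classes : set (set ext_weyl) := range conj_class.

Definition min_len (O : set ext_weyl) : nat := least (len @` O).

Definition x : laurent := v - vinv.

Definition finitely_supported {U : Type} (f : U -> laurent) : Prop :=
  finite_set [set u | f u != 0].

Record is_hecke_algebra (H : algType laurent) (T : ext_weyl -> H) : Prop := {
  hecke_basis : forall h : H, exists! c : ext_weyl -> laurent,
    finitely_supported c /\ h = \sum_(w \in setT) c w *: T w;
  hecke_mul : forall y z : ext_weyl,
    len (y * z)%g = (len y + len z)%N -> T y * T z = T (y * z)%g;
  hecke_quadratic : forall s, s \in simple_refls ->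
    (T s - v%:A) * (T s + vinv%:A) = 0 }.

Definition commutators (H : algType laurent) : set H :=
  [set h | exists r : seq (laurent * (H * H)),
     h = \sum_(q <- r) q.1 *: (q.2.1 * q.2.2 - q.2.2 * q.2.1)].

Definition min_len_section (r : set ext_weyl -> ext_weyl) : Prop :=
  forall O, conj_classes O -> O (r O) /\ len (r O) = min_len O.

(* T_w = sum_O f(O) T_O modulo [H, H], T_O being represented by T_u for an
   arbitrary minimal length element u of O.  The values of f on sets that are
   not conjugacy classes are irrelevant and set to 0. *)
Definition is_class_poly (H : algType laurent) (T : ext_weyl -> H)
    (w : ext_weyl) (f : set ext_weyl -> laurent) : Prop :=
  [/\ forall O, ~ conj_classes O -> f O = 0,
      finitely_supported f
    & forall r, min_len_section r ->
        commutators (T w - \sum_(O \in conj_classes) f O *: T (r O))].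

Definition class_poly (H : algType laurent) (T : ext_weyl -> H)
    (w : ext_weyl) : set ext_weyl -> laurent :=
  xget (fun=> 0) [set f | is_class_poly T w f].

Definition class_O2 : set ext_weyl :=
  [set w | exists2 l, coroot_lattice l
     & w = (transl l * s1 * s2)%g \/ w = (transl l * s2 * s1)%g].

Definition class_O (l : coweight) : set ext_weyl := conj_class (transl l).

Definition class_C (i : nat) : set ext_weyl :=
  [set w | exists k : int,
     [\/ w = (transl (root_comb k i%:Z) * s1)%g,
         w = (transl (root_comb (- i%:Z) k) * s2)%g
       | w = (transl (root_comb k (k - i%:Z)) * s1 * s2 * s1)%g]].

Definition class_C' (i : nat) : set ext_weyl :=
  [set w | exists k : int,
     [\/ w = (transl (root_comb k (- i%:Z)) * s1)%g,
         w = (transl (root_comb i%:Z k) * s2)%g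
       | w = (transl (root_comb (k - i%:Z) k) * s1 * s2 * s1)%g]].

Definition class_ts1 (l : coweight) : set ext_weyl := conj_class (transl l * s1)%g.
Definition class_ts2 (l : coweight) : set ext_weyl := conj_class (transl l * s2)%g.

Definition classes_le_ts1 (l : coweight) : set (set ext_weyl) :=
  [set O | exists i : nat,
     [/\ (0 < i)%N, O = class_C i & (min_len (class_C i) <= min_len (class_ts1 l))%N]].

Definition classes_le_ts2 (l : coweight) : set (set ext_weyl) :=
  [set O | exists i : nat,
     [/\ (0 < i)%N, O = class_C' i & (min_len (class_C' i) <= min_len (class_ts2 l))%N]].

Definition Q_sh : set coweight :=
  coroot_lattice `\`
  [set l | exists k : int, [\/ l = root_comb k (k *+ 2),
                               l = root_comb (k *+ 2) k
                             | l = root_comb k (- k)]].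

Definition below (l a : coweight) : Prop :=
  a - l != 0 /\ exists m n : nat, a - l = root_comb m%:Z n%:Z.

Definition Q_below (a : coweight) : set coweight :=
  [set l | [/\ coroot_lattice l, dominant l & below l a]] `&` Q_sh.

Definition E_set (l : coweight) : set coweight :=
  [set m | exists2 i : nat, (0 < i)%N & m = l - alpha1 *+ i] `&` dominant `&` Q_sh.

Definition E'_set (l : coweight) : set coweight :=
  [set m | exists2 i : nat, (0 < i)%N & m = l - alpha2 *+ i] `&` dominant `&` Q_sh.

(* f has the values prescribed by the rows of a table, and vanishes on the
   classes to which no row applies. *)
Definition tabulated (f : set ext_weyl -> laurent)
    (rows : set ext_weyl -> laurent -> Prop) : Prop :=
  forall O, conj_classes O ->
    (forall c, rows O c -> f O = c) /\ ((forall c, ~ rows O c) -> f O = 0).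

(* The tables of the three cases, without their "0, otherwise" rows. *)
Inductive rows1 (i l : nat) : set ext_weyl -> laurent -> Prop :=
| Rows1_O j : ((i %/ 2).+1 <= j <= (l - 1) %/ 2 - i)%N ->
    rows1 i l (class_O (root_comb j%:Z i%:Z)) x
| Rows1_C : rows1 i l (class_C i) 1.

Inductive rows2 (i k : nat) : set ext_weyl -> laurent -> Prop :=
| Rows2_top : rows2 i k (class_O (root_comb (2 * i)%:Z i%:Z)) x
| Rows2_O2 : rows2 i k class_O2 (k%:R * x)
| Rows2_le O :
    ((classes_le_ts1 (root_comb (2 * i)%:Z i%:Z) `|`
      classes_le_ts2 (root_comb (2 * i)%:Z i%:Z)) `\ class_C i) O ->
    rows2 i k O (k%:R * x ^+ 2)
| Rows2_Q l :
    (Q_below (root_comb (2 * i)%:Z i%:Z) `\` E_set (root_comb (2 * i)%:Z i%:Z)) l ->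
    rows2 i k (class_O l) (k%:R * x ^+ 3)
| Rows2_E l : E_set (root_comb (2 * i)%:Z i%:Z) l ->
    rows2 i k (class_O l) (k%:R * x ^+ 3 + x)
| Rows2_ts1 j : (1 <= j <= k - 1)%N ->
    rows2 i k (class_ts1 (root_comb (2 * i + j + 1)%:Z (i + j)%:Z))
      ((k - j)%:R * x ^+ 2)
| Rows2_ts2 j : (1 <= j <= k - 1)%N ->
    rows2 i k (class_ts2 (root_comb (2 * i + j)%:Z (i + j)%:Z))
      ((k - j)%:R * x ^+ 2)
| Rows2_EE' j l : (1 <= j <= k - 1)%N ->
    (E_set (root_comb (2 * i + j)%:Z (i + j)%:Z) `|`
     E'_set (root_comb (2 * i + j)%:Z (i + j)%:Z)) l ->
    rows2 i k (class_O l) ((k - j)%:R * x ^+ 3)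
| Rows2_O j : (1 <= j <= k - 1)%N ->
    rows2 i k (class_O (root_comb (2 * i + j)%:Z (i + j)%:Z))
      ((k - j)%:R * x ^+ 3 + x)
| Rows2_C : rows2 i k (class_C i) (k%:R * x ^+ 2 + 1).

Inductive rows3 (i k : nat) : set ext_weyl -> laurent -> Prop :=
| Rows3_rows2 O c : rows2 i k O c -> rows3 i k O c
| Rows3_O : rows3 i k (class_O (root_comb (2 * i + k)%:Z (i + k)%:Z)) x.

(* Main.v *)
(** Two elements of the Hecke algebra are compared modulo commutators with three
    moves: conjugation by a length-zero element, conjugation by a simple
    reflection preserving the length, and [T_w = T_(sws) + x T_(sw)] when [sws]
    is shorter than [w] by 2.  Modulo the first move, an element of [C_i] is
    [t^(k a1 + i a2) s1]; for [1 - i <= k <= 2i] each descent produces one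
    translation, and further away it produces alternately a translation and a
    rotation.  The rotation at [(A + 1) a1 + (B + 1) a2] has the closed form
      [O_2 + x (sum_(j <= B) C_j + sum_(j <= A) C'_j) + x^2 sum O_l],
    [l] running over the regular dominant weights bounded by [A a1 + B a2]: lowering
    [A] or [B] removes one reflection, whose own expansion is a column or a row of
    translations.  Summing over the descents gives the tables.

    The coefficients are unique because the [T_O] are linearly independent in the
    cocenter.  Traces of representations of the Hecke algebra induced from the
    parabolic subalgebras (of dimension 6, 3 and 1) specialize at [v = 1] to
    characters that separate the conjugacy classes, so the coefficients of a
    relation vanish at [v = 1]; dividing by [v - 1] and repeating, they vanish. *)

(* [class_poly] is chosen among all solutions of [is_class_poly], so each table needs a solution and
   its uniqueness. A solution must hold for every choice of minimal length representatives; hence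
   for each class that occurs, its minimal length elements are shown equivalent by explicit
   conjugations instead of quoting the general theorem. All computations take place in coordinates
   [mk p q u], where an identity in the group is a case split on the six values of [u] followed by
   linear arithmetic in [p] and [q].

   For uniqueness, the induced representations carry free parameters, specialised to powers of 2 and
   3. At [v = 1] their traces become power sums of numbers [2^a * 3^b], and unique factorisation
   recovers the orbit of a translation or the axis of a reflection. Rotations have no such
   invariant; their class is given by the degree in [P/Q], so every trace is also restricted to one
   degree. Since [tau] permutes [s0], [s1], [s2] cyclically, a representation is determined by the
   matrices of [s1] and [tau], which leaves one quadratic and one braid relation to verify. *)
From HB Require Import structures.
Require Import Defs.
From mathcomp Require Import all_boot all_order all_algebra all_fingroup.
From mathcomp Require Import all_classical.
From mathcomp Require Import zify ring.

Set Implicit Arguments.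
Unset Strict Implicit.
Unset Printing Implicit Defensive.

Import Order.TTheory GRing.Theory Num.Theory.

Local Open Scope ring_scope.

(** * Lengths in the extended affine Weyl group *)

(* [mulgA] at type [ext_weyl]: rewriting with [mulgA] itself leaves unreduced
   structure projections, which [lia] and further rewriting do not recognise. *)
Lemma emulA (y z w : ext_weyl) : (y * (z * w) = y * z * w)%g.
Proof. exact: mulgA. Qed.

(* The finite Weyl group, with a = s1 and b = s2. *)
Inductive dih := D1 | Da | Db | Dab | Dba | Daba.

Definition dih_perm (u : dih) : 'S_3 :=
  let a := tperm 0 1 in let b := tperm 1 2%:R in
  match u with
  | D1 => 1 | Da => a | Db => b | Dab => a * b | Dba => b * a
  | Daba => a * b * a
  end%g.

Definition mula (u : dih) : dih :=
  match u with
  | D1 => Da | Da => D1 | Db => Dab | Dab => Db | Dba => Daba | Daba => Dba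
  end.
Definition mulb (u : dih) : dih :=
  match u with
  | D1 => Db | Db => D1 | Da => Dba | Dba => Da | Dab => Daba | Daba => Dab
  end.
Definition dmul (u w : dih) : dih :=
  match u with
  | D1 => w | Da => mula w | Db => mulb w | Dab => mula (mulb w)
  | Dba => mulb (mula w) | Daba => mula (mulb (mula w))
  end.
Definition dinv (u : dih) : dih :=
  match u with Dab => Dba | Dba => Dab | _ => u end.
Definition dact (u : dih) (p q : int) : int * int :=
  match u with
  | D1 => (p, q) | Da => (- p, p + q) | Db => (p + q, - q)
  | Dab => (- p - q, p) | Dba => (q, - p - q) | Daba => (- q, - p)
  end.

Definition mk (p q : int) (u : dih) : ext_weyl := ((p, q), dih_perm u).

Lemma perm3P (s t : 'S_3) :
  [/\ s 0 = t 0, s 1 = t 1 & s 2%:R = t 2%:R] -> s = t.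
Proof.
case=> h0 h1 h2; apply/permP => -[[|[|[|//]]] h].
- by have -> : Ordinal h = 0 by apply: val_inj.
- by have -> : Ordinal h = 1 by apply: val_inj.
- by have -> : Ordinal h = 2%:R by apply: val_inj.
Qed.

Ltac perm_simp := repeat progress rewrite /= ?permM ?perm1 ?permE.

Lemma dih_permM u w : dih_perm (dmul u w) = (dih_perm u * dih_perm w)%g.
Proof.
by case: u; case: w; apply: perm3P; perm_simp.
Qed.

Lemma dih_permV u : dih_perm (dinv u) = (dih_perm u)^-1%g.
Proof.
apply/eqP; rewrite eq_sym eq_invg_mul -dih_permM.
by case: u.
Qed.

Lemma dih_perm_surj (s : 'S_3) : exists u, s = dih_perm u.
Proof.
have i3 (i : 'I_3) : [\/ i = 0, i = 1 | i = 2%:R].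
  by case: i => [[|[|[|//]]] ?]; [constructor 1|constructor 2|constructor 3];
     apply: val_inj.
have d01 : s 0 != s 1 by rewrite (inj_eq perm_inj).
have d02 : s 0 != s 2%:R by rewrite (inj_eq perm_inj).
have d12 : s 1 != s 2%:R by rewrite (inj_eq perm_inj).
case: (i3 (s 0)) (i3 (s 1)) (i3 (s 2%:R)) => e0 [] e1 [] e2;
  try by move: d01 d02 d12; rewrite e0 e1 e2.
- by exists D1; apply: perm3P; rewrite e0 e1 e2 !perm1.
- by exists Db; apply: perm3P; rewrite e0 e1 e2; perm_simp.
- by exists Da; apply: perm3P; rewrite e0 e1 e2; perm_simp.
- by exists Dba; apply: perm3P; rewrite e0 e1 e2; perm_simp.
- by exists Dab; apply: perm3P; rewrite e0 e1 e2; perm_simp.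
- by exists Daba; apply: perm3P; rewrite e0 e1 e2; perm_simp.
Qed.

Lemma mk_surj (w : ext_weyl) : exists p q u, w = mk p q u.
Proof. by case: w => [[p q] s]; have [u ->] := dih_perm_surj s; exists p, q, u. Qed.

Lemma dih_perm_inj : injective dih_perm.
Proof.
move=> u w e; have: dih_perm (dmul (dinv u) w) = 1%g.
  by rewrite dih_permM dih_permV e mulVg.
have e0 (d : dih) : dih_perm d = 1%g -> d = D1.
  move=> /permP h; have := h 0; have := h 1; by case: d {h} => //=; perm_simp.
by move/e0; case: u {e}; case: w.
Qed.

Lemma mk_inj p q u p' q' u' : mk p q u = mk p' q' u' -> [/\ p = p', q = q' & u = u'].
Proof. by case=> -> -> /dih_perm_inj. Qed.

Lemma weyl_act_dih u p q : weyl_act (dih_perm u) (p, q) = dact u p q.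
Proof.
have ha p' q' : weyl_act (tperm 0 1) (p', q') = (- p', p' + q').
  by rewrite weyl_act_s1 coweight_mulrz /=; congr (_, _); rewrite /= mulrzz; lia.
have hb p' q' : weyl_act (tperm 1 2%:R) (p', q') = (p' + q', - q').
  by rewrite weyl_act_s2 coweight_mulrz /=; congr (_, _); rewrite /= mulrzz; lia.
case: u => /=; rewrite ?weyl_act1 ?weyl_actM ?(ha p q) ?(hb p q) ?hb ?ha //;
  by congr (_, _); lia.
Qed.

Lemma mkM p q u p' q' u' : (mk p q u * mk p' q' u')%g =
  mk (p + (dact u p' q').1) (q + (dact u p' q').2) (dmul u u').
Proof.
change (ext_mul (mk p q u) (mk p' q' u') = mk (p + (dact u p' q').1)
  (q + (dact u p' q').2) (dmul u u')).
by rewrite /ext_mul /mk weyl_act_dih dih_permM.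
Qed.

Lemma mk1 : mk 0 0 D1 = 1%g. Proof. by []. Qed.
Lemma s1E : s1 = mk 0 0 Da. Proof. by []. Qed.
Lemma s2E : s2 = mk 0 0 Db. Proof. by []. Qed.
Lemma translE l : transl l = mk l.1 l.2 D1. Proof. by case: l. Qed.

Lemma s0E : s0 = mk 1 1 Daba.
Proof. by rewrite /s0 translE s1E s2E !mkM. Qed.

Lemma tauE : tau = mk 1 0 Dab.
Proof. by rewrite /tau translE s1E s2E !mkM. Qed.

Lemma mkV p q u :
  ((mk p q u)^-1)%g = mk (- (dact (dinv u) p q).1) (- (dact (dinv u) p q).2) (dinv u).
Proof.
apply: (mulgI (mk p q u)); rewrite mulgV mkM -mk1.
by case: u => /=; congr mk; lia.
Qed.

Lemma tauVE : (tau^-1)%g = mk 0 1 Dba.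
Proof. by rewrite tauE mkV /=; congr mk; lia. Qed.

Lemma tau2E : (tau ^+ 2)%g = mk 0 1 Dba.
Proof. by rewrite expgS expg1 tauE mkM. Qed.

Lemma root_combE a b : root_comb a b = (2 * a - b, 2 * b - a).
Proof.
by rewrite /root_comb !coweight_mulrz /=; congr (_, _); rewrite /= !mulrzz; lia.
Qed.

Definition inva (u : dih) : int := match u with Da | Dab | Daba => 1 | _ => 0 end.
Definition invb (u : dih) : int := match u with Db | Dba | Daba => 1 | _ => 0 end.
Definition invc (u : dih) : int := match u with Dab | Dba | Daba => 1 | _ => 0 end.

(* The length formula of Iwahori and Matsumoto. *)
Definition mklen (p q : int) (u : dih) : nat :=
  (absz (p - inva u)%R + absz (q - invb u)%R + absz (p + q - invc u)%R)%N.

Lemma mem_simple (s : ext_weyl) :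
  s \in simple_refls -> [\/ s = s0, s = s1 | s = s2].
Proof. by rewrite !inE => /or3P[]/eqP ->; [constructor 1|constructor 2|constructor 3]. Qed.

Lemma s0_simple : s0 \in simple_refls. Proof. by rewrite !inE eqxx. Qed.
Lemma s1_simple : s1 \in simple_refls. Proof. by rewrite !inE eqxx orbT. Qed.
Lemma s2_simple : s2 \in simple_refls. Proof. by rewrite !inE eqxx !orbT. Qed.

Lemma s0K : (s0 * s0 = 1)%g. Proof. by rewrite s0E mkM. Qed.
Lemma s1K : (s1 * s1 = 1)%g. Proof. by rewrite s1E mkM. Qed.
Lemma s2K : (s2 * s2 = 1)%g. Proof. by rewrite s2E mkM. Qed.
Lemma simpleK (s : ext_weyl) : s \in simple_refls -> (s * s = 1)%g.
Proof. by case/mem_simple => ->; rewrite (s0K, s1K, s2K). Qed.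
Lemma s0_mk p q u : (s0 * mk p q u)%g = mk (1 - q) (1 - p) (dmul Daba u).
Proof. by rewrite s0E mkM. Qed.
Lemma s1_mk p q u : (s1 * mk p q u)%g = mk (- p) (p + q) (mula u).
Proof. by rewrite s1E mkM !add0r. Qed.
Lemma s2_mk p q u : (s2 * mk p q u)%g = mk (p + q) (- q) (mulb u).
Proof. by rewrite s2E mkM !add0r. Qed.
Lemma tau_mk p q u : (tau * mk p q u)%g = mk (1 - p - q) p (dmul Dab u).
Proof. by rewrite tauE mkM /=; congr mk; lia. Qed.

Lemma mklen0 p q u : mklen p q u = 0%N ->
  exists2 j, (j < 3)%N & mk p q u = (tau ^+ j)%g.
Proof.
rewrite /mklen => h.
have [[-> [-> ->]]|[[-> [-> ->]]|[-> [-> ->]]]] : (p = 0 /\ q = 0 /\ u = D1) \/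
   (p = 1 /\ q = 0 /\ u = Dab) \/ (p = 0 /\ q = 1 /\ u = Dba).
- by case: u h => /= h; solve [exfalso; lia | left; split; [lia|split; [lia|done]]
    | right; left; split; [lia|split; [lia|done]]
    | right; right; split; [lia|split; [lia|done]]].
- by exists 0%N.
- by exists 1%N => //; rewrite expg1 tauE.
- by exists 2%N => //; rewrite tau2E.
Qed.

Lemma mklen_word (s : ext_weyl) p q u : s \in simple_refls ->
  exists p' q' u', (s * mk p q u)%g = mk p' q' u' /\
    (mklen p q u <= (mklen p' q' u').+1)%N.
Proof.
case/mem_simple => ->; [rewrite s0_mk|rewrite s1_mk|rewrite s2_mk];
  do 3 eexists; (split; first by []); by rewrite /mklen; case: u => /=; lia.
Qed.

Lemma mklen_descent p q u : (0 < mklen p q u)%N ->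
  exists2 s : ext_weyl, s \in simple_refls & exists p' q' u',
    (s * mk p q u)%g = mk p' q' u' /\ mklen p q u = (mklen p' q' u').+1.
Proof.
move=> h.
have [e|[e|e]] : mklen p q u = (mklen (1 - q) (1 - p) (dmul Daba u)).+1 \/
    mklen p q u = (mklen (- p) (p + q) (mula u)).+1 \/
    mklen p q u = (mklen (p + q) (- q) (mulb u)).+1.
  by move: h; rewrite /mklen; case: u => /=; lia.
- by exists s0; rewrite ?s0_simple // s0_mk; do 3 eexists; split; eauto.
- by exists s1; rewrite ?s1_simple // s1_mk; do 3 eexists; split; eauto.
- by exists s2; rewrite ?s2_simple // s2_mk; do 3 eexists; split; eauto.
Qed.

Lemma least_eq (S : set nat) n :
  S n -> (forall m, S m -> (n <= m)%N) -> least S = n.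
Proof.
move=> Sn mn; rewrite /least; case: xgetP => [m _ [Sm mm]|/(_ n)[]//].
by apply/eqP; rewrite eqn_leq mn // mm.
Qed.

Lemma mklen_tau j p q u : (tau ^+ j)%g = mk p q u -> mklen p q u = 0%N.
Proof.
elim: j p q u => [|j IHj] p q u.
  by rewrite expg0 -mk1 => /mk_inj[<- <- <-].
have [p' [q' [u' e]]] := mk_surj (tau ^+ j)%g.
rewrite expgS e tau_mk => /mk_inj[<- <- <-].
by have := IHj _ _ _ e; rewrite /mklen; case: u' {e} => /=; lia.
Qed.

(** A descent exists as long as [mklen] is positive, and value 0 leaves only powers of [tau]: this
    builds a word of length [mklen]. No word is shorter, since one letter changes [mklen] by at most
    one and [tau] does not change it. *)
Lemma len_mk p q u : len (mk p q u) = mklen p q u.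
Proof.
apply: least_eq => [|m [c [j [sc <- {m} e]]]].
  elim: {p q u}(mklen p q u) {-2}p {-2}q {-2}u (erefl (mklen p q u)) => [|n IHn] p q u e.
    have [j _ ej] := mklen0 e; exists [::], j; split=> //.
    by rewrite big_nil mul1g.
  have [|s ss [p' [q' [u' [e1 e2]]]]] := @mklen_descent p q u; first by rewrite e.
  have [|c [j [sc cn ec]]] := IHn p' q' u'; first by lia.
  exists (s :: c), j; split; rewrite /= ?cn //.
    by move=> t; rewrite inE => /orP[/eqP->//|/sc].
  by rewrite big_cons -mulgA -ec -e1 mulgA simpleK // mul1g.
elim: c p q u sc e => [|s c IHc] p q u sc.
  by rewrite big_nil mul1g => /esym/mklen_tau ->.
rewrite big_cons -mulgA => e.
have [p' [q' [u' e']]] := mk_surj (\prod_(t <- c) t * tau ^+ j)%g.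
have le1 : (mklen p' q' u' <= size c)%N.
  by apply: IHc; rewrite ?e' // => t tc; apply: sc; rewrite inE tc orbT.
have [|p2 [q2 [u2 [e2 le2]]]] := @mklen_word s p q u; first by apply: sc; rewrite inE eqxx.
have: mk p2 q2 u2 = mk p' q' u'.
  rewrite -e2 e e' mulgA simpleK ?mul1g //.
  by apply: sc; rewrite inE eqxx.
by case/mk_inj=> ep eq eu; rewrite ep eq eu in le2; rewrite /=; lia.
Qed.

(** * Relations modulo commutators *)

Section Cocenter.
Variables (H : algType laurent) (T : ext_weyl -> H).
Hypothesis hT : is_hecke_algebra T.

Definition eqc (g h : H) : Prop := commutators (g - h).

Lemma commutators0 : @commutators H 0.
Proof. by exists [::]; rewrite big_nil. Qed.

Lemma commutatorsD g h : @commutators H g -> commutators h -> commutators (g + h).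
Proof. by case=> r -> [s ->]; exists (r ++ s); rewrite big_cat. Qed.

Lemma commutatorsZ c h : @commutators H h -> commutators (c *: h).
Proof.
case=> r ->; exists [seq (c * q.1, q.2) | q <- r].
by rewrite big_map scaler_sumr; apply: eq_bigr => q _; rewrite scalerA.
Qed.

Lemma commutatorsN h : @commutators H h -> commutators (- h).
Proof. by move/(commutatorsZ (-1)); rewrite scaleN1r. Qed.

Lemma eqc_refl g : eqc g g. Proof. by rewrite /eqc subrr; apply: commutators0. Qed.

Lemma eqc_sym g h : eqc g h -> eqc h g.
Proof. by move/commutatorsN; rewrite opprB. Qed.

Lemma eqc_trans g h k : eqc g h -> eqc h k -> eqc g k.
Proof. by move=> a /(commutatorsD a); rewrite subrKA. Qed.

Lemma eqcD g h g' h' : eqc g h -> eqc g' h' -> eqc (g + g') (h + h').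
Proof. by move=> a /(commutatorsD a); rewrite addrACA -opprD. Qed.

Lemma eqcZ c g h : eqc g h -> eqc (c *: g) (c *: h).
Proof. by move/(commutatorsZ c); rewrite scalerBr. Qed.

Lemma eqcM g h : eqc (g * h) (h * g).
Proof. by exists [:: (1, (g, h))]; rewrite big_seq1 scale1r. Qed.

Lemma T_mul (y z : ext_weyl) : len (y * z)%g = (len y + len z)%N -> T y * T z = T (y * z)%g.
Proof. exact: hecke_mul. Qed.

Lemma T_quad (s : ext_weyl) : s \in simple_refls -> T s * T s = 1 + x *: T s.
Proof.
move/(hecke_quadratic hT); rewrite mulrDr !mulrBl !mulr_algl !mulr_algr scalerA.
rewrite v_vinv scale1r => h; apply: subr0_eq; rewrite -[RHS]h /x scalerBl.
rewrite !opprD opprK -!addrA; congr (_ + _).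
rewrite [RHS]addrC -!addrA addrC -!addrA; congr (_ + _).
Qed.
End Cocenter.

Lemma len_simple (s : ext_weyl) : s \in simple_refls -> len s = 1%N.
Proof. by case/mem_simple => ->; rewrite ?s0E ?s1E ?s2E len_mk. Qed.

Lemma len_tau : len tau = 0%N. Proof. by rewrite tauE len_mk. Qed.

Lemma len_mul_tau (w : ext_weyl) : len (w * tau)%g = len w.
Proof.
have [p [q [u ->]]] := mk_surj w.
by rewrite tauE mkM !len_mk /mklen; case: u => /=; lia.
Qed.

Lemma len_tau_mul (w : ext_weyl) : len (tau * w)%g = len w.
Proof.
have [p [q [u ->]]] := mk_surj w.
by rewrite tauE mkM !len_mk /mklen; case: u => /=; lia.
Qed.

Lemma len_simple_mul (s w : ext_weyl) : s \in simple_refls ->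
  len (s * w)%g = (len w).+1 \/ len w = (len (s * w)%g).+1.
Proof.
have [p [q [u ->]]] := mk_surj w.
by case/mem_simple => ->; rewrite ?s0E ?s1E ?s2E mkM !len_mk /mklen;
  case: u => /=; lia.
Qed.

Lemma len_mul_simple (s w : ext_weyl) : s \in simple_refls ->
  len (w * s)%g = (len w).+1 \/ len w = (len (w * s)%g).+1.
Proof.
have [p [q [u ->]]] := mk_surj w.
by case/mem_simple => ->; rewrite ?s0E ?s1E ?s2E mkM !len_mk /mklen;
  case: u => /=; lia.
Qed.

Section Shifts.
Variables (H : algType laurent) (T : ext_weyl -> H).
Hypothesis hT : is_hecke_algebra T.

Lemma eqc_tau (w : ext_weyl) : eqc (T (tau * w * tau^-1)%g) (T w).
Proof.
have h : len (tau * (w * tau^-1))%g = (len tau + len (w * tau^-1)%g)%N.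
  by rewrite len_tau_mul len_tau.
have h' : len (w * tau^-1 * tau)%g = (len (w * tau^-1)%g + len tau)%N.
  by rewrite len_mul_tau len_tau addn0.
have -> : (tau * w * tau^-1 = tau * (w * tau^-1))%g by rewrite mulgA.
rewrite -(T_mul hT h); apply: eqc_trans (eqcM _ _) _.
by rewrite (T_mul hT h') mulgVK; exact: eqc_refl.
Qed.

(** If [sw] is shorter, then [T w = T s * T (sw)]; moving [T s] to the right gives [T (sws)],
    because [len (sws) = len w] makes the lengths add again. The other case is symmetric. *)
Lemma eqc_shift (s w : ext_weyl) : s \in simple_refls -> len (s * w * s)%g = len w ->
  (len (s * w)%g < len w)%N \/ (len (w * s)%g < len w)%N ->
  eqc (T w) (T (s * w * s)%g).
Proof.
move=> ss e; have ls := len_simple ss.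
case=> lt.
  have {1}-> : T w = T s * T (s * w)%g.
    rewrite (T_mul hT) mulgA simpleK ?mul1g // ls.
    by have := len_simple_mul w ss; lia.
  apply: eqc_trans (eqcM _ _) _; rewrite (T_mul hT) ?ls; first exact: eqc_refl.
  by rewrite e; have := len_simple_mul w ss; lia.
have {1}-> : T w = T (w * s)%g * T s.
  rewrite (T_mul hT) -mulgA simpleK ?mulg1 // ls.
  by have := len_mul_simple w ss; lia.
apply: eqc_trans (eqcM _ _) _; rewrite (T_mul hT) ?ls ?mulgA; first exact: eqc_refl.
by rewrite e; have := len_mul_simple w ss; lia.
Qed.

(** Here [T w = T s * T (sw)] and [T (sw) = T (sws) * T s]. Moving the first [T s] to the right
    produces its square, and the quadratic relation splits it into the two terms. *)
Lemma eqc_reduce (s w : ext_weyl) : s \in simple_refls -> len w = (len (s * w * s)%g + 2)%N ->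
  eqc (T w) (T (s * w * s)%g + x *: T (s * w)%g).
Proof.
move=> ss e; have ls := len_simple ss.
have l1 := len_simple_mul w ss; have l2 := len_mul_simple (s * w)%g ss.
have {1}-> : T w = T s * T (s * w)%g.
  by rewrite (T_mul hT) mulgA simpleK ?mul1g // ls; lia.
have sw : T (s * w)%g = T (s * w * s)%g * T s.
  have h : (s * w * s * s = s * w)%g by rewrite -mulgA simpleK ?mulg1.
  by rewrite (T_mul hT) h // ls; lia.
apply: eqc_trans (eqcM _ _) _.
rewrite {1}sw -mulrA (T_quad hT ss) mulrDr mulr1 -scalerAr -sw.
exact: eqc_refl.
Qed.

End Shifts.

Ltac mkeq := rewrite ?s0E ?s1E ?s2E ?tauVE ?tauE ?mkM /=; congr mk; lia.
Ltac mklia := rewrite /mklen /=; lia.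

Section Moves.
Variables (H : algType laurent) (T : ext_weyl -> H).
Hypothesis hT : is_hecke_algebra T.

Lemma eqc_shift_mk s p1 q1 u1 p2 q2 u2 p q u p' q' u' : s \in simple_refls ->
  (s * mk p q u)%g = mk p1 q1 u1 -> (mk p q u * s)%g = mk p2 q2 u2 ->
  (mk p1 q1 u1 * s)%g = mk p' q' u' -> mklen p' q' u' = mklen p q u ->
  (mklen p1 q1 u1 < mklen p q u)%N \/ (mklen p2 q2 u2 < mklen p q u)%N ->
  eqc (T (mk p q u)) (T (mk p' q' u')).
Proof.
move=> ss e1 e2 e3 l lt; rewrite -e3 -e1; apply: eqc_shift => //.
  by rewrite e1 e3 !len_mk.
by rewrite e1 e2 !len_mk.
Qed.

Lemma eqc_reduce_mk s p1 q1 u1 p q u p' q' u' : s \in simple_refls ->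
  (s * mk p q u)%g = mk p1 q1 u1 -> (mk p1 q1 u1 * s)%g = mk p' q' u' ->
  mklen p q u = (mklen p' q' u' + 2)%N ->
  eqc (T (mk p q u)) (T (mk p' q' u') + x *: T (mk p1 q1 u1)).
Proof.
move=> ss e1 e2 l; rewrite -e2 -e1; apply: eqc_reduce => //.
by rewrite e1 e2 !len_mk.
Qed.

Lemma eqc_mk p q u p' q' : p = p' -> q = q' -> eqc (T (mk p q u)) (T (mk p' q' u)).
Proof. by move=> -> ->; exact: eqc_refl. Qed.

Lemma eqc_tau_mk p q u p' q' u' :
  (tau * mk p q u * tau^-1)%g = mk p' q' u' -> eqc (T (mk p q u)) (T (mk p' q' u')).
Proof. by move=> <-; apply/eqc_sym/eqc_tau. Qed.

(* The basis elements of t^(k a1 + i a2) s1, t^(i a1 + k a2) s2, t^(a a1 + b a2)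
   and t^(a a1 + b a2) s2 s1. *)
Definition R1 (k i : int) : H := T (mk (2 * k - i) (2 * i - k) Da).
Definition R2 (i k : int) : H := T (mk (2 * i - k) (2 * k - i) Db).
Definition T0 (a b : int) : H := T (mk (2 * a - b) (2 * b - a) D1).
Definition R21 (a b : int) : H := T (mk (2 * a - b) (2 * b - a) Dba).

(** Conjugation by [tau] permutes the three directions of reflections cyclically; this and the next
    three lemmas bring every element of [class_C i] to the form [R1] and every element of
    [class_C' i] to the form [R2]. *)
Lemma refl_b_R1 i k : eqc (T (mk (- 2 * i - k) (2 * k + i) Db)) (R1 (k + i) i).
Proof. by apply/eqc_sym/eqc_tau_mk; mkeq. Qed.

Lemma refl_aba_R1 i k : eqc (T (mk (k + i) (k - 2 * i) Daba)) (R1 (i + 1 - k) i).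
Proof. by apply: eqc_tau_mk; mkeq. Qed.

Lemma refl_a_R2 i k : eqc (T (mk (2 * k + i) (- 2 * i - k) Da)) (R2 i (k + i)).
Proof. by apply: eqc_tau_mk; mkeq. Qed.

Lemma refl_aba_R2 i k : eqc (T (mk (k - 2 * i) (k + i) Daba)) (R2 i (i + 1 - k)).
Proof. by apply/eqc_sym/eqc_tau_mk; mkeq. Qed.

(** The element of [R1 k i] has length [|2k - i - 1| + |2i - k| + |k + i|]. In this range it equals
    [3i + |2k - i - 1|], which is symmetric under [k -> i + 1 - k]; conjugation by [s2], then by
    [tau], realises the symmetry. *)
Lemma R1_flip i k : 1 - i <= k <= 2 * i -> eqc (R1 k i) (R1 (i + 1 - k) i).
Proof.
move=> h; apply: eqc_trans (refl_aba_R1 _ _).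
apply: (@eqc_shift_mk s2 (k + i) (k - 2 * i) Dba (2 * k - i) (2 * i - k) Dab);
  first exact: s2_simple; try mkeq; mklia.
Qed.

Lemma R2_flip i k : 1 - i <= k <= 2 * i -> eqc (R2 i k) (R2 i (i + 1 - k)).
Proof.
move=> h; apply: eqc_trans (refl_aba_R2 _ _).
apply: (@eqc_shift_mk s1 (k - 2 * i) (k + i) Dab (2 * i - k) (2 * k - i) Dba);
  first exact: s1_simple; try mkeq; mklia.
Qed.

Lemma R1_s1 i k : 2 * k < i -> eqc (R1 k i) (R1 (i - k) i + x *: T0 (i - k) i).
Proof.
by move=> h; apply: eqc_reduce_mk; first exact: s1_simple; try mkeq; mklia.
Qed.

Lemma R2_s2 i k : 2 * k < i -> eqc (R2 i k) (R2 i (i - k) + x *: T0 i (i - k)).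
Proof.
by move=> h; apply: eqc_reduce_mk; first exact: s2_simple; try mkeq; mklia.
Qed.

(** The flip followed by [R1_s1]: [k -> i + 1 - k -> k - 1]. *)
Lemma R1_down i k : i + 2 < 2 * k -> k <= 2 * i ->
  eqc (R1 k i) (R1 (k - 1) i + x *: T0 (k - 1) i).
Proof.
move=> h1 h2; have -> : k - 1 = i - (i + 1 - k) by lia.
by apply: eqc_trans (R1_flip _) (R1_s1 _); lia.
Qed.

Lemma R2_down i k : i + 2 < 2 * k -> k <= 2 * i ->
  eqc (R2 i k) (R2 i (k - 1) + x *: T0 i (k - 1)).
Proof.
move=> h1 h2; have -> : k - 1 = i - (i + 1 - k) by lia.
by apply: eqc_trans (R2_flip _) (R2_s2 _); lia.
Qed.

(** Beyond the range of [R1_flip], conjugation by [s2] lowers the length by 2 instead of preserving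
    it, and the extra term is a rotation. *)
Lemma R1_far i m : 0 < i -> 1 <= m ->
  eqc (R1 (2 * i + m) i) (R1 (1 - i - m) i + x *: R21 (2 * i + m) (i + m)).
Proof.
move=> hi hm; apply: (@eqc_trans _ _
  (T (mk (2 * i + m + i) (2 * i + m - 2 * i) Daba) + x *: R21 (2 * i + m) (i + m))).
  by apply: eqc_reduce_mk; first exact: s2_simple; try mkeq; mklia.
apply: eqcD; last exact: eqc_refl.
have -> : 1 - i - m = i + 1 - (2 * i + m) by lia.
exact: refl_aba_R1.
Qed.

(* The conjugate by s2 of the element of [R21 a b]. *)
Definition R12 (a b : int) : H := T (mk (a + b) (a - 2 * b) Dab).

Lemma R21_R12 a b : 1 <= a <= 2 * b - 1 -> b <= 2 * a - 1 -> eqc (R21 a b) (R12 a b).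
Proof.
move=> h1 h2; apply: (@eqc_shift_mk s2 (a + b) (a - 2 * b) Da (2 * a - b) (2 * b - a) Daba);
  first exact: s2_simple; try mkeq; mklia.
Qed.

(** [s0] lowers the length by 2, and two conjugations by [tau] bring the shorter rotation back to
    the form [R12]. The orientation is reversed; [R12_column] reverses it again, so the two moves
    can be composed. *)
Lemma R21_row a b : 0 <= a -> 1 <= b <= 2 * a -> a < 2 * b ->
  eqc (R21 (a + 1) (b + 1)) (R12 (a + 1) b + x *: R1 (a + 1) b).
Proof.
move=> h1 h2 h3; apply: (@eqc_trans _ _
  (T (mk (2 - 2 * b + a) (b - 2 * a - 1) Dab) + x *: T (mk (a - 2 * b) (b - 2 * a) Db))).
  by apply: eqc_reduce_mk; first exact: s0_simple; try mkeq; mklia.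
apply: eqcD.
  by apply: eqc_sym; apply: (@eqc_trans _ _ (T (mk (b - 2 * a) (a + b) Dab)));
    apply: eqc_tau_mk; mkeq.
apply: eqcZ; have -> : a + 1 = b + 1 - (- a + b) by lia.
apply: eqc_trans (R1_flip _); last lia.
apply: eqc_trans (refl_b_R1 _ _).
by apply: eqc_mk; lia.
Qed.

Lemma R12_column a b : 0 <= a -> 0 <= b < 2 * a ->
  eqc (R12 (a + 1) (b + 1)) (R21 a (b + 1) + x *: R2 a (b + 1)).
Proof.
move=> h1 h2; apply: (@eqc_trans _ _
  (T (mk (2 * b - a + 1) (1 - a - b) Dba) + x *: T (mk (2 * b - a + 2) (- 1 - a - b) Da))).
  by apply: eqc_reduce_mk; first exact: s0_simple; try mkeq; mklia.
apply: eqcD.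
  by apply: eqc_sym; apply: (@eqc_trans _ _ (T (mk (- a - b) (2 * a - b) Dba)));
    apply: eqc_tau_mk; mkeq.
apply: eqcZ; have -> : b + 1 = (b - a + 1) + a by lia.
apply: eqc_trans (refl_a_R2 _ _).
by apply: eqc_mk; lia.
Qed.

(** The length of a translation is invariant under the finite Weyl group, so conjugation by [s1] is
    a shift; only for [p = 0] does no product with [s1] get shorter, and then the element is
    fixed. *)
Lemma T0_s1 p q : eqc (T (mk p q D1)) (T (mk (- p) (p + q) D1)).
Proof.
have [->|p0] := eqVneq p 0; first by rewrite oppr0 add0r; exact: eqc_refl.
by apply: eqc_shift_mk; first exact: s1_simple; try mkeq; mklia.
Qed.

Lemma T0_s2 p q : eqc (T (mk p q D1)) (T (mk (p + q) (- q) D1)).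
Proof.
have [->|q0] := eqVneq q 0; first by rewrite oppr0 addr0; exact: eqc_refl.
by apply: eqc_shift_mk; first exact: s2_simple; try mkeq; mklia.
Qed.

End Moves.

(** * Conjugacy classes *)

Lemma conj_classP w w' : conj_class w w' <-> exists g, w' = (w ^ g)%g.
Proof. by split=> [[g _ <-]|[g ->]]; [exists g|exists g]. Qed.

Lemma conj_class_refl w : conj_class w w.
Proof. by apply/conj_classP; exists 1%g; rewrite conjg1. Qed.

Lemma conj_class_eq w w' : conj_class w w' -> conj_class w' = conj_class w.
Proof.
move=> /conj_classP[g ->]; apply/seteqP; split=> y /conj_classP[h ->]; apply/conj_classP.
  by exists (g * h)%g; rewrite conjgM.
by exists (g^-1 * h)%g; rewrite conjgM conjgK.
Qed.

Lemma conj_classesP O : conj_classes O <-> exists w, O = conj_class w.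
Proof. by split=> [[w _ <-]|[w ->]]; [exists w|exists w]. Qed.

Definition is_refl (u : dih) : bool :=
  match u with Da | Db | Daba => true | _ => false end.
Definition is_rot (u : dih) : bool :=
  match u with Dab | Dba => true | _ => false end.

(* Position of the axis of a reflection of the plane composed with a translation
   along the axis: it classifies these elements up to conjugacy. *)
Definition axis (p q : int) (u : dih) : int :=
  match u with
  | Da => p + 2 * q | Db => - (2 * p + q) | Daba => p - q | _ => 0
  end.

Lemma conj_mk p q u a b c : exists p' q', (mk p q u ^ mk a b c)%g =
    mk p' q' (dmul (dinv c) (dmul u c)) /\
  let l := dact (dinv c) (p - a + (dact u a b).1) (q - b + (dact u a b).2) in
  p' = l.1 /\ q' = l.2.
Proof.
do 2 eexists; split; first by rewrite conjgE mkV !mkM; reflexivity.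
by case: u; case: c => /=; lia.
Qed.

Lemma refl_conj p q u g : is_refl u -> exists p' q' u',
  [/\ (mk p q u ^ g)%g = mk p' q' u', is_refl u' & axis p' q' u' = axis p q u].
Proof.
have [a [b [c ->]]] := mk_surj g; have [p' [q' [e]]] := conj_mk p q u a b c.
move=> e' hu; do 3 eexists; split; first exact: e; move: e' hu {e};
  by case: u; case: c => //= -[-> ->]; lia.
Qed.

Lemma refl_conj_canon p q u : is_refl u ->
  conj_class (mk (axis p q u) 0 Da) = conj_class (mk p q u).
Proof.
move=> hu; apply: conj_class_eq; apply/conj_classP.
case: u hu => // _.
- by exists (mk (- q) 0 D1); rewrite conjgE mkV !mkM /=; congr mk; lia.
- by exists (mk 0 0 Dab * mk (p + q) 0 D1)%g; rewrite conjgE mkM mkV !mkM /=; congr mk; lia.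
- by exists (mk 0 0 Db * mk q 0 D1)%g; rewrite conjgE mkM mkV !mkM /=; congr mk; lia.
Qed.

Lemma refl_class p q u p' q' u' : is_refl u ->
  conj_class (mk p q u) (mk p' q' u') <-> is_refl u' /\ axis p' q' u' = axis p q u.
Proof.
move=> hu; split=> [/conj_classP[g e]|[hu' e]].
  have [p2 [q2 [u2 [e2 h2 e3]]]] := refl_conj p q g hu.
  by move: e; rewrite e2 => /mk_inj[-> -> ->].
by rewrite -(refl_conj_canon p q hu) -e (refl_conj_canon p' q' hu'); exact: conj_class_refl.
Qed.

Lemma transl_class p q p' q' u' : conj_class (mk p q D1) (mk p' q' u') <->
  u' = D1 /\ exists d, (p', q') = dact d p q.
Proof.
split=> [/conj_classP[g]|[-> [d e]]].
  have [a [b [c ->]]] := mk_surj g; have [p2 [q2 [-> e]]] := conj_mk p q D1 a b c.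
  case/mk_inj => -> -> ->; split; first by case: c {e}.
  exists (dinv c); case: e; rewrite /= !subrK => -> ->.
  by case: (dact _ _ _).
apply/conj_classP; exists (mk 0 0 (dinv d)); rewrite conjgE mkV !mkM.
by move: e; case: d => /= -[-> ->]; congr mk; lia.
Qed.

Definition congr3 (m n : int) : Prop := exists k : int, m = n + 3 * k.

(** Conjugation by translations changes the translation part of a rotation with linear part [w] by
    [(1 - w)P], a sublattice of index 3, given by [p = q] modulo 3. It is equal to [Q], so the
    rotations in [W_a] form a single class. *)
Lemma rot_class p q u p' q' u' : is_rot u ->
  conj_class (mk p q u) (mk p' q' u') <-> is_rot u' /\ congr3 (p' - q') (p - q).
Proof.
move=> hu; split=> [/conj_classP[g]|[hu' [k e]]].
  have [a [b [c ->]]] := mk_surj g; have [p2 [q2 [-> e]]] := conj_mk p q u a b c.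
  case/mk_inj => -> -> ->; move: e hu.
  rewrite /congr3; case: u; case: c => //= -[-> ->] _; (split; first by []);
  match goal with |- exists k, ?m = ?n + 3 * k => exists (divz (m - n) 3) end; lia.
(* [s1] exchanges the two orientations and keeps [p - q] modulo 3, so both elements may be taken of
   type [Dab]. *)
have rot1 a b c : is_rot c -> exists a' b', congr3 (a' - b') (a - b) /\
    conj_class (mk a' b' Dab) = conj_class (mk a b c).
  case: c => // _; first by exists a, b; split=> //; exists 0; lia.
  exists (- a), (a + b); split; first by exists (- a); lia.
  apply: conj_class_eq; apply/conj_classP; exists s1.
  by rewrite conjgE s1E mkV !mkM /=; congr mk; lia.
have [a [b [[k1 h1] <-]]] := rot1 p q u hu.
have [a' [b' [[k2 h2] e2]]] := rot1 p' q' u' hu'.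
rewrite (@conj_class_eq (mk a b Dab) (mk a' b' Dab)) in e2.
  by rewrite e2; exact: conj_class_refl.
have [k' hk'] : exists k', a' - b' = a - b + 3 * k' by exists (k + k2 - k1); lia.
apply/conj_classP; exists (mk (- k') (a - a' + 2 * k') D1); rewrite conjgE mkV !mkM /=.
congr mk; lia.
Qed.

Lemma class_CE (i : nat) : class_C i = conj_class (mk (3 * i%:Z) 0 Da).
Proof.
apply/seteqP; split=> w.
  case=> k []; rewrite root_combE ?translE ?s1E ?s2E !mkM /= => ->;
    by apply/refl_class => //=; split=> //; lia.
have [p [q [u ->]]] := mk_surj w; move=> /refl_class -/(_ isT)[].
case: u => // _ /= h.
- exists (2 * i%:Z - q); apply: Or31; rewrite root_combE translE s1E mkM /=; congr mk; lia.
- exists (- 2 * i%:Z - p); apply: Or32; rewrite root_combE translE s2E mkM /=; congr mk; lia.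
- exists (p - i%:Z); apply: Or33; rewrite root_combE translE s1E s2E !mkM /=; congr mk; lia.
Qed.

Lemma class_C'E (i : nat) : class_C' i = conj_class (mk (- 3 * i%:Z) 0 Da).
Proof.
apply/seteqP; split=> w.
  case=> k []; rewrite root_combE ?translE ?s1E ?s2E !mkM /= => ->;
    by apply/refl_class => //=; split=> //; lia.
have [p [q [u ->]]] := mk_surj w; move=> /refl_class -/(_ isT)[].
case: u => // _ /= h.
- exists (- 2 * i%:Z - q); apply: Or31; rewrite root_combE translE s1E mkM /=; congr mk; lia.
- exists (2 * i%:Z - p); apply: Or32; rewrite root_combE translE s2E mkM /=; congr mk; lia.
- exists (q - i%:Z); apply: Or33; rewrite root_combE translE s1E s2E !mkM /=; congr mk; lia.
Qed.

Lemma class_OE (a b : int) :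
  class_O (root_comb a b) = conj_class (mk (2 * a - b) (2 * b - a) D1).
Proof. by rewrite /class_O root_combE translE. Qed.

Lemma class_O2E : class_O2 = conj_class (mk 0 0 Dab).
Proof.
apply/seteqP; split=> w.
  case=> l [a [b ->]]; rewrite root_combE translE ?s1E ?s2E !mkM /=.
  by case=> ->; apply/rot_class => //; split=> //; exists (a - b); lia.
have [p [q [u ->]]] := mk_surj w; move=> /rot_class -/(_ isT)[hu [k h]].
exists (root_comb (q + 2 * k) (q + k)); first by exists (q + 2 * k), (q + k).
rewrite root_combE translE s1E s2E !mkM /=.
by case: u hu => // _; [left|right]; congr mk; lia.
Qed.

Lemma class_ts1E (a b : nat) : class_ts1 (root_comb a%:Z b%:Z) = class_C b.
Proof.
rewrite class_CE /class_ts1 root_combE translE s1E mkM /=; symmetry.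
by apply: conj_class_eq; apply/refl_class => //=; split=> //; lia.
Qed.

Lemma class_ts2E (a b : nat) : class_ts2 (root_comb a%:Z b%:Z) = class_C' a.
Proof.
rewrite class_C'E /class_ts2 root_combE translE s2E mkM /=; symmetry.
by apply: conj_class_eq; apply/refl_class => //=; split=> //; lia.
Qed.

(* The classes with a nonzero entry in the tables. *)
Inductive lab := LO (a b : nat) | LC (i : nat) | LC' (i : nat) | LR.

Definition lab_eq (l l' : lab) : bool :=
  match l, l' with
  | LO a b, LO a' b' => (a' == a) && (b' == b)
  | LC i, LC i' | LC' i, LC' i' => i' == i
  | LR, LR => true
  | _, _ => false
  end.

Lemma lab_eqP : Equality.axiom lab_eq.
Proof.
move=> l l'; apply: (iffP idP) => [|->].
  by case: l l' => [a b|i|i|] [a' b'|i'|i'|] //=; [case/andP=> /eqP-> /eqP->|move/eqP->..].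
by case: l' => [a b|i|i|] //=; rewrite !eqxx.
Qed.

HB.instance Definition _ := hasDecEq.Build lab lab_eqP.

Lemma lab_eqE l l' : (l == l') = lab_eq l l'. Proof. by []. Qed.

Definition cls (l : lab) : set ext_weyl :=
  match l with
  | LO a b => class_O (root_comb a%:Z b%:Z)
  | LC i => class_C i
  | LC' i => class_C' i
  | LR => class_O2
  end.

(** Dominance of the weight, and positivity of the index. Without them [cls] is not injective:
    [LO 1 0] and [LO 1 1] name the same class, and so do [LC 0] and [LC' 0]. *)
Definition lab_ok (l : lab) : bool :=
  match l with
  | LO a b => (a <= 2 * b)%N && (b <= 2 * a)%N
  | LC i | LC' i => (0 < i)%N
  | LR => true
  end.

Definition cls_rep (l : lab) : ext_weyl :=
  match l with
  | LO a b => mk (2 * a%:Z - b%:Z) (2 * b%:Z - a%:Z) D1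
  | LC i => mk (3 * i%:Z) 0 Da
  | LC' i => mk (- 3 * i%:Z) 0 Da
  | LR => mk 0 0 Dab
  end.

Lemma clsE l : cls l = conj_class (cls_rep l).
Proof.
by case: l => [a b|i|i|]; rewrite /cls /cls_rep (class_OE, class_CE, class_C'E, class_O2E).
Qed.

Lemma cls_conj l : conj_classes (cls l).
Proof. by apply/conj_classesP; exists (cls_rep l); rewrite clsE. Qed.

Lemma cls_inj l l' : lab_ok l -> lab_ok l' -> cls l = cls l' -> l = l'.
Proof.
move=> hl hl' e; have: conj_class (cls_rep l) (cls_rep l').
  by rewrite -clsE e clsE; exact: conj_class_refl.
case: l l' hl hl' {e} => [a b|i|i|] [a' b'|i'|i'|] //= hl hl'.
- move/transl_class=> [_ [d]].
  by case: d => /= -[h1 h2]; (have -> : a = a' by lia); (have -> : b = b' by lia).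
- by move/transl_class=> [].
- by move/transl_class=> [].
- by move/transl_class=> [].
- by move=> /refl_class -/(_ isT)[].
- by move=> /refl_class -/(_ isT)[_ /= h]; have -> : i = i' by lia.
- by move=> /refl_class -/(_ isT)[_ /= h]; exfalso; lia.
- by move=> /refl_class -/(_ isT)[].
- by move=> /refl_class -/(_ isT)[].
- by move=> /refl_class -/(_ isT)[_ /= h]; exfalso; lia.
- by move=> /refl_class -/(_ isT)[_ /= h]; have -> : i = i' by lia.
- by move=> /refl_class -/(_ isT)[].
- by move=> /rot_class -/(_ isT)[].
- by move=> /rot_class -/(_ isT)[].
- by move=> /rot_class -/(_ isT)[].
Qed.

(** * Minimal lengths and equivalence of the minimal length elements *)

Lemma min_len_eq O n w : O w -> len w = n -> (forall w', O w' -> (n <= len w')%N) ->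
  min_len O = n.
Proof.
move=> Ow e h; apply: least_eq; first by exists w.
by move=> m [w' Ow' <-]; exact: h.
Qed.

(** The minimum over [k] of [3i + |2k - i - 1|]: the second term can vanish only for odd [i]. *)
Definition refl_min_len (i : nat) : nat := (3 * i + ~~ odd i)%N.

Lemma refl_len_ge (i : nat) p q u : is_refl u -> absz (axis p q u) = (3 * i)%N ->
  (refl_min_len i <= mklen p q u)%N.
Proof.
rewrite /refl_min_len /mklen; have := odd_double_half i; rewrite -addnn.
by case: (odd i) => /= h; case: u => //= _; lia.
Qed.

Lemma min_len_C i : min_len (class_C i) = refl_min_len i.
Proof.
apply: (@min_len_eq _ _ (mk (2 * (uphalf i)%:Z - i%:Z) (2 * i%:Z - (uphalf i)%:Z) Da)).
- by rewrite class_CE; apply/refl_class => //=; split=> //; lia.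
- rewrite len_mk /refl_min_len /mklen uphalf_half /=.
  by have := odd_double_half i; rewrite -addnn; case: (odd i) => /=; lia.
move=> w; have [p [q [u ->]]] := mk_surj w; rewrite class_CE => /refl_class -/(_ isT)[hu h].
by rewrite len_mk; apply: refl_len_ge => //; rewrite h /=; lia.
Qed.

Lemma min_len_C' i : min_len (class_C' i) = refl_min_len i.
Proof.
apply: (@min_len_eq _ _ (mk (2 * i%:Z - (uphalf i)%:Z) (2 * (uphalf i)%:Z - i%:Z) Db)).
- by rewrite class_C'E; apply/refl_class => //=; split=> //; lia.
- rewrite len_mk /refl_min_len /mklen uphalf_half /=.
  by have := odd_double_half i; rewrite -addnn; case: (odd i) => /=; lia.
move=> w; have [p [q [u ->]]] := mk_surj w; rewrite class_C'E => /refl_class -/(_ isT)[hu h].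
by rewrite len_mk; apply: refl_len_ge => //; rewrite h /=; lia.
Qed.

Section Minimal.
Variables (H : algType laurent) (T : ext_weyl -> H).
Hypothesis hT : is_hecke_algebra T.

Lemma C_normal (i : nat) w : class_C i w -> exists k : int,
  eqc (T w) (R1 T k i) /\ len w = len (mk (2 * k - i%:Z) (2 * i%:Z - k) Da).
Proof.
case=> k []; rewrite root_combE ?translE ?s1E ?s2E !mkM /= => ->.
- by exists k; split; [apply: eqc_mk; lia|rewrite !len_mk; mklia].
- exists (k + i%:Z); split; last by rewrite !len_mk; mklia.
  by apply: eqc_trans (refl_b_R1 hT _ _); apply: eqc_mk; lia.
- exists (i%:Z + 1 - k); split; last by rewrite !len_mk; mklia.
  by apply: eqc_trans (refl_aba_R1 hT _ _); apply: eqc_mk; lia.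
Qed.

Lemma C'_normal (i : nat) w : class_C' i w -> exists k : int,
  eqc (T w) (R2 T i k) /\ len w = len (mk (2 * i%:Z - k) (2 * k - i%:Z) Db).
Proof.
case=> k []; rewrite root_combE ?translE ?s1E ?s2E !mkM /= => ->.
- exists (k + i%:Z); split; last by rewrite !len_mk; mklia.
  by apply: eqc_trans (refl_a_R2 hT _ _); apply: eqc_mk; lia.
- by exists k; split; [apply: eqc_mk; lia|rewrite !len_mk; mklia].
- exists (i%:Z + 1 - k); split; last by rewrite !len_mk; mklia.
  by apply: eqc_trans (refl_aba_R2 hT _ _); apply: eqc_mk; lia.
Qed.

(** Minimality forces [|2k - i - 1| <= 1]: one value of [k] for odd [i], and two values exchanged by
    [R1_flip] for even [i]. *)
Lemma C_minimal (i : nat) w : (0 < i)%N -> class_C i w -> len w = min_len (class_C i) ->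
  eqc (T w) (R1 T (i./2.+1)%:Z i).
Proof.
move=> hi /C_normal[k [e ->]]; rewrite len_mk min_len_C /refl_min_len /mklen /=.
have := odd_double_half i; set h := i./2; rewrite -addnn => hh hl.
apply: eqc_trans e _.
have [->|->] : k = h.+1%:Z \/ k = i%:Z + 1 - h.+1%:Z by case: (odd i) hh hl => /=; lia.
  exact: eqc_refl.
by apply/eqc_sym/R1_flip => //; lia.
Qed.

Lemma C'_minimal (i : nat) w : (0 < i)%N -> class_C' i w -> len w = min_len (class_C' i) ->
  eqc (T w) (R2 T i (i./2.+1)%:Z).
Proof.
move=> hi /C'_normal[k [e ->]]; rewrite len_mk min_len_C' /refl_min_len /mklen /=.
have := odd_double_half i; set h := i./2; rewrite -addnn => hh hl.
apply: eqc_trans e _.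
have [->|->] : k = h.+1%:Z \/ k = i%:Z + 1 - h.+1%:Z by case: (odd i) hh hl => /=; lia.
  exact: eqc_refl.
by apply/eqc_sym/R2_flip => //; lia.
Qed.

(** All elements of the class of a translation have the same length, so no minimality hypothesis
    appears. *)
Lemma transl_orbit p q p' q' u' : conj_class (mk p q D1) (mk p' q' u') ->
  eqc (T (mk p' q' u')) (T (mk p q D1)).
Proof.
move=> /transl_class[-> [d e]]; have [-> ->] : p' = (dact d p q).1 /\ q' = (dact d p q).2.
  by rewrite -e.
have h1 a b := T0_s1 hT a b; have h2 a b := T0_s2 hT a b.
apply: eqc_sym; case: d {e} => /=.
- exact: eqc_refl.
- exact: h1.
- exact: h2.
- by apply: eqc_trans (h2 _ _) (eqc_trans (h1 _ _) _); apply: eqc_mk; lia.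
- by apply: eqc_trans (h1 _ _) (eqc_trans (h2 _ _) _); apply: eqc_mk; lia.
- apply: eqc_trans (h1 _ _) (eqc_trans (h2 _ _) (eqc_trans (h1 _ _) _)).
  by apply: eqc_mk; lia.
Qed.

(** Six elements have length 2, three of each orientation: [tau] permutes each triple cyclically,
    and a shift by [s1] connects the two triples. *)
Lemma O2_minimal w : class_O2 w -> len w = min_len class_O2 -> eqc (T w) (R21 T 1 1).
Proof.
have Rm : min_len class_O2 = 2%N.
  apply: (@min_len_eq _ _ (mk 0 0 Dab)); rewrite ?len_mk //.
    by rewrite class_O2E; exact: conj_class_refl.
  move=> w'; have [p [q [u ->]]] := mk_surj w'.
  rewrite class_O2E => /rot_class -/(_ isT)[hu [k h]].
  by rewrite len_mk /mklen; case: u hu => //= _; lia.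
rewrite Rm class_O2E; have [p [q [u ->]]] := mk_surj w.
move=> /rot_class -/(_ isT)[hu [k h]]; rewrite len_mk => hl.
have b0 : eqc (T (mk 0 0 Dba)) (R21 T 1 1).
  apply: (@eqc_trans _ _ (T (mk 1 1 Dba))); last by apply: eqc_mk; lia.
  by apply: (eqc_tau_mk hT); mkeq.
have b1 : eqc (T (mk (- 1) 2 Dba)) (R21 T 1 1).
  by apply: eqc_trans b0; apply: (eqc_tau_mk hT); mkeq.
have a0 : eqc (T (mk 0 0 Dab)) (R21 T 1 1).
  apply: eqc_trans b0; apply: (@eqc_shift_mk _ _ hT s1 0 0 Db 0 0 Daba);
    first exact: s1_simple; try mkeq; mklia.
have a1 : eqc (T (mk 1 1 Dab)) (R21 T 1 1).
  by apply: eqc_trans a0; apply: (eqc_tau_mk hT); mkeq.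
have a2 : eqc (T (mk 2 (- 1) Dab)) (R21 T 1 1).
  by apply: eqc_trans a1; apply: (eqc_tau_mk hT); mkeq.
move: hl; case: u hu => // _; rewrite /mklen /= => hl.
  have [[-> ->]|[[-> ->]|[-> ->]]] : (p = 0 /\ q = 0) \/ (p = 1 /\ q = 1) \/
    (p = 2 /\ q = - 1) by lia.
  - exact: a0.
  - exact: a1.
  - exact: a2.
have [[-> ->]|[[-> ->]|[-> ->]]] : (p = 0 /\ q = 0) \/ (p = 1 /\ q = 1) \/
    (p = - 1 /\ q = 2) by lia.
- exact: b0.
- by apply: eqc_mk; lia.
- exact: b1.
Qed.

End Minimal.

(** * Expansions of reflections and rotations *)

Definition combination (e : seq (laurent * lab)) (l : lab) : laurent :=
  \sum_(q <- e) q.1 *+ (q.2 == l).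

Section Expansion.
Variables (H : algType laurent) (T : ext_weyl -> H).
Hypothesis hT : is_hecke_algebra T.

(** The witness is a formal sum in which labels may repeat: addition is concatenation, and finite
    support needs no argument. [F] is constrained only on admissible labels, where it has a closed
    form. *)
Definition expands (h : H) (F : lab -> laurent) : Prop :=
  exists e : seq (laurent * lab),
    [/\ all (fun q => lab_ok q.2) e,
        forall l, lab_ok l -> F l = combination e l
      & forall r, min_len_section r ->
          eqc h (\sum_(q <- e) q.1 *: T (r (cls q.2)))].

Lemma expands_eqc g h F : eqc g h -> expands h F -> expands g F.
Proof. by move=> gh [e [e1 e2 e3]]; exists e; split=> // r /e3; apply: eqc_trans. Qed.

Lemma expandsD h h' F G K : expands h F -> expands h' G ->
  (forall l, lab_ok l -> K l = F l + x * G l) -> expands (h + x *: h') K.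
Proof.
move=> [e [e1 e2 e3]] [e' [e1' e2' e3']] hK.
exists (e ++ [seq (x * q.1, q.2) | q <- e']); split.
- by rewrite all_cat e1 all_map.
- move=> l hl; rewrite hK // e2 // e2' // /combination big_cat big_map mulr_sumr.
  by congr (_ + _); apply: eq_bigr => q _; rewrite mulrnAr.
- move=> r hr; rewrite big_cat big_map; apply: eqcD; first exact: e3.
  under eq_bigr do rewrite /= -scalerA; rewrite -scaler_sumr.
  exact/eqcZ/e3'.
Qed.

Lemma expands_ext h F G : expands h F -> (forall l, lab_ok l -> G l = F l) -> expands h G.
Proof. by move=> [e [e1 e2 e3]] hG; exists e; split=> // l hl; rewrite hG // e2. Qed.

Lemma expands_min l h F : lab_ok l ->
  (forall w, cls l w -> len w = min_len (cls l) -> eqc (T w) h) ->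
  (forall l', lab_ok l' -> F l' = (l == l')%:R) -> expands h F.
Proof.
move=> hl hm hF; exists [:: (1, l)]; split; rewrite /= ?hl //.
  by move=> l' hl'; rewrite hF // /combination big_seq1.
move=> r hr; rewrite big_seq1 scale1r; have [r1 r2] := hr _ (cls_conj l).
exact/eqc_sym/hm.
Qed.

Lemma expands_transl (a b : nat) F : lab_ok (LO a b) ->
  (forall l', lab_ok l' -> F l' = (LO a b == l')%:R) -> expands (T0 T a b) F.
Proof.
move=> hl hF; apply: (expands_min hl) => // w; have [p [q [u ->]]] := mk_surj w.
by rewrite /cls class_OE => /(transl_orbit hT).
Qed.

(** Coefficients of [R1 k i] for [i/2 < k <= 2i]: each use of [R1_down] on the way to minimal length
    leaves one translation. The value [k = 2i + 1] describes [R1 (-i) i]. [near'_coef] is the mirror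
    image under the exchange of the simple roots. *)
Definition near_coef (i k : nat) (l : lab) : laurent :=
  match l with
  | LO a b => x *+ [&& b == i, (i < 2 * a)%N & (a < k)%N]
  | LC j => (j == i)%:R
  | _ => 0
  end.

Definition near'_coef (i k : nat) (l : lab) : laurent :=
  match l with
  | LO a b => x *+ [&& a == i, (i < 2 * b)%N & (b < k)%N]
  | LC' j => (j == i)%:R
  | _ => 0
  end.

(** Coefficients of [R21 (A + 1) (B + 1)] for [B <= A <= 2B]. *)
Definition rot_coef (A B : nat) (l : lab) : laurent :=
  match l with
  | LO a b => x ^+ 2 *+ [&& (a < 2 * b)%N, (b < 2 * a)%N, (a <= A)%N & (b <= B)%N]
  | LC j => x *+ (j <= B)
  | LC' j => x *+ (j <= A)
  | LR => 1
  end.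

(* Subtractions are truncated: [k - (j - i)] counts, among the k
   rotations met on the way, with (A, B) = (2i + m, i + m) for 0 <= m < k, those
   in whose expansion [C_j] occurs.  The last summand for [LO a b] counts the translations met at
   (2i + m) a1 + (i + m) a2 for 1 <= m <= d. *)
Definition far_coef (i k d : nat) (l : lab) : laurent :=
  match l with
  | LO a b => x *+ [&& b == i, (i < 2 * a)%N & (a <= 2 * i)%N]
      + x ^+ 3 *+ (if (a < 2 * b)%N && (b < 2 * a)%N
                   then k - maxn (a - 2 * i) (b - i) else 0)%N
      + x *+ [&& a - 2 * i == b - i, 2 * i < a, i < b & b <= i + d]%N
  | LC j => x ^+ 2 *+ (k - (j - i))%N + (j == i)%:R
  | LC' j => x ^+ 2 *+ (k - (j - 2 * i))%N
  | LR => x *+ k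
  end.

Lemma mulrn_eqD (R : nmodType) (y : R) (m n k : nat) : (m = n + k)%N -> y *+ m = y *+ n + y *+ k.
Proof. by move=> ->; rewrite mulrnDr. Qed.

Ltac coef l hl :=
  case: l hl => [a b|j|j|] /= hl; rewrite ?lab_eqE /=.

Lemma R1_near (i k : nat) : (i < 2 * k)%N -> (k <= 2 * i)%N ->
  expands (R1 T k i) (near_coef i k).
Proof.
move=> h1 h2; have hi : (0 < i)%N by lia.
have e := odd_double_half i; rewrite -addnn in e.
have [n en] : exists n, k = (n + i./2.+1)%N by exists (k - i./2.+1)%N; case: (odd i) e; lia.
rewrite {}en in h1 h2 *; elim: n h2 {h1} => [|n IHn] h2.
  rewrite add0n; apply: (@expands_min (LC i)) => //; first by move=> w; exact: C_minimal.
  move=> l hl; coef l hl => //.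
  rewrite (_ : [&& _, _ & _] = false) //; apply/negP => /and3P[_]; case: (odd i) e => /=; lia.
apply: expands_eqc (expandsD (IHn _) (@expands_transl (n + i./2.+1) i _ _ (fun _ _ => erefl)) _).
- rewrite (_ : (n + i./2.+1)%:Z = (n.+1 + i./2.+1)%:Z - 1); last lia.
  by apply: R1_down => //; case: (odd i) e => /=; lia.
- by lia.
- by rewrite /=; case: (odd i) e => /=; lia.
- move=> l hl; coef l hl; rewrite ?mulr0 ?addr0 // mulr_natr.
  by apply: mulrn_eqD; case: (odd i) e => /=; lia.
Qed.

Lemma R2_near (i k : nat) : (i < 2 * k)%N -> (k <= 2 * i)%N ->
  expands (R2 T i k) (near'_coef i k).
Proof.
move=> h1 h2; have hi : (0 < i)%N by lia.
have e := odd_double_half i; rewrite -addnn in e.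
have [n en] : exists n, k = (n + i./2.+1)%N by exists (k - i./2.+1)%N; case: (odd i) e; lia.
rewrite {}en in h1 h2 *; elim: n h2 {h1} => [|n IHn] h2.
  rewrite add0n; apply: (@expands_min (LC' i)) => //; first by move=> w; exact: C'_minimal.
  move=> l hl; coef l hl => //.
  rewrite (_ : [&& _, _ & _] = false) //; apply/negP => /and3P[_]; case: (odd i) e => /=; lia.
apply: expands_eqc (expandsD (IHn _) (@expands_transl i (n + i./2.+1) _ _ (fun _ _ => erefl)) _).
- rewrite (_ : (n + i./2.+1)%:Z = (n.+1 + i./2.+1)%:Z - 1); last lia.
  by apply: R2_down => //; case: (odd i) e => /=; lia.
- by lia.
- by rewrite /=; case: (odd i) e => /=; lia.
- move=> l hl; coef l hl; rewrite ?mulr0 ?addr0 // mulr_natr.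
  by apply: mulrn_eqD; case: (odd i) e => /=; lia.
Qed.

(** One use of [R21_row] and one of [R12_column] lower [n + 1] to [n]. The square of weights loses
    the row [b = n + 1] with its corner, coming from [R1], and the rest of the column [a = n + 1],
    coming from [R2]. *)
Lemma R21_diag (n : nat) : expands (R21 T n.+1%:Z n.+1%:Z) (rot_coef n n).
Proof.
elim: n => [|n IHn].
  apply: (@expands_min LR) => //; first by move=> w; exact: O2_minimal.
  move=> l hl; coef l hl => //; first by rewrite (_ : [&& _, _, _ & _] = false) //; lia.
    by rewrite (_ : (_ <= 0)%N = false) //; lia.
  by rewrite (_ : (_ <= 0)%N = false) //; lia.
have hR1 := @R1_near n.+1 n.+2 ltac:(lia) ltac:(lia).
have hR2 := @R2_near n.+1 n.+1 ltac:(lia) ltac:(lia).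
have hd := expandsD (expandsD IHn hR2 (fun _ _ => erefl)) hR1 (fun _ _ => erefl).
apply: expands_eqc (expands_ext hd _).
- have := @R21_row _ _ hT n.+1 n.+1 ltac:(lia) ltac:(lia) ltac:(lia).
  rewrite (_ : n.+1%:Z + 1 = n.+2); last lia.
  move/eqc_trans; apply; apply: eqcD; last exact: eqc_refl.
  have := @R12_column _ _ hT n.+1 n ltac:(lia) ltac:(lia).
  rewrite (_ : n.+1%:Z + 1 = n.+2); last lia.
  by rewrite (_ : n%:Z + 1 = n.+1); last lia.
- move=> l hl; coef l hl; rewrite ?mulr0 ?addr0 ?mulr_natr //.
  + rewrite !mulrnAr -expr2; rewrite -!mulrnDr; congr (_ *+ _); lia.
  + by rewrite -mulrnDr; congr (_ *+ _); lia.
  + by rewrite -mulrnDr; congr (_ *+ _); lia.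
Qed.

(** Off the diagonal only columns are removed; [d <= c] is the range in which the orientation can be
    changed by [R21_R12] without changing the length. *)
Lemma R21_rot (c d : nat) : (d <= c)%N ->
  expands (R21 T (c + d).+1%:Z c.+1%:Z) (rot_coef (c + d) c).
Proof.
elim: d => [|d IHd] hd; first by rewrite addn0; exact: R21_diag.
have hR2 := @R2_near (c + d.+1) c.+1 ltac:(lia) ltac:(lia).
apply: expands_eqc (expandsD (IHd _) hR2 _); last 2 first.
- by lia.
- move=> l hl; coef l hl; rewrite ?mulr0 ?addr0 ?mulr_natr //.
  + rewrite !mulrnAr -expr2; rewrite -!mulrnDr; congr (_ *+ _); lia.
  + by rewrite -mulrnDr; congr (_ *+ _); lia.
apply: eqc_trans (R21_R12 hT _ _) _; try lia.
have := @R12_column _ _ hT (c + d.+1) c ltac:(lia) ltac:(lia).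
rewrite (_ : (c + d.+1)%:Z + 1 = (c + d.+1).+1); last lia.
rewrite (_ : c%:Z + 1 = c.+1); last lia.
by rewrite (_ : (c + d).+1 = c + d.+1)%N; last lia.
Qed.

(** [k = -i] lies just outside the range of [R1_flip], but [R1_s1] leads from it to [R1 (2i) i]. Its
    length [6i + 1] is the last one of the first table. *)
Lemma R1_far_left0 i : (0 < i)%N -> expands (R1 T (- i%:Z) i) (near_coef i (2 * i).+1).
Proof.
move=> hi; have hn := @R1_near i (2 * i) ltac:(lia) ltac:(lia).
apply: expands_eqc (expandsD hn (@expands_transl (2 * i) i _ _ (fun _ _ => erefl)) _).
- have := @R1_s1 _ _ hT i (- i%:Z) ltac:(lia).
  by rewrite (_ : i%:Z - - i%:Z = (2 * i)%N); last lia.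
- by rewrite /=; lia.
- by move=> l hl; coef l hl; rewrite ?mulr0 ?addr0 // mulr_natr; apply: mulrn_eqD; lia.
Qed.

(** Used for the weight [(2i + m) a1 + i a2], which is not dominant for [m > 0]; [s2] carries it to
    the dominant weight [(2i + m) a1 + (i + m) a2]. *)
Lemma T0_flip (a b : nat) (F : lab -> laurent) h : (b <= a)%N ->
  lab_ok (LO a (a - b)) -> expands h F ->
  expands (h + x *: T0 T a b) (fun l => F l + x * (LO a (a - b) == l)%:R).
Proof.
move=> hab hl hF; apply: expands_eqc (expandsD hF
  (@expands_transl a (a - b) _ hl (fun _ _ => erefl)) (fun _ _ => erefl)).
apply: eqcD; first exact: eqc_refl.
apply/eqcZ/(eqc_trans (T0_s2 hT _ _)).
by apply: eqc_mk; lia.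
Qed.

(** The two sides are proved together because descents alternate between them: [R1_far] goes from
    the right side [m + 1] to the left side [m], leaving a rotation, and [R1_s1] from the left side
    [m + 1] to the right side [m + 1], leaving a translation. *)
Lemma R1_far_left_right i m : (0 < i)%N ->
  expands (R1 T (- i%:Z - m%:Z) i) (far_coef i m m) /\
  expands (R1 T (2 * i%:Z + m.+1%:Z) i) (far_coef i m.+1 m).
Proof.
move=> hi.
have step (n : nat) : expands (R1 T (- i%:Z - n%:Z) i) (far_coef i n n) ->
    expands (R1 T (2 * i%:Z + n.+1%:Z) i) (far_coef i n.+1 n).
  (* The rotation sits at [(2i + n + 1, i + n + 1)], so its coefficients are
     [rot_coef (2i + n) (i + n)]. *)
  move=> hn; have hr := @R21_rot (i + n) i ltac:(lia).
  apply: expands_eqc (expandsD hn hr _).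
    have := @R1_far _ _ hT i n.+1 ltac:(lia) ltac:(lia).
    rewrite (_ : 1 - i%:Z - n.+1%:Z = - i%:Z - n%:Z); last lia.
    rewrite (_ : 2 * i%:Z + n.+1%:Z = (i + n + i).+1); last lia.
    by rewrite (_ : i%:Z + n.+1%:Z = (i + n).+1); last lia.
  move=> l hl; coef l hl.
  (* The new rotation contains a regular weight exactly if [maxn (a - 2i) (b - i) <= n], which is
     when the truncated difference grows by one. *)
  - rewrite [RHS]addrAC; congr (_ + _); rewrite -addrA; congr (_ + _).
    rewrite mulrnAr -exprS -mulrnDr; congr (_ *+ _).
    by case: (a < 2 * b)%N; case: (b < 2 * a)%N => //=; lia.
  - rewrite mulrnAr -expr2 addrAC -mulrnDr; congr (_ *+ _ + _); lia.
  - by rewrite mulrnAr -expr2 -mulrnDr; congr (_ *+ _); lia.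
  - by rewrite mulr1 -mulrSr.
elim: m => [|m [IHl IHr]].
  have h0 : expands (R1 T (- i%:Z - 0%:Z) i) (far_coef i 0 0).
    rewrite subr0; apply: expands_ext (R1_far_left0 hi) _ => l hl; coef l hl.
    - rewrite (_ : (if _ then _ else _) = 0%N); last by case: ifP.
      rewrite mulr0n addr0 [X in _ + X](_ : _ = 0).
        by rewrite addr0; congr (_ *+ _); lia.
      by rewrite (_ : [&& _, _, _ & _] = false); last lia.
    - by rewrite mulr0n add0r.
    - by rewrite mulr0n.
    - by rewrite mulr0n.
  by split=> //; exact: step.
have hl : expands (R1 T (- i%:Z - m.+1%:Z) i) (far_coef i m.+1 m.+1).
  have hok : lab_ok (LO (2 * i + m.+1) (2 * i + m.+1 - i)) by rewrite /=; lia.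
  apply: expands_eqc (expands_ext (@T0_flip (2 * i + m.+1) i _ _ _ hok IHr) _).
  - have := @R1_s1 _ _ hT i (- i%:Z - m.+1%:Z) ltac:(lia).
    rewrite (_ : i%:Z - (- i%:Z - m.+1%:Z) = 2 * i%:Z + m.+1%:Z); last lia.
    by rewrite (_ : (2 * i + m.+1)%:Z = 2 * i%:Z + m.+1%:Z); last lia.
  - by lia.
  - move=> l hl; coef l hl; rewrite ?mulr0 ?addr0 // mulr_natr -[RHS]addrA.
    congr (_ + _); apply: mulrn_eqD; lia.
by split=> //; exact: step.
Qed.

(** These lengths force [-i <= k <= 2i]. Apart from [k = -i], the flip allows [i < 2k], and then the
    length is [2k + 2i - 1]; this is the origin of the bound on the weights in the table. *)
Lemma expands_near (i : nat) w : (0 < i)%N -> class_C i w -> (len w <= 6 * i + 1)%N ->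
  expands (T w) (near_coef i ((len w - 1) %/ 2 - i).+1).
Proof.
move=> hi /C_normal -/(_ _ _ hT)[k [e ->]]; rewrite len_mk => hl.
have := hl; rewrite {1}/mklen /= => hl'.
apply: expands_eqc e _.
have [ek|nk] := eqVneq k (- i%:Z).
  rewrite ek [X in X.+1](_ : _ = 2 * i)%N; first exact: R1_far_left0.
  by rewrite /mklen /=; lia.
have [n en [[n1 n2] ->]] : exists2 n : nat, eqc (R1 T k i) (R1 T n%:Z i) &
    ((i < 2 * n)%N /\ (n <= 2 * i)%N) /\
    mklen (2 * k - i%:Z) (2 * i%:Z - k) Da = (2 * n + 2 * i - 1)%N.
  have [k2|k2] : i%:Z + 1 <= 2 * k \/ 2 * k < i%:Z + 1 by lia.
    exists (absz k); last by rewrite /mklen /=; lia.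
    by rewrite (_ : (absz k)%:Z = k); [exact: eqc_refl | lia].
  exists (absz (i%:Z + 1 - k)%R); last by rewrite /mklen /=; lia.
  rewrite (_ : (absz (i%:Z + 1 - k)%R)%:Z = i%:Z + 1 - k); last by lia.
  by apply: (R1_flip hT); lia.
rewrite (_ : ((2 * n + 2 * i - 1 - 1) %/ 2 - i).+1 = n)%N; last by lia.
by apply: expands_eqc en _; exact: R1_near.
Qed.

(** The length [6i - 1 + 4k] occurs only at [R1 (2i + k) i], and [6i + 1 + 4k] only at
    [R1 (-i - k) i]; the latter has one more translation, hence the last argument [k] instead of
    [k - 1]. *)
Lemma expands_far (i k : nat) w : (0 < i)%N -> class_C i w -> (0 < k)%N ->
  (len w = (6 * i - 1 + 4 * k)%N -> expands (T w) (far_coef i k k.-1)) /\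
  (len w = (6 * i + 1 + 4 * k)%N -> expands (T w) (far_coef i k k)).
Proof.
move=> hi /C_normal -/(_ _ _ hT)[n [e ->]]; rewrite len_mk /mklen /= => hk.
split=> hl; apply: expands_eqc e _.
  have -> : n = 2 * i%:Z + k.-1.+1%:Z by lia.
  by rewrite -[in far_coef _ k _](prednK hk); have [] := R1_far_left_right k.-1 hi.
have -> : n = - i%:Z - k%:Z by lia.
by have [] := R1_far_left_right k hi.
Qed.

End Expansion.

(** * Representations of the Hecke algebra *)

(** The class of the translation part in [P/Q], which is also the exponent of [tau]. *)
Definition deg (w : ext_weyl) : nat := absz (modz (w.1.1 + 2 * w.1.2) 3).

Lemma deg_lt3 (w : ext_weyl) : (deg w < 3)%N.
Proof. by rewrite /deg; lia. Qed.

Lemma deg_mk p q u : deg (mk p q u) = absz (modz (p + 2 * q) 3).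
Proof. by []. Qed.

Lemma deg_simple_mul (s w : ext_weyl) : s \in simple_refls -> deg (s * w)%g = deg w.
Proof.
have [p [q [u ->]]] := mk_surj w.
by case/mem_simple => ->; rewrite ?s0E ?s1E ?s2E mkM !deg_mk /=; lia.
Qed.

Lemma deg_mul_simple (s w : ext_weyl) : s \in simple_refls -> deg (w * s)%g = deg w.
Proof.
have [p [q [u ->]]] := mk_surj w.
by case/mem_simple => ->; rewrite ?s0E ?s1E ?s2E mkM !deg_mk /=; case: u => /=; lia.
Qed.

Lemma deg_tau_mul (w : ext_weyl) : deg (tau * w)%g = ((deg w).+1 %% 3)%N.
Proof.
have [p [q [u ->]]] := mk_surj w.
by rewrite tauE mkM !deg_mk /=; lia.
Qed.

Lemma deg_mul_tau (w : ext_weyl) : deg (w * tau)%g = ((deg w).+1 %% 3)%N.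
Proof.
have [p [q [u ->]]] := mk_surj w.
by rewrite tauE mkM !deg_mk /=; case: u => /=; lia.
Qed.

Lemma len0_tau (w : ext_weyl) : len w = 0%N -> w = (tau ^+ deg w)%g.
Proof.
have [p [q [u ->]]] := mk_surj w; rewrite len_mk => /mklen0[j hj e].
rewrite e; congr (_ ^+ _)%g; case: j hj {e} => [|[|[|//]]] _.
- by rewrite expg0 -mk1.
- by rewrite expg1 tauE.
- by rewrite tau2E.
Qed.

Lemma tau_simple (s : ext_weyl) : s \in simple_refls ->
  exists2 t : ext_weyl, t \in simple_refls & (tau * s = t * tau)%g.
Proof.
case: tau_relations => _ h0 h1 h2; case/mem_simple => ->.
- by exists s1; rewrite ?s1_simple // -h0 mulgVK.
- by exists s2; rewrite ?s2_simple // -h1 mulgVK.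
- by exists s0; rewrite ?s0_simple // -h2 mulgVK.
Qed.

Lemma braid (s t : ext_weyl) : s \in simple_refls -> t \in simple_refls -> s != t ->
  (s * t * s = t * s * t)%g.
Proof.
by case/mem_simple => ->; case/mem_simple => ->; rewrite ?eqxx // => _;
  rewrite ?s0E ?s1E ?s2E !mkM /=; congr mk; lia.
Qed.

(** Two left descents [s] and [t] split off the longest element [sts] of the group they generate. *)
Lemma two_descents (s t w : ext_weyl) : s \in simple_refls -> t \in simple_refls -> s != t ->
  (len (s * w)%g < len w)%N -> (len (t * w)%g < len w)%N ->
  len w = (len (s * t * s * w)%g + 3)%N.
Proof.
have [p [q [u ->]]] := mk_surj w.
by case/mem_simple => ->; case/mem_simple => ->; rewrite ?eqxx // => _;
  rewrite ?s0E ?s1E ?s2E !mkM !len_mk /mklen; case: u => /=; lia.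
Qed.

Lemma exists_descent (w : ext_weyl) : (0 < len w)%N ->
  exists2 s : ext_weyl, s \in simple_refls & (len (s * w)%g < len w)%N.
Proof.
have [p [q [u ->]]] := mk_surj w; rewrite len_mk => /mklen_descent[s ss [a [b [c [e h]]]]].
by exists s => //; rewrite e len_mk h.
Qed.

Lemma len1 : len 1%g = 0%N. Proof. exact: (len_mk 0 0 D1). Qed.

Lemma len_mul_le (y z : ext_weyl) : (len (y * z)%g <= len y + len z)%N.
Proof.
have [n] := ubnP (len y); elim: n y => // n IHn y hn.
have [y0|y_gt0] := posnP (len y).
  rewrite {1}(len0_tau y0); elim: (deg y) => [|d IHd]; first by rewrite expg0 mul1g leq_addl.
  by rewrite expgS -emulA len_tau_mul.
have [s ss ls] := exists_descent y_gt0.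
have h : (len (s * (y * z))%g <= len (s * y)%g + len z)%N.
  by rewrite emulA; apply: IHn (leq_trans ls hn).
by have := len_simple_mul y ss; have := len_simple_mul (y * z)%g ss; lia.
Qed.

(** * From matrices of the generators to all basis elements *)

Section Representation.
Variables (R : pzRingType) (M : ext_weyl -> R) (N : R).
Hypothesis N3 : N ^+ 3 = 1.
Hypothesis NM : forall s t : ext_weyl, s \in simple_refls -> t \in simple_refls ->
  (tau * s = t * tau)%g -> N * M s = M t * N.
Hypothesis Mbraid : forall s t : ext_weyl, s \in simple_refls -> t \in simple_refls -> s != t ->
  M s * M t * M s = M t * M s * M t.

(** The product along one reduced word, [n] being the remaining length. The preference among [s0],
    [s1], [s2] is arbitrary; [rep_descent] shows that it does not matter. *)
Fixpoint rep_rec (n : nat) (w : ext_weyl) : R :=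
  if n is n'.+1 then
    let s := if (len (s0 * w)%g < len w)%N then s0
             else if (len (s1 * w)%g < len w)%N then s1 else s2 in
    M s * rep_rec n' (s * w)%g
  else N ^+ deg w.

Definition rep (w : ext_weyl) : R := rep_rec (len w) w.

Lemma rep0 (w : ext_weyl) : len w = 0%N -> rep w = N ^+ deg w.
Proof. by rewrite /rep => ->. Qed.

Lemma rep1 : rep 1%g = 1.
Proof. by rewrite rep0 -?mk1 ?len_mk // deg_mk expr0. Qed.

Lemma rep_unfold (w : ext_weyl) : (0 < len w)%N ->
  exists s : ext_weyl, [/\ s \in simple_refls, (len (s * w)%g < len w)%N
    & rep w = M s * rep (s * w)%g].
Proof.
move=> hw; have [t st lt] := exists_descent hw.
have [s [se ss ls]] : exists s : ext_weyl, [/\ s = if (len (s0 * w)%g < len w)%N then s0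
      else if (len (s1 * w)%g < len w)%N then s1 else s2,
    s \in simple_refls & (len (s * w)%g < len w)%N].
  case h0 : (len (s0 * w)%g < len w)%N; first by exists s0; rewrite s0_simple.
  case h1 : (len (s1 * w)%g < len w)%N; first by exists s1; rewrite s1_simple.
  exists s2; rewrite s2_simple; split=> //.
  by case/mem_simple: st lt => ->; rewrite ?h0 ?h1.
have h := len_simple_mul w ss.
have [n [en1 en2]] : exists n, len w = n.+1 /\ len (s * w)%g = n.
  by exists (len (s * w)%g); lia.
exists s; split=> //; rewrite /rep en1 en2 /=; congr (M _ * rep_rec _ (_ * _)%g); exact: esym.
Qed.

(* If two simple reflections lower the length of [w], then so does the longest
   element they generate; the braid relation concludes as in Matsumoto's theorem. *)
Lemma rep_descent (s w : ext_weyl) : s \in simple_refls -> (len (s * w)%g < len w)%N ->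
  rep w = M s * rep (s * w)%g.
Proof.
move: s; have [n] := ubnP (len w); elim: n w => // n IHn w hn s ss ls.
have [|t [st lt ->]] := @rep_unfold w; first by lia.
have [->//|nst] := eqVneq s t.
have h3 := two_descents ss st nst ls lt.
have e1 : (s * (t * (s * w)) = s * t * s * w)%g by rewrite !emulA.
have e2 : (t * (s * (t * w)) = s * t * s * w)%g by rewrite !emulA (braid ss st nst).
have a1 := len_simple_mul w ss; have a2 := len_simple_mul w st.
have a3 := len_simple_mul (t * w)%g ss; have a4 := len_simple_mul (s * w)%g st.
have a5 := len_simple_mul (t * (s * w))%g ss; have a6 := len_simple_mul (s * (t * w))%g st.
rewrite e1 in a5; rewrite e2 in a6.
rewrite (IHn (t * w)%g _ s) //; try lia.
rewrite (IHn (s * (t * w))%g _ t) ?e2 //; try lia.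
rewrite (IHn (s * w)%g _ t) //; try lia.
rewrite (IHn (t * (s * w))%g _ s) ?e1 //; try lia.
by rewrite !mulrA (Mbraid ss st nst).
Qed.

Lemma rep_simple_mul (s w : ext_weyl) : s \in simple_refls -> (len w < len (s * w)%g)%N ->
  rep (s * w)%g = M s * rep w.
Proof.
by move=> ss h; rewrite (@rep_descent s) ?emulA ?simpleK ?mul1g.
Qed.

(** [NM] moves [N] through a reduced word; at length zero, [N ^+ 3 = 1] compensates the reduction of
    [deg] modulo 3. *)
Lemma rep_tau_mul (w : ext_weyl) : rep (tau * w)%g = N * rep w.
Proof.
have [n] := ubnP (len w); elim: n w => // n IHn w hn.
have [w0|w_gt0] := posnP (len w).
  rewrite !rep0 ?len_tau_mul // deg_tau_mul -exprS.
  by have := deg_lt3 w; case: (deg w) => [|[|[|//]]].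
have [s ss ls] := exists_descent w_gt0; have [t st e] := tau_simple ss.
have e' : (t * (tau * w) = tau * (s * w))%g.
  by rewrite (emulA t) (emulA tau) e.
rewrite (@rep_descent t) // e' ?len_tau_mul // IHn ?(leq_trans ls) //.
by rewrite (rep_descent ss ls) !mulrA (NM ss st e).
Qed.

Lemma rep_mul (y z : ext_weyl) : len (y * z)%g = (len y + len z)%N -> rep (y * z)%g = rep y * rep z.
Proof.
have [n] := ubnP (len y); elim: n y => // n IHn y hn.
have [y0 _|y_gt0 hyz] := posnP (len y).
  rewrite (rep0 y0) {1}(len0_tau y0); elim: (deg y) => [|d IHd].
    by rewrite expg0 mul1g expr0 mul1r.
  by rewrite expgS -emulA rep_tau_mul IHd exprS mulrA.
have [s ss ls] := exists_descent y_gt0.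
have a1 := len_simple_mul y ss; have a2 := len_simple_mul (y * z)%g ss.
have a3 : (len (s * y * z)%g <= len (s * y)%g + len z)%N.
  exact: len_mul_le.
rewrite emulA in a2.
rewrite (@rep_descent s (y * z)%g) // ?emulA; last by lia.
rewrite IHn; [|by lia|by lia].
by rewrite mulrA -rep_descent.
Qed.

Lemma rep_simple (s : ext_weyl) : s \in simple_refls -> rep s = M s.
Proof.
move=> ss; have e : (s * 1 = s)%g := mulg1 s.
have l : (len 1%g < len (s * 1)%g)%N by rewrite e len1 len_simple.
by have := rep_simple_mul ss l; rewrite e rep1 mulr1.
Qed.

Lemma rep_mul_simple (s w : ext_weyl) : s \in simple_refls -> (len w < len (w * s)%g)%N ->
  rep (w * s)%g = rep w * M s.
Proof.
move=> ss h; have e : len (w * s)%g = (len w + len s)%N.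
  by rewrite (len_simple ss); have := len_mul_simple w ss; lia.
by rewrite (rep_mul e) (rep_simple ss).
Qed.

Lemma rep_mul_tau (w : ext_weyl) : rep (w * tau)%g = rep w * N.
Proof.
have e : len (w * tau)%g = (len w + len tau)%N by rewrite len_mul_tau len_tau addn0.
rewrite (rep_mul e) (rep0 len_tau); congr (_ * _).
by rewrite (_ : deg tau = 1%N) ?expr1 // tauE.
Qed.

End Representation.

(** * Linear functionals vanishing on commutators *)

Notation K := {fraction {poly int}}.

Definition vK : K := tofrac 'X.
Definition xK : K := vK - vK^-1.

Lemma val_laurentD (a b : laurent) : val (a + b) = val a + val b. Proof. exact: rmorphD. Qed.
Lemma val_laurentM (a b : laurent) : val (a * b) = val a * val b. Proof. exact: rmorphM. Qed.
Lemma val_laurent1 : val (1 : laurent) = 1. Proof. exact: rmorph1. Qed.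
Lemma val_laurent0 : val (0 : laurent) = 0. Proof. exact: rmorph0. Qed.
Lemma val_laurentN (a : laurent) : val (- a) = - val a. Proof. exact: rmorphN. Qed.
Lemma val_laurentx : val x = xK. Proof. exact: rmorphB. Qed.

Lemma fsbigT_seq (R : nmodType) (U : choiceType) (F : U -> R) (r : seq U) :
  uniq r -> (forall w, w \notin r -> F w = 0) ->
  \sum_(w \in [set: U]) F w = \sum_(w <- r) F w.
Proof.
move=> ur h; rewrite (fsbigE r) //; last by move=> w _; exact: h.
by apply: eq_bigl => w; rewrite in_setT.
Qed.

Lemma finite_support_seq (U : choiceType) (c : U -> laurent) :
  finitely_supported c <-> exists r : seq U, uniq r /\ forall w, w \notin r -> c w = 0.
Proof.
split=> [fc|[r [_ h]]].
  have /finite_seqP[r er] := fc; exists (undup r); split; first exact: undup_uniq.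
  move=> w; rewrite mem_undup => hw; apply/eqP/negPn/negP => cw.
  have : [set u | c u != 0]%classic w by [].
  by rewrite er /= (negbTE hw).
apply: (@sub_finite_set _ _ [set` r]%classic); last exact: finite_seq.
by move=> w /= cw; apply/negPn/negP => /h e; rewrite e eqxx in cw.
Qed.

Section Coordinates.
Variables (H : algType laurent) (T : ext_weyl -> H).
Hypothesis hT : is_hecke_algebra T.

Definition coord (h : H) : ext_weyl -> laurent := projT1 (cid (hecke_basis hT h)).

Lemma coord_seq h : exists r : seq ext_weyl,
  [/\ uniq r, forall w, w \notin r -> coord h w = 0 & h = \sum_(w <- r) coord h w *: T w].
Proof.
rewrite /coord; case: cid => c /= [[/finite_support_seq[r [ur cr]] e] _].
exists r; split=> //; rewrite {1}e (@fsbigT_seq _ _ _ r) // => w /cr ->.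
by rewrite scale0r.
Qed.

Lemma coord_uniq h (c : ext_weyl -> laurent) (r : seq ext_weyl) : uniq r ->
  (forall w, w \notin r -> c w = 0) -> h = \sum_(w <- r) c w *: T w -> coord h = c.
Proof.
move=> ur cr e; rewrite /coord; case: cid => c' /= [_ hc]; apply: hc; split.
  by apply/finite_support_seq; exists r.
by rewrite e (@fsbigT_seq _ _ _ r) // => w /cr ->; rewrite scale0r.
Qed.

Lemma sum_widen (R : nmodType) (r r' : seq ext_weyl) (F : ext_weyl -> R) :
  uniq r -> uniq r' -> {subset r <= r'} -> (forall w, w \notin r -> F w = 0) ->
  \sum_(w <- r) F w = \sum_(w <- r') F w.
Proof.
move=> ur ur' s h; rewrite -(@fsbigT_seq _ _ F r) // (@fsbigT_seq _ _ F r') //.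
by move=> w hw; apply: h; apply: contra hw; exact: s.
Qed.

Lemma coord_linear a g h w : coord (a *: g + h) w = a * coord g w + coord h w.
Proof.
have [r [ur cr er]] := coord_seq g; have [r' [ur' cr' er']] := coord_seq h.
pose q := undup (r ++ r').
have s : {subset r <= q} by move=> y hy; rewrite mem_undup mem_cat hy.
have s' : {subset r' <= q} by move=> y hy; rewrite mem_undup mem_cat hy orbT.
have uq := undup_uniq (r ++ r').
suff -> : coord (a *: g + h) = fun y => a * coord g y + coord h y by [].
apply: (@coord_uniq _ _ q) => // [y hy|].
  rewrite cr ?cr' ?mulr0 ?addr0 //; apply: contra hy; [exact: s'|exact: s].
rewrite {1}er {1}er' (@sum_widen _ r q) //; last by move=> y /cr ->; rewrite scale0r.
rewrite (@sum_widen _ r' q) //; last by move=> y /cr' ->; rewrite scale0r.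
rewrite scaler_sumr -big_split; apply: eq_bigr => y _.
by rewrite /= scalerA -scalerDl.
Qed.

Lemma coord_T w : coord (T w) = fun y => (y == w)%:R.
Proof.
apply: (@coord_uniq _ _ [:: w]) => //; last by rewrite big_seq1 eqxx scale1r.
by move=> y; rewrite inE => /negbTE ->.
Qed.

Variable g : ext_weyl -> K.

Definition functional (h : H) : K := \sum_(w \in [set: ext_weyl]) val (coord h w) * g w.

Lemma functionalE h r : uniq r -> (forall w, w \notin r -> coord h w = 0) ->
  functional h = \sum_(w <- r) val (coord h w) * g w.
Proof.
by move=> ur cr; apply: fsbigT_seq => // w /cr ->; rewrite val_laurent0 mul0r.
Qed.

Lemma functional_linear a h h' : functional (a *: h + h') = val a * functional h + functional h'.
Proof.
have [r [ur cr _]] := coord_seq h; have [r' [ur' cr' _]] := coord_seq h'.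
pose q := undup (r ++ r'); have uq : uniq q := undup_uniq (r ++ r').
have s y : y \notin q -> (y \notin r) /\ (y \notin r').
  by rewrite mem_undup mem_cat negb_or => /andP.
rewrite !(@functionalE _ q) // => [|y /s[_ /cr']|y /s[/cr]|y /s[h1 h2]] //; last first.
  by rewrite coord_linear cr // cr' // mulr0 addr0.
rewrite mulr_sumr -big_split; apply: eq_bigr => y _.
by rewrite /= coord_linear val_laurentD val_laurentM mulrDl mulrA.
Qed.

Lemma functional0 : functional 0 = 0.
Proof.
have := functional_linear 1 0 0; rewrite scaler0 addr0 val_laurent1 mul1r => /eqP.
by rewrite -[X in X == _]addr0 (inj_eq (addrI _)) => /eqP.
Qed.

Lemma functionalD h h' : functional (h + h') = functional h + functional h'.
Proof. by rewrite -[h]scale1r functional_linear val_laurent1 mul1r scale1r. Qed.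

Lemma functionalZ a h : functional (a *: h) = val a * functional h.
Proof. by rewrite -[a *: h]addr0 functional_linear functional0 addr0. Qed.

Lemma functional_sum (I : Type) (r : seq I) (F : I -> H) :
  functional (\sum_(i <- r) F i) = \sum_(i <- r) functional (F i).
Proof. exact: (big_morph functional functionalD functional0). Qed.

Lemma functional_T w : functional (T w) = g w.
Proof.
rewrite (@functionalE _ [:: w]) //; last by move=> y; rewrite inE coord_T => /negbTE ->.
by rewrite big_seq1 coord_T eqxx val_laurent1 mul1r.
Qed.

Hypothesis g_simple : forall s w : ext_weyl, s \in simple_refls ->
  functional (T s * T w) = functional (T w * T s).
Hypothesis g_tau : forall w : ext_weyl, g (tau * w)%g = g (w * tau)%g.

Lemma functional_central z : (forall w, functional (z * T w) = functional (T w * z)) ->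
  forall h, functional (z * h) = functional (h * z).
Proof.
move=> hz h; have [r [_ _ ->]] := coord_seq h.
rewrite mulr_sumr mulr_suml !functional_sum; apply: eq_bigr => w _.
by rewrite -scalerAr -scalerAl !functionalZ hz.
Qed.

(** The elements [z] with [functional (z * h) = functional (h * z)] for all [h] are closed under
    products, so the generators [T s] and [T tau] suffice. *)
Lemma functional_T_mul w h : functional (T w * h) = functional (h * T w).
Proof.
have tauC h' : functional (T tau * h') = functional (h' * T tau).
  move: h'; apply: functional_central => y.
  rewrite (T_mul hT) ?len_tau_mul ?len_tau // (T_mul hT) ?len_mul_tau ?len_tau ?addn0 //.
  by rewrite !functional_T g_tau.
have mulC y z : (forall h, functional (y * h) = functional (h * y)) ->
    (forall h, functional (z * h) = functional (h * z)) ->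
    forall h, functional (y * z * h) = functional (h * (y * z)).
  by move=> hy hz h'; rewrite -mulrA hy -mulrA hz mulrA.
move: h; have [n] := ubnP (len w); elim: n w => // n IHn w hn.
have [w0|w_gt0] := posnP (len w).
  rewrite (len0_tau w0); elim: (deg w) => [|d IHd].
    apply: functional_central => y; rewrite expg0.
    have l1 : len (1 * y)%g = (len 1%g + len y)%N by rewrite len1 mul1g.
    have l2 : len (y * 1)%g = (len y + len 1%g)%N by rewrite len1 mulg1 addn0.
    by rewrite (T_mul hT l1) (T_mul hT l2) mul1g mulg1.
  have l : len (tau * tau ^+ d)%g = (len tau + len (tau ^+ d)%g)%N.
    by rewrite len_tau_mul len_tau.
  by rewrite expgS -(T_mul hT l); apply: mulC.
have [s ss ls] := exists_descent w_gt0.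
have -> : T w = T s * T (s * w)%g.
  rewrite (T_mul hT) emulA simpleK ?mul1g // (len_simple ss).
  by have := len_simple_mul w ss; lia.
apply: mulC; last exact: IHn (leq_trans ls hn).
by apply: functional_central => y; exact: g_simple.
Qed.

Lemma functional_commutators h : commutators h -> functional h = 0.
Proof.
case=> r ->; rewrite functional_sum big1 // => q _.
rewrite functionalZ; have -> : functional (q.2.1 * q.2.2 - q.2.2 * q.2.1) = 0.
  have hq : functional (q.2.1 * q.2.2) = functional (q.2.2 * q.2.1).
    have [r' [_ _ ->]] := coord_seq q.2.1.
    rewrite mulr_sumr mulr_suml !functional_sum; apply: eq_bigr => w _.
    by rewrite -scalerAr -scalerAl !functionalZ functional_T_mul.
  by rewrite -scaleN1r functionalD functionalZ hq val_laurentN val_laurent1 mulN1r subrr.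
by rewrite mulr0.
Qed.

End Coordinates.

(** * Monomial matrices and their deformation *)

Section Operators.
Variables (F : fieldType) (n : nat) (X : eqType) (enc : 'I_n -> X).
Hypothesis enc_bij : bijective enc.

Definition linear_op (L : (X -> F) -> X -> F) : Prop :=
  forall c f g u, L (fun y => c * f y + g y) u = c * L f u + L g u.

(** Working with operators on functions lets relations be checked pointwise; the matrices provide
    the ring structure and the trace. *)
Definition opmx (L : (X -> F) -> X -> F) : 'M[F]_n :=
  \matrix_(i, j) L (fun y => (y == enc j)%:R) (enc i).

Lemma linear_op0 L : linear_op L -> forall u, L (fun=> 0) u = 0.
Proof.
move=> hL u; have e := hL (-1) (fun=> 0) (fun=> 0) u.
have e0 : (fun=> -1 * 0 + 0) = (fun=> 0) :> (X -> F).
  by apply/funext => y; rewrite mulr0 addr0.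
by rewrite e0 mulN1r addNr in e.
Qed.

Lemma linear_op_sum L (I : Type) (r : seq I) (c : I -> F) (f : I -> X -> F) u :
  linear_op L ->
  L (fun y => \sum_(i <- r) c i * f i y) u = \sum_(i <- r) c i * L (f i) u.
Proof.
move=> hL; elim: r => [|i r IHr].
  rewrite big_nil -[RHS](linear_op0 hL u); congr (L _ u).
  by apply/funext => y; rewrite big_nil.
rewrite big_cons -IHr -hL; congr (L _ u).
by apply/funext => y; rewrite big_cons.
Qed.

Lemma opmxM L L' : linear_op L -> opmx L *m opmx L' = opmx (fun f => L (L' f)).
Proof.
move=> hL; apply/matrixP => i j; rewrite !mxE.
under eq_bigr do rewrite !mxE mulrC.
rewrite -(linear_op_sum _ _ _ _ hL); congr (L _ _); apply/funext => y.
have [dec encK decK] := enc_bij.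
rewrite (bigD1 (dec y)) //= decK eqxx mulr1 big1 ?addr0 // => k hk.
by rewrite (_ : (y == enc k) = false) ?mulr0 //; apply: contraNF hk => /eqP ->; rewrite encK.
Qed.

Lemma opmx_ext L L' : (forall f u, L f u = L' f u) -> opmx L = opmx L'.
Proof. by move=> h; apply/matrixP => i j; rewrite !mxE h. Qed.

Lemma opmx1 : opmx id = 1%:M.
Proof.
by apply/matrixP => i j; rewrite !mxE (bij_eq enc_bij).
Qed.

Lemma opmx_tr L : \tr (opmx L) = \sum_i L (fun y => (y == enc i)%:R) (enc i).
Proof. by apply: eq_bigr => i _; rewrite mxE. Qed.

End Operators.

(* The data of a monomial representation of P ><| W: the weight [wt u] is the
   exponent of the character by which P acts on the basis vector [u]. *)
Record lattice_action (X : Type) (act : dih -> X -> X)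
    (wt : X -> int -> int -> int * int) : Prop := {
  act1 : forall u, act D1 u = u;
  actM : forall y y' u, act (dmul y y') u = act y (act y' u);
  wtD1 : forall u p q p' q', (wt u (p + p') (q + q')).1 = (wt u p q).1 + (wt u p' q').1;
  wtD2 : forall u p q p' q', (wt u (p + p') (q + q')).2 = (wt u p q).2 + (wt u p' q').2;
  wt_act : forall u y p q, wt u (dact y p q).1 (dact y p q).2 = wt (act (dinv y) u) p q }.

Definition dih_of (s : 'S_3) : dih := projT1 (cid (dih_perm_surj s)).

Lemma dih_permK : cancel dih_perm dih_of.
Proof. by move=> u; apply: dih_perm_inj; rewrite /dih_of; case: cid => w /= <-. Qed.

Lemma dmulA u w y : dmul u (dmul w y) = dmul (dmul u w) y.
Proof. by case: u; case: w; case: y. Qed.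

Lemma dinvM u w : dinv (dmul u w) = dmul (dinv w) (dinv u).
Proof. by case: u; case: w. Qed.

Section Monomial.
Variables (F : fieldType) (n : nat) (X : eqType) (enc : 'I_n -> X).
Hypothesis enc_bij : bijective enc.
Variables (act : dih -> X -> X) (wt : X -> int -> int -> int * int).
Hypothesis hact : lattice_action act wt.
Variables (z1 z2 : F).
Hypotheses (z1_neq0 : z1 != 0) (z2_neq0 : z2 != 0).

Definition chi (u : X) (p q : int) : F := z1 ^ (wt u p q).1 * z2 ^ (wt u p q).2.

Lemma chiD u p q p' q' : chi u (p + p') (q + q') = chi u p q * chi u p' q'.
Proof.
by rewrite /chi (wtD1 hact) (wtD2 hact) !expfzDr // mulrACA.
Qed.

Lemma chi_neq0 u p q : chi u p q != 0.
Proof. by rewrite mulf_neq0 // expfz_neq0. Qed.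

Lemma chi0 u : chi u 0 0 = 1.
Proof.
apply: (mulfI (chi_neq0 u 0 0)); rewrite -chiD mulr1.
by congr chi.
Qed.

Lemma chi_act u y p q : chi u (dact y p q).1 (dact y p q).2 = chi (act (dinv y) u) p q.
Proof. by rewrite /chi (wt_act hact). Qed.

(** The action of the group, valid at [v = 1]; [T tau], of length zero, acts by this formula for all
    [v]. *)
Definition mono_op (w : ext_weyl) (f : X -> F) (u : X) : F :=
  chi u w.1.1 w.1.2 * f (act (dinv (dih_of w.2)) u).

Definition mono (w : ext_weyl) : 'M[F]_n := opmx enc (mono_op w).

Lemma mono_opE p q y f u : mono_op (mk p q y) f u = chi u p q * f (act (dinv y) u).
Proof. by rewrite /mono_op /mk /= dih_permK. Qed.

Lemma mono_op_linear w : linear_op (mono_op w).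
Proof. by move=> c f g u; rewrite /mono_op; ring. Qed.

Lemma mono_opM (w w' : ext_weyl) f u : mono_op (w * w')%g f u = mono_op w (mono_op w' f) u.
Proof.
have [p [q [y ->]]] := mk_surj w; have [p' [q' [y' ->]]] := mk_surj w'.
rewrite mkM !mono_opE chiD chi_act dinvM (actM hact); ring.
Qed.

Lemma monoM (w w' : ext_weyl) : mono (w * w')%g = mono w *m mono w'.
Proof.
rewrite /mono opmxM //; last exact: mono_op_linear.
by apply: opmx_ext => f u; rewrite mono_opM.
Qed.

Lemma mono1 : mono 1%g = 1%:M.
Proof.
rewrite -mk1 /mono -(opmx1 F enc_bij); apply: opmx_ext => f u.
by rewrite mono_opE chi0 mul1r /= (act1 hact).
Qed.

Lemma mono_tr p q y : \tr (mono (mk p q y)) =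
  \sum_i (act (dinv y) (enc i) == enc i)%:R * chi (enc i) p q.
Proof. by rewrite opmx_tr; apply: eq_bigr => i _; rewrite mono_opE mulrC. Qed.

Variables (eps : F) (d : X -> F).

Definition refl_op (y : dih) (d' : X -> F) (f : X -> F) (u : X) : F :=
  (if act y u == u then 0 else eps * f (act y u)) + d' u * f u.

Definition conj_diag (u : X) : F := d (act Dba u).

Lemma refl_op_linear y d' : linear_op (refl_op y d').
Proof. by move=> c f g u; rewrite /refl_op; case: ifP => _; ring. Qed.

Lemma tau_refl_op f u :
  mono_op tau (refl_op Da d f) u = refl_op Db conj_diag (mono_op tau f) u.
Proof.
have e : act Da (act Dba u) = act Dba (act Db u) by rewrite -!(actM hact).
have bK : act Dab (act Dba u) = u by rewrite -(actM hact) (act1 hact).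
have bK' : act Dab (act Dba (act Db u)) = act Db u by rewrite -(actM hact) (act1 hact).
(* The translation part [omega1] of [tau] is fixed by [s2]. *)
have ec : chi (act Db u) 1 0 = chi u 1 0 by have := chi_act u Db 1 0; rewrite /= addr0 oppr0 => <-.
rewrite tauE /refl_op !mono_opE /= /conj_diag e ec.
have -> : (act Dba (act Db u) == act Dba u) = (act Db u == u).
  by apply/eqP/eqP => [h|->//]; rewrite -bK' h bK.
by case: ifP => _; ring.
Qed.

(** [s2] and [s0] get the conjugates of the matrix of [s1] by [tau], with [N *m N] as the inverse of
    [N]; compatibility with [tau] then holds by construction. *)
Definition refl_mx (s : ext_weyl) : 'M[F]_n :=
  let A := opmx enc (refl_op Da d) in let N := mono tau in
  if s == s1 then A else if s == s2 then N *m A *m (N *m N) else N *m N *m A *m N.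

End Monomial.

Lemma simple_neq : [/\ s0 != s1, s0 != s2 & s1 != s2].
Proof.
by split; apply/eqP; rewrite ?s0E ?s1E ?s2E => /mk_inj[].
Qed.

Section HeckeRep.
Variables (F : fieldType) (n : nat) (X : eqType) (enc : 'I_n -> X).
Hypothesis enc_bij : bijective enc.
Variables (act : dih -> X -> X) (wt : X -> int -> int -> int * int).
Hypothesis hact : lattice_action act wt.
Variables (z1 z2 : F).
Hypotheses (z1_neq0 : z1 != 0) (z2_neq0 : z2 != 0).
Variables (x0 eps : F) (d : X -> F).

Hypothesis refl_quad : forall f u,
  refl_op act eps Da d (refl_op act eps Da d f) u = f u + x0 * refl_op act eps Da d f u.
Hypothesis refl_braid : forall f u,
  refl_op act eps Da d (refl_op act eps Db (conj_diag act d) (refl_op act eps Da d f)) u =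
  refl_op act eps Db (conj_diag act d)
    (refl_op act eps Da d (refl_op act eps Db (conj_diag act d) f)) u.

Notation mono := (mono enc act wt z1 z2).
Notation refl_mx := (refl_mx enc act wt z1 z2 eps d).

Let N : 'M[F]_n := mono tau.
Let Ma : 'M[F]_n := opmx enc (refl_op act eps Da d).
Let Mb : 'M[F]_n := opmx enc (refl_op act eps Db (conj_diag act d)).

Lemma refl_mx1 : refl_mx s1 = Ma. Proof. by rewrite /refl_mx eqxx. Qed.

Lemma refl_mx_s2 : refl_mx s2 = N * Ma * (N * N).
Proof.
have [_ _ h] := simple_neq.
by rewrite /refl_mx eq_sym (negbTE h) eqxx.
Qed.

Lemma refl_mx_s0 : refl_mx s0 = N * N * Ma * N.
Proof.
have [h1 h2 _] := simple_neq.
by rewrite /refl_mx (negbTE h1) (negbTE h2).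
Qed.

Lemma mono_tau3 : N * N * N = 1.
Proof.
rewrite /N; have h := monoM enc_bij hact z1_neq0 z2_neq0.
have -> : mono tau * mono tau * mono tau = mono (tau * tau * tau)%g by rewrite !h.
have -> : (tau * tau * tau = 1)%g by rewrite !tauE !mkM.
exact: mono1.
Qed.

Lemma refl_mx_s2E : refl_mx s2 = Mb.
Proof.
rewrite refl_mx_s2.
have e : N * Ma = Mb * N.
  rewrite /N /Ma /Mb /mono -!mulmxE
    (opmxM enc_bij _ (mono_op_linear _ _ _ _ _)) (opmxM enc_bij _ (refl_op_linear _ _ _ _)).
  by apply: opmx_ext => f u; exact: tau_refl_op.
by rewrite e -!mulrA (mulrA N N N) mono_tau3 mulr1.
Qed.

Lemma refl_mx_tau (s t : ext_weyl) : s \in simple_refls -> t \in simple_refls ->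
  (tau * s = t * tau)%g -> N * refl_mx s = refl_mx t * N.
Proof.
have [h01 h02 h12] := simple_neq; case: tau_relations => _ e0 e1 e2.
have h3 := mono_tau3.
move=> ss _ e; have -> : t = (tau * s * tau^-1)%g by rewrite e mulgK.
case/mem_simple: ss {e} => ->.
- rewrite e0 refl_mx_s0 refl_mx1 !mulrA h3 mul1r.
  by [].
- rewrite e1 refl_mx_s2 refl_mx1.
  by rewrite -!mulrA (mulrA N N N) h3 mulr1.
- rewrite e2 refl_mx_s2 refl_mx_s0.
  by rewrite !mulrA.
Qed.

Lemma refl_mx_quad (s : ext_weyl) : s \in simple_refls ->
  refl_mx s * refl_mx s = 1 + x0 *: refl_mx s.
Proof.
have qa : Ma * Ma = 1 + x0 *: Ma.
  rewrite /Ma -mulmxE opmxM //; last exact: refl_op_linear.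
  apply/matrixP => i j; rewrite !mxE refl_quad; congr (_ + _).
  by rewrite (bij_eq enc_bij).
have h3 := mono_tau3.
case/mem_simple => ->.
- rewrite refl_mx_s0.
  transitivity (N * N * (Ma * (N * N * N) * Ma) * N); first by rewrite !mulrA.
  rewrite h3 mulr1 qa mulrDr mulrDl mulr1 h3; congr (_ + _).
  by rewrite -!mulmxE -scalemxAr -scalemxAl.
- by rewrite refl_mx1.
- rewrite refl_mx_s2.
  transitivity (N * (Ma * (N * N * N) * Ma) * (N * N)); first by rewrite !mulrA.
  rewrite h3 mulr1 qa mulrDr mulrDl mulr1 mulrA h3; congr (_ + _).
  by rewrite -!mulmxE -scalemxAr -scalemxAl.
Qed.

Lemma refl_mx_braid (s t : ext_weyl) : s \in simple_refls -> t \in simple_refls -> s != t ->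
  refl_mx s * refl_mx t * refl_mx s = refl_mx t * refl_mx s * refl_mx t.
Proof.
have h3 := mono_tau3.
have b12 : refl_mx s1 * refl_mx s2 * refl_mx s1 = refl_mx s2 * refl_mx s1 * refl_mx s2.
  rewrite refl_mx_s2E refl_mx1 /Ma /Mb -!mulmxE.
  have la := refl_op_linear act eps Da d; have lb := refl_op_linear act eps Db (conj_diag act d).
  rewrite -!mulmxA (opmxM enc_bij _ lb) (opmxM enc_bij _ la) (opmxM enc_bij _ la)
    (opmxM enc_bij _ lb).
  exact: opmx_ext.
(* Conjugation by the inverse of [tau] sends [s1] to [s0], [s2] to [s1] and [s0] to [s2], so the
   three braid relations follow from one. *)
pose cj (A : 'M[F]_n) := N * N * A * N.
have cjM A B : cj (A * B) = cj A * cj B.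
  rewrite /cj; transitivity (N * N * A * (N * N * N) * B * N); last by rewrite !mulrA.
  by rewrite h3 mulr1 !mulrA.
have c1 : cj (refl_mx s1) = refl_mx s0 by rewrite refl_mx1 refl_mx_s0.
have c2 : cj (refl_mx s2) = refl_mx s1.
  rewrite refl_mx1 refl_mx_s2 /cj; transitivity (N * N * N * Ma * (N * N * N)).
    by rewrite !mulrA.
  by rewrite h3 mul1r mulr1.
have c0 : cj (refl_mx s0) = refl_mx s2.
  rewrite refl_mx_s0 refl_mx_s2 /cj; transitivity (N * N * N * (N * Ma * (N * N))).
    by rewrite !mulrA.
  by rewrite h3 mul1r.
have b01 : refl_mx s0 * refl_mx s1 * refl_mx s0 = refl_mx s1 * refl_mx s0 * refl_mx s1.
  by have := congr1 cj b12; rewrite !cjM c1 c2.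
have b20 : refl_mx s2 * refl_mx s0 * refl_mx s2 = refl_mx s0 * refl_mx s2 * refl_mx s0.
  by have := congr1 cj b01; rewrite !cjM c0 c1.
by case/mem_simple => ->; case/mem_simple => ->; rewrite ?eqxx // => _;
   rewrite ?b12 ?b01 ?b20.
Qed.

End HeckeRep.

(** * Traces of representations as functionals *)

Section Products.
Variables (H : algType laurent) (T : ext_weyl -> H).
Hypothesis hT : is_hecke_algebra T.

Lemma T_simple_up (s w : ext_weyl) : s \in simple_refls -> (len w < len (s * w)%g)%N ->
  T s * T w = T (s * w)%g.
Proof.
move=> ss l; rewrite (T_mul hT) // (len_simple ss).
by have := len_simple_mul w ss; lia.
Qed.

Lemma T_simple_down (s w : ext_weyl) : s \in simple_refls -> (len (s * w)%g < len w)%N ->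
  T s * T w = T (s * w)%g + x *: T w.
Proof.
move=> ss l; have e : (s * (s * w) = w)%g by rewrite emulA simpleK ?mul1g.
have h : T s * T (s * w)%g = T w by rewrite T_simple_up ?e.
rewrite -[in LHS]h mulrA (T_quad hT ss) mulrDl mul1r -scalerAl h.
by [].
Qed.

Lemma T_up_simple (s w : ext_weyl) : s \in simple_refls -> (len w < len (w * s)%g)%N ->
  T w * T s = T (w * s)%g.
Proof.
move=> ss l; rewrite (T_mul hT) // (len_simple ss).
by have := len_mul_simple w ss; lia.
Qed.

Lemma T_down_simple (s w : ext_weyl) : s \in simple_refls -> (len (w * s)%g < len w)%N ->
  T w * T s = T (w * s)%g + x *: T w.
Proof.
move=> ss l; have e : (w * s * s = w)%g by rewrite -emulA simpleK ?mulg1.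
have h : T (w * s)%g * T s = T w by rewrite T_up_simple ?e.
rewrite -[in LHS]h -mulrA (T_quad hT ss) mulrDr mulr1 -scalerAr h.
by [].
Qed.

End Products.

Section TraceForm.
Variables (H : algType laurent) (T : ext_weyl -> H).
Hypothesis hT : is_hecke_algebra T.
Variables (n : nat) (M : ext_weyl -> 'M[K]_n) (N : 'M[K]_n).
Hypothesis N3 : N * N * N = 1.
Hypothesis NM : forall s t : ext_weyl, s \in simple_refls -> t \in simple_refls ->
  (tau * s = t * tau)%g -> N * M s = M t * N.
Hypothesis Mbraid : forall s t : ext_weyl, s \in simple_refls -> t \in simple_refls ->
  s != t -> M s * M t * M s = M t * M s * M t.
Hypothesis Mquad : forall s : ext_weyl, s \in simple_refls -> M s * M s = 1 + xK *: M s.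

Let r : ext_weyl -> 'M[K]_n := rep (R := 'M[K]_n) M N.

Definition trace_form (j : nat) (w : ext_weyl) : K := (deg w == j)%:R * \tr (r w).

Lemma N3X : N ^+ 3 = 1. Proof. by rewrite !exprS expr0 mulr1 mulrA. Qed.

Lemma Mq (s : ext_weyl) : s \in simple_refls -> M s *m M s = 1%:M + xK *: M s.
Proof. exact: Mquad. Qed.

(** Whether [s] raises or lowers the length, the value on [T s * T w] is the trace of [M s *m r w]
    in the degree of [w], thanks to the quadratic relation; the symmetry of the trace compares it
    with [T w * T s]. *)
Lemma trace_form_commutators j h :
  @commutators H h -> functional hT (trace_form j) h = 0.
Proof.
apply: functional_commutators => [s w ss|w].
  have lhs : functional hT (trace_form j) (T s * T w) =
      (deg w == j)%:R * \tr (M s *m r w).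
    have [l|l] := len_simple_mul w ss.
      rewrite (T_simple_up hT ss) ?l // functional_T /trace_form (deg_simple_mul w ss).
      by rewrite /r (rep_simple_mul (R := 'M[K]_n) N Mbraid ss) ?l // mulmxE.
    have l' : (len (s * w)%g < len w)%N by rewrite l.
    rewrite (T_simple_down hT ss l') functionalD functionalZ !functional_T val_laurentx.
    rewrite /trace_form (deg_simple_mul w ss) mulrCA -mulrDr; congr (_ * _).
    have -> : r w = M s * r (s * w)%g by exact: (rep_descent (R := 'M[K]_n) N Mbraid ss l').
    by rewrite -mulmxE mulmxA (Mq ss) mulmxDl mul1mx -scalemxAl mxtraceD mxtraceZ.
  have rhs : functional hT (trace_form j) (T w * T s) =
      (deg w == j)%:R * \tr (r w *m M s).
    have [l|l] := len_mul_simple w ss.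
      rewrite (T_up_simple hT ss) ?l // functional_T /trace_form (deg_mul_simple w ss).
      by rewrite /r (rep_mul_simple (R := 'M[K]_n) N3X NM Mbraid ss) ?l // mulmxE.
    have l' : (len (w * s)%g < len w)%N by rewrite l.
    rewrite (T_down_simple hT ss l') functionalD functionalZ !functional_T val_laurentx.
    rewrite /trace_form (deg_mul_simple w ss) mulrCA -mulrDr; congr (_ * _).
    have -> : r w = r (w * s)%g * M s.
      have e : (w * s * s = w)%g by rewrite -emulA simpleK ?mulg1.
      rewrite -{1}e; apply: (rep_mul_simple (R := 'M[K]_n) N3X NM Mbraid ss).
      by rewrite e.
    by rewrite -mulmxE -mulmxA (Mq ss) mulmxDr mulmx1 -scalemxAr mxtraceD mxtraceZ.
  by rewrite lhs rhs mxtrace_mulC.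
rewrite /trace_form deg_tau_mul deg_mul_tau /r (rep_tau_mul (R := 'M[K]_n) N3X NM Mbraid).
by rewrite (rep_mul_tau (R := 'M[K]_n) N3X NM Mbraid) -!mulmxE mxtrace_mulC.
Qed.

End TraceForm.

(* [at_one y c]: the fraction [y] is defined at [v = 1], with value [c] there. *)
Definition at_one (y : K) (c : rat) : Prop := exists p q : {poly int},
  [/\ q.[1] != 0, y * tofrac q = tofrac p & c * q.[1]%:~R = p.[1]%:~R].

Lemma at_one_poly (p : {poly int}) : at_one (tofrac p) p.[1]%:~R.
Proof. by exists p, 1; rewrite hornerC tofrac1 !mulr1. Qed.

Lemma at_one_nat m : at_one m%:R m%:R.
Proof.
have := at_one_poly m%:R; rewrite (_ : tofrac m%:R = m%:R) ?rmorph_nat //.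
by rewrite -polyC_natr hornerC natz -pmulrn.
Qed.

Lemma at_oneM y y' c c' : at_one y c -> at_one y' c' -> at_one (y * y') (c * c').
Proof.
move=> [p [q [q1 e1 e2]]] [p' [q' [q1' e1' e2']]]; exists (p * p'), (q * q').
rewrite !hornerM mulf_neq0 // !rmorphM /= -e1 -e1' -e2 -e2'; split=> //.
  by rewrite mulrACA.
by rewrite mulrACA.
Qed.

Lemma at_oneD y y' c c' : at_one y c -> at_one y' c' -> at_one (y + y') (c + c').
Proof.
move=> [p [q [q1 e1 e2]]] [p' [q' [q1' e1' e2']]].
exists (p * q' + p' * q), (q * q'); split.
- by rewrite hornerM mulf_neq0.
- rewrite tofracD !tofracM -e1 -e1'; ring.
- rewrite hornerD !hornerM rmorphD !rmorphM /= -e2 -e2'; ring.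
Qed.

Lemma at_oneN y c : at_one y c -> at_one (- y) (- c).
Proof.
move=> [p [q [q1 e1 e2]]]; exists (- p), q; split=> //.
  by rewrite tofracN -e1 mulNr.
by rewrite hornerN rmorphN /= -e2 mulNr.
Qed.

Lemma at_one0 c : at_one 0 c -> c = 0.
Proof.
move=> [p [q [q1 e1 e2]]]; rewrite mul0r in e1.
have p0 : p = 0 by apply/eqP; rewrite -tofrac_eq0 -e1.
apply/eqP; move/eqP: e2; rewrite p0 horner0 mulf_eq0 intr_eq0 (negbTE q1) orbF.
by [].
Qed.

Lemma at_oneV y c : at_one y c -> c != 0 -> at_one y^-1 c^-1.
Proof.
move=> h c0; have y0 : y != 0 by apply: contra_neq c0 => e; apply: at_one0; rewrite -e.
case: h => p [q [q1 e1 e2]]; exists q, p.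
have p1 : p.[1] != 0.
  by rewrite -(intr_eq0 rat) -e2 mulf_neq0 // intr_eq0.
split=> //; first by rewrite -e1 mulKf.
by rewrite -e2 mulKf.
Qed.

Lemma at_one_sum (I : Type) (s : seq I) (P : pred I) (f : I -> K) (g : I -> rat) :
  (forall i, at_one (f i) (g i)) ->
  at_one (\sum_(i <- s | P i) f i) (\sum_(i <- s | P i) g i).
Proof.
by move=> h; elim/big_ind2: _ => // [|y c y' c']; [exact: (at_one_nat 0)|exact: at_oneD].
Qed.

Lemma at_one_exp y c (m : int) : at_one y c -> c != 0 -> at_one (y ^ m) (c ^ m).
Proof.
have pos y' c' (k : nat) : at_one y' c' -> at_one (y' ^+ k) (c' ^+ k).
  move=> h; elim: k => [|k IHk]; first exact: (at_one_nat 1).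
  by rewrite !exprS; exact: at_oneM.
case: m => k h c0; first exact: pos.
by rewrite !NegzE -!exprnN; apply: at_oneV; [exact: pos|exact: expf_neq0].
Qed.

Lemma at_one_v : at_one vK 1.
Proof. by have := at_one_poly 'X; rewrite hornerX. Qed.

Lemma at_one_vV : at_one vK^-1 1.
Proof. by rewrite -[1]invr1; apply: at_oneV at_one_v _. Qed.

Lemma at_one_x : at_one xK 0.
Proof. by rewrite -(subrr 1); apply: at_oneD at_one_v (at_oneN at_one_vV). Qed.

Lemma at_one_mx m n p (A : 'M[K]_(m, n)) (A' : 'M[rat]_(m, n))
    (B : 'M[K]_(n, p)) (B' : 'M[rat]_(n, p)) :
  (forall i j, at_one (A i j) (A' i j)) -> (forall i j, at_one (B i j) (B' i j)) ->
  forall i j, at_one ((A *m B) i j) ((A' *m B') i j).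
Proof.
by move=> hA hB i j; rewrite !mxE; apply: at_one_sum => k; exact: at_oneM.
Qed.

Definition odd_weyl (w : ext_weyl) : bool := is_refl (dih_of w.2).

Lemma odd_mk p q u : odd_weyl (mk p q u) = is_refl u.
Proof. by rewrite /odd_weyl /mk dih_permK. Qed.

Lemma odd_simple_mul (s w : ext_weyl) : s \in simple_refls ->
  odd_weyl (s * w)%g = ~~ odd_weyl w.
Proof.
have [p [q [u ->]]] := mk_surj w.
by case/mem_simple => ->; rewrite ?s0E ?s1E ?s2E mkM !odd_mk; case: u.
Qed.

Lemma odd_tau d : odd_weyl (tau ^+ d)%g = false.
Proof.
elim: d => [|d]; first by rewrite expg0 -mk1 odd_mk.
rewrite expgS; have [p [q [u ->]]] := mk_surj (tau ^+ d)%g.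
by rewrite tauE mkM !odd_mk; case: u.
Qed.

(** * Specialization of the representations at v = 1 *)

Section AtOne.
Variables (n : nat) (X : eqType) (enc : 'I_n -> X).
Hypothesis enc_bij : bijective enc.
Variables (act : dih -> X -> X) (wt : X -> int -> int -> int * int).
Hypothesis hact : lattice_action act wt.
Variables (z1 z2 eps : K) (c1 c2 sgn : rat) (d : X -> K).
Hypotheses (hz1 : at_one z1 c1) (hz2 : at_one z2 c2) (c1_neq0 : c1 != 0) (c2_neq0 : c2 != 0).
Hypotheses (heps : at_one eps sgn) (sgn2 : sgn * sgn = 1).
Hypothesis hd : forall u, at_one (d u) (if act Da u == u then sgn else 0).

Lemma at_one_neq0 y c : at_one y c -> c != 0 -> y != 0.
Proof. by move=> h c0; apply: contra_neq c0 => e; apply: at_one0; rewrite -e. Qed.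

Let z1_neq0 : z1 != 0 := at_one_neq0 hz1 c1_neq0.
Let z2_neq0 : z2 != 0 := at_one_neq0 hz2 c2_neq0.

Hypothesis refl_quad : forall f u,
  refl_op act eps Da d (refl_op act eps Da d f) u = f u + xK * refl_op act eps Da d f u.
Hypothesis refl_braid : forall f u,
  refl_op act eps Da d (refl_op act eps Db (conj_diag act d) (refl_op act eps Da d f)) u =
  refl_op act eps Db (conj_diag act d)
    (refl_op act eps Da d (refl_op act eps Db (conj_diag act d) f)) u.

Notation monoK := (mono enc act wt z1 z2).
Notation monoQ := (mono enc act wt c1 c2).
Notation M := (refl_mx enc act wt z1 z2 eps d).

Lemma at_one_mono (w : ext_weyl) i j : at_one (monoK w i j) (monoQ w i j).
Proof.
rewrite !mxE /mono_op; apply: at_oneM; last exact: at_one_nat.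
by apply: at_oneM; apply: at_one_exp.
Qed.

(** At [v = 1] the diagonal [d] survives only on points fixed by [s1], with value [sgn], which is
    also the value of [eps]: what remains is [sgn] times the monomial matrix. *)
Lemma at_one_refl_mx (s : ext_weyl) i j : s \in simple_refls ->
  at_one (M s i j) ((sgn *: monoQ s) i j).
Proof.
have ha k l : at_one (opmx enc (refl_op act eps Da d) k l) ((sgn *: monoQ s1) k l).
  rewrite [X in at_one _ X]mxE !mxE s1E mono_opE /refl_op (chi0 hact) ?mul1r //=.
  have := hd (enc k); case: eqP => [->|_] hk.
    by rewrite add0r; apply: at_oneM => //; exact: at_one_nat.
  rewrite -[sgn * _]addr0; apply: at_oneD.
    by apply: at_oneM => //; exact: at_one_nat.
  by rewrite -[0](mul0r ((enc k == enc l)%:R : rat)); apply: at_oneM => //; exact: at_one_nat.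
have hM := monoM enc_bij hact c1_neq0 c2_neq0.
have ht := at_one_mono tau.
have [h1 h2 h3] := simple_neq; case: tau_relations => _ _ e1 _.
rewrite /refl_mx; case/mem_simple => ->.
- rewrite (negbTE h1) (negbTE h2).
  have -> : sgn *: monoQ s0 = monoQ tau *m monoQ tau *m (sgn *: monoQ s1) *m monoQ tau.
    rewrite -scalemxAr -scalemxAl -!hM; congr (_ *: monoQ _).
    by rewrite tauE s1E s0E !mkM.
  by do ![apply: at_one_mx => // ? ?].
- by rewrite eqxx.
- rewrite eq_sym (negbTE h3) eqxx.
  have -> : sgn *: monoQ s2 = monoQ tau *m (sgn *: monoQ s1) *m (monoQ tau *m monoQ tau).
    rewrite -scalemxAr -scalemxAl -!hM; congr (_ *: monoQ _).
    by rewrite tauE s1E s2E !mkM.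
  by do ![apply: at_one_mx => // ? ?].
Qed.

Notation R := (rep (R := 'M[K]_n) M (monoK tau)).

Lemma at_one_rep (w : ext_weyl) i j :
  at_one (R w i j) ((sgn ^+ odd_weyl w *: monoQ w) i j).
Proof.
have hM := monoM enc_bij hact c1_neq0 c2_neq0.
have hMK := monoM enc_bij hact z1_neq0 z2_neq0.
have hb := @refl_mx_braid _ _ _ _ enc_bij _ _ hact _ _ z1_neq0 z2_neq0 _ _ refl_braid.
have hX e : monoK tau ^+ e = monoK (tau ^+ e)%g :> 'M[K]_n.
  elim: e => [|e IHe]; first by rewrite expr0 expg0 (mono1 enc_bij hact z1_neq0 z2_neq0).
  rewrite exprS IHe expgS (hMK tau (tau ^+ e)%g).
  by [].
move: i j; have [k] := ubnP (len w); elim: k w => // k IHk w hk i j.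
have [w0|w_gt0] := posnP (len w).
  have ew := len0_tau w0; rewrite (rep0 (R := 'M[K]_n) _ _ w0).
  have -> : odd_weyl w = false by rewrite ew odd_tau.
  have -> : monoK tau ^+ deg w = monoK w.
    by rewrite hX -ew.
  by rewrite expr0 scale1r; exact: at_one_mono.
have [s ss ls] := exists_descent w_gt0.
rewrite (rep_descent (R := 'M[K]_n) _ hb ss ls).
have ew : w = (s * (s * w))%g by rewrite emulA simpleK ?mul1g.
have -> : sgn ^+ odd_weyl w *: monoQ w =
    (sgn *: monoQ s) *m (sgn ^+ odd_weyl (s * w)%g *: monoQ (s * w)%g).
  rewrite {2}ew (hM s) -scalemxAl -scalemxAr scalerA (odd_simple_mul w ss).
  by case: (odd_weyl w); rewrite /= ?expr1 ?expr0 ?mulr1 // sgn2.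
apply: at_one_mx => [k' l|k' l]; first exact: at_one_refl_mx.
by apply: IHk; exact: leq_trans ls hk.
Qed.

Lemma at_one_trace (j : nat) (w : ext_weyl) :
  at_one (trace_form M (monoK tau) j w)
         ((deg w == j)%:R * (sgn ^+ odd_weyl w * \tr (monoQ w))).
Proof.
apply: at_oneM; first exact: at_one_nat.
rewrite -mxtraceZ; apply: at_one_sum => i.
exact: at_one_rep.
Qed.

Lemma trace_form_trace (H : algType laurent) (T : ext_weyl -> H) (hT : is_hecke_algebra T)
  j h : @commutators H h -> functional hT (trace_form M (monoK tau) j) h = 0.
Proof.
apply: trace_form_commutators.
- exact: (mono_tau3 enc_bij hact z1_neq0 z2_neq0).
- exact: (refl_mx_tau enc_bij hact z1_neq0 z2_neq0).
- exact: (refl_mx_braid enc_bij hact z1_neq0 z2_neq0 refl_braid).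
- exact: (refl_mx_quad enc_bij hact z1_neq0 z2_neq0 refl_quad).
Qed.

End AtOne.

(* A pair (trace function on the Hecke algebra, its specialization at [v = 1]). *)
Definition specialized_trace (g : ext_weyl -> K) (g1 : ext_weyl -> rat) : Prop :=
  (forall (H : algType laurent) (T : ext_weyl -> H) (hT : is_hecke_algebra T) h,
     commutators h -> functional hT g h = 0) /\
  forall w, at_one (g w) (g1 w).

Lemma specialized_trace_mono (n : nat) (X : eqType) (enc : 'I_n -> X)
    (act : dih -> X -> X) (wt : X -> int -> int -> int * int) (k1 k2 : nat)
    (eps : K) (sgn : rat) (d : X -> K) (j : nat) :
  bijective enc -> lattice_action act wt -> (0 < k1)%N -> (0 < k2)%N ->
  at_one eps sgn -> sgn * sgn = 1 ->
  (forall u, at_one (d u) (if act Da u == u then sgn else 0)) ->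
  (forall f u, refl_op act eps Da d (refl_op act eps Da d f) u =
     f u + xK * refl_op act eps Da d f u) ->
  (forall f u,
    refl_op act eps Da d (refl_op act eps Db (conj_diag act d) (refl_op act eps Da d f)) u =
    refl_op act eps Db (conj_diag act d)
    (refl_op act eps Da d (refl_op act eps Db (conj_diag act d) f)) u) ->
  exists g, specialized_trace g (fun w =>
    (deg w == j)%:R * (sgn ^+ odd_weyl w * \tr (mono enc act wt k1%:R k2%:R w))).
Proof.
move=> enc_bij hact k1_gt0 k2_gt0 heps sgn2 hd hq hb.
have n1 : k1%:R != 0 :> rat by rewrite pnatr_eq0 -lt0n.
have n2 : k2%:R != 0 :> rat by rewrite pnatr_eq0 -lt0n.
exists (trace_form (refl_mx enc act wt (k1%:R) (k2%:R) eps d) (mono enc act wt k1%:R k2%:R tau) j).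
split=> [H T hT h|w].
  by apply: trace_form_trace => //; try exact: at_one_nat.
by apply: at_one_trace => //; exact: at_one_nat.
Qed.

(** * The representations of dimension 6, 3 and 1 *)

Definition dih_seq : seq dih := [:: D1; Da; Db; Dab; Dba; Daba].
Definition dih_code (u : dih) : nat :=
  match u with D1 => 0 | Da => 1 | Db => 2 | Dab => 3 | Dba => 4 | Daba => 5 end.
Lemma dih_codeK : cancel dih_code (nth D1 dih_seq). Proof. by case. Qed.
HB.instance Definition _ := Equality.copy dih (can_type dih_codeK).

(* The three points permuted by the Weyl group, i.e. the coordinates of P. *)
Inductive tri := Y0 | Y1 | Y2.
Definition tri_seq : seq tri := [:: Y0; Y1; Y2].
Definition tri_code (y : tri) : nat := match y with Y0 => 0 | Y1 => 1 | Y2 => 2 end.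
Lemma tri_codeK : cancel tri_code (nth Y0 tri_seq). Proof. by case. Qed.
HB.instance Definition _ := Equality.copy tri (can_type tri_codeK).

Definition dih_enc (i : 'I_6) : dih := nth D1 dih_seq i.
Definition tri_enc (i : 'I_3) : tri := nth Y0 tri_seq i.
Definition unit_enc (i : 'I_1) : unit := tt.

Lemma dih_enc_bij : bijective dih_enc.
Proof.
exists (fun u => inord (dih_code u)) => [[i hi]|u].
  by apply: val_inj; rewrite /= inordK; case: i hi => [|[|[|[|[|[|//]]]]]].
by rewrite /dih_enc inordK; case: u.
Qed.

Lemma tri_enc_bij : bijective tri_enc.
Proof.
exists (fun u => inord (tri_code u)) => [[i hi]|u].
  by apply: val_inj; rewrite /= inordK; case: i hi => [|[|[|//]]].
by rewrite /tri_enc inordK; case: u.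
Qed.

Lemma unit_enc_bij : bijective unit_enc.
Proof. by exists (fun=> ord0) => [i|[]]; rewrite ?ord1. Qed.

Definition tri_a (y : tri) : tri := match y with Y0 => Y1 | Y1 => Y0 | Y2 => Y2 end.
Definition tri_b (y : tri) : tri := match y with Y0 => Y0 | Y1 => Y2 | Y2 => Y1 end.
Definition tri_act (u : dih) (y : tri) : tri :=
  match u with
  | D1 => y | Da => tri_a y | Db => tri_b y | Dab => tri_a (tri_b y)
  | Dba => tri_b (tri_a y) | Daba => tri_a (tri_b (tri_a y))
  end.
(** Three times the coordinates of the weight in the plane of sum zero; the factor 3 makes them
    integral on [P]. Only one parameter is needed, hence the 0. *)
Definition tri_wt (y : tri) (p q : int) : int * int :=
  (match y with Y0 => 2 * p + q | Y1 => q - p | Y2 => - p - 2 * q end, 0).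
Definition dih_wt (u : dih) (p q : int) : int * int := dact (dinv u) p q.

Lemma tri_action : lattice_action tri_act tri_wt.
Proof.
split=> //.
- by case; case; case.
- by case=> *; rewrite /=; lia.
- by case; case=> p q; rewrite /tri_wt /=; congr (_, _); lia.
Qed.

Lemma dih_action : lattice_action dmul dih_wt.
Proof.
split=> //.
- by move=> y y' u; rewrite dmulA.
- by case=> *; rewrite /=; lia.
- by case=> *; rewrite /=; lia.
- by case; case=> p q; rewrite /dih_wt /=; congr (_, _); lia.
Qed.

Lemma unit_action : lattice_action (fun _ (u : unit) => u) (fun _ _ _ => (0, 0)).
Proof. by split. Qed.

Lemma vK_neq0 : vK != 0.
Proof. by rewrite tofrac_eq0 polyX_eq0. Qed.

Section Quadratic.
Variables (F : fieldType) (z : F).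
Hypothesis z_neq0 : z != 0.

Lemma quad_z (f : F) : z * (z * f) = f + (z - z^-1) * (z * f).
Proof. by field. Qed.

Lemma quad_zV (f : F) : - z^-1 * (- z^-1 * f) = f + (z - z^-1) * (- z^-1 * f).
Proof. by field. Qed.

(** [Y2] is the point fixed by [s1], where [T s1] acts by one of its two eigenvalues [c]; on [Y0],
    [Y1] it acts by a block with both eigenvalues. *)
Definition tri_diag (c : F) (y : tri) : F :=
  match y with Y0 => 0 | Y1 => z - z^-1 | Y2 => c end.
(** The regular representation of the finite Hecke algebra: the diagonal is nonzero on the elements
    with left descent [s1]. *)
Definition dih_diag (u : dih) : F :=
  match u with Da | Dab | Daba => z - z^-1 | _ => 0 end.

Lemma tri_quad eps c f u : eps * eps = 1 -> c = z \/ c = - z^-1 ->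
  refl_op tri_act eps Da (tri_diag c) (refl_op tri_act eps Da (tri_diag c) f) u =
  f u + (z - z^-1) * refl_op tri_act eps Da (tri_diag c) f u.
Proof.
move=> e2 hc; have e01 : (Y1 == Y0) = false by [].
have e10 : (Y0 == Y1) = false by [].
case: u; rewrite /refl_op /= ?eqxx ?e01 ?e10.
- rewrite !mul0r !addr0 mulrDr mulrA e2; ring.
- rewrite !mul0r !addr0 mulrA e2; ring.
- by rewrite !add0r; case: hc => ->; [exact: quad_z|exact: quad_zV].
Qed.

Lemma tri_braid eps c f u : eps = 1 \/ eps = -1 -> c = z \/ c = - z^-1 ->
  refl_op tri_act eps Da (tri_diag c) (refl_op tri_act eps Db (conj_diag tri_act (tri_diag c))
    (refl_op tri_act eps Da (tri_diag c) f)) u =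
  refl_op tri_act eps Db (conj_diag tri_act (tri_diag c)) (refl_op tri_act eps Da (tri_diag c)
    (refl_op tri_act eps Db (conj_diag tri_act (tri_diag c)) f)) u.
Proof.
move=> e2 hc.
have e01 : (Y1 == Y0) = false by [].
have e10 : (Y0 == Y1) = false by [].
have e12 : (Y2 == Y1) = false by [].
have e21 : (Y1 == Y2) = false by [].
case: u; rewrite /refl_op /conj_diag /= ?eqxx ?e01 ?e10 ?e12 ?e21; case: hc => ->;
  case: e2 => ->; by field.
Qed.

Lemma dih_quad f u :
  refl_op dmul 1 Da dih_diag (refl_op dmul 1 Da dih_diag f) u =
  f u + (z - z^-1) * refl_op dmul 1 Da dih_diag f u.
Proof.
have e k : (mula k == k) = false by case: k.
by rewrite /refl_op /= !e; case: u => /=; ring.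
Qed.

Lemma dih_braid f u :
  refl_op dmul 1 Da dih_diag (refl_op dmul 1 Db (conj_diag dmul dih_diag)
    (refl_op dmul 1 Da dih_diag f)) u =
  refl_op dmul 1 Db (conj_diag dmul dih_diag) (refl_op dmul 1 Da dih_diag
    (refl_op dmul 1 Db (conj_diag dmul dih_diag) f)) u.
Proof.
have e k : (mula k == k) = false by case: k.
have e' k : (mulb k == k) = false by case: k.
by rewrite /refl_op /conj_diag /= !(e, e'); case: u => /=; ring.
Qed.
End Quadratic.

Lemma trace_unit j : exists g, specialized_trace g (fun w => (deg w == j)%:R).
Proof.
have [|||f u|f u|g [hg1 hg2]] := @specialized_trace_mono _ _ unit_enc _ _ 1 1 1 1 (fun=> vK) j
  unit_enc_bij unit_action isT isT.
- exact: (at_one_nat 1).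
- by rewrite mulr1.
- by move=> []; exact: at_one_v.
- rewrite /refl_op eqxx !add0r; exact: quad_z vK_neq0 _.
- by rewrite /refl_op eqxx.
exists g; split=> // w; have := hg2 w; rewrite expr1n mul1r.
have [p [q [u ->]]] := mk_surj w.
rewrite mono_tr big_ord_recl big_ord0 eqxx mul1r addr0 /chi /= !expr0z !mulr1.
by [].
Qed.

Lemma trace_tri (b : bool) j k : exists g, specialized_trace g (fun w =>
  (deg w == j)%:R * ((-1) ^+ (b && odd_weyl w) *
    \tr (mono tri_enc tri_act tri_wt (2 ^ k)%:R 1%:R w))).
Proof.
have k0 : (0 < 2 ^ k)%N by rewrite expn_gt0.
have [|||f u|f u|g [hg1 hg2]] := @specialized_trace_mono _ _ tri_enc _ _ (2 ^ k)%N 1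
  ((-1) ^+ b) ((-1) ^+ b) (tri_diag vK (if b then - vK^-1 else vK)) j tri_enc_bij tri_action k0 isT.
- case: b; rewrite ?expr0 ?expr1; last exact: (at_one_nat 1).
  exact: at_oneN (at_one_nat 1).
- by rewrite -expr2 sqrr_sign.
- case.
  + exact: (at_one_nat 0).
  + exact: at_one_x.
  + case: b; rewrite /= ?expr1 ?expr0; last exact: at_one_v.
    by apply: at_oneN at_one_vV.
- apply: tri_quad; [exact: vK_neq0|by rewrite -expr2 sqrr_sign|].
  by case: b; [right|left].
- apply: tri_braid; [exact: vK_neq0|by case: b; [right|left]|].
  by case: b; [right|left].
exists g; split=> // w; have := hg2 w.
by rewrite -exprM mulnb.
Qed.

Lemma trace_dih j k : exists g, specialized_trace g (fun w =>
  (deg w == j)%:R * \tr (mono dih_enc dmul dih_wt (2 ^ k)%:R (3 ^ k)%:R w)).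
Proof.
have k2 : (0 < 2 ^ k)%N by rewrite expn_gt0.
have k3 : (0 < 3 ^ k)%N by rewrite expn_gt0.
have [|||f u|f u|g [hg1 hg2]] := @specialized_trace_mono _ _ dih_enc _ _ (2 ^ k)%N (3 ^ k)%N
  1 1 (dih_diag vK) j dih_enc_bij dih_action k2 k3.
- exact: (at_one_nat 1).
- by rewrite mulr1.
- by case; rewrite /dih_diag; try exact: at_one_x; exact: (at_one_nat 0).
- exact: dih_quad.
- exact: dih_braid.
exists g; split=> // w; have := hg2 w.
by rewrite expr1n mul1r.
Qed.

(** * Linear independence in the cocenter *)

(** By linearity the power [m ^+ k] may be replaced by any polynomial in [m]. The square of a
    polynomial vanishing exactly on the other lists isolates [c i0], and squaring makes its sum over
    [L i0] positive. *)
Lemma moment_separation (I : eqType) (s : seq I) (c : I -> rat) (L : I -> seq rat) :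
  uniq s ->
  (forall k : nat, \sum_(i <- s) c i * \sum_(m <- L i) m ^+ k = 0) ->
  (forall i j m, i \in s -> j \in s -> m \in L i -> m \in L j -> i = j) ->
  forall i, i \in s -> L i != [::] -> c i = 0.
Proof.
move=> us hs hL i0 i0s Li0.
have hp (P : {poly rat}) : \sum_(i <- s) c i * \sum_(m <- L i) P.[m] = 0.
  under eq_bigr do under eq_bigr do rewrite horner_coef.
  rewrite [LHS](_ : _ = \sum_(k < size P) P`_k * \sum_(i <- s) c i * \sum_(m <- L i) m ^+ k).
    by rewrite big1 // => k _; rewrite hs mulr0.
  under [RHS]eq_bigr do rewrite mulr_sumr.
  rewrite exchange_big; apply: eq_bigr => i _.
  rewrite exchange_big mulr_sumr; apply: eq_bigr => k _.
  by rewrite -mulr_sumr mulrCA.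
pose D := \prod_(i <- s | i != i0) \prod_(m <- L i) ('X - m%:P) : {poly rat}.
have D0 i m : i \in s -> i != i0 -> m \in L i -> D.[m] = 0.
  move=> hi ni hm; rewrite /D (big_rem i) //= ni hornerM (big_rem m) //= hornerM.
  by rewrite hornerXsubC subrr !mul0r.
have D1 m : m \in L i0 -> D.[m] != 0.
  move=> hm; rewrite /D horner_prod prodf_seq_neq0; apply/allP => i hi; apply/implyP => ni.
  rewrite horner_prod prodf_seq_neq0; apply/allP => m' hm' /=.
  rewrite hornerXsubC subr_eq0; apply: contra_neq ni => e.
  by apply: (hL i i0 m') => //; rewrite -e.
have rest : \sum_(i <- s | i != i0) c i * \sum_(m <- L i) (D ^+ 2).[m] = 0.
  rewrite big_seq_cond big1 // => i /andP[hi ni]; rewrite big_seq big1 ?mulr0 // => m hm.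
  by rewrite horner_exp (D0 i) // expr0n.
have := hp (D ^+ 2); rewrite (bigD1_seq i0) //= rest addr0 => /eqP.
rewrite mulf_eq0 => /orP[/eqP//|/eqP e]; exfalso.
have : 0 < \sum_(m <- L i0) (D ^+ 2).[m].
  case: (L i0) Li0 D1 => // m r _ hr; rewrite big_cons ltr_wpDr //.
    by apply: sumr_ge0 => m' _; rewrite horner_exp sqr_ge0.
  by rewrite horner_exp lt_neqAle sqr_ge0 eq_sym expf_neq0 // hr // inE eqxx.
by rewrite e ltxx.
Qed.

Definition mono23 (a b : int) : rat := 2 ^ a * 3 ^ b.

Lemma mono23_inj a b a' b' : mono23 a b = mono23 a' b' -> a = a' /\ b = b'.
Proof.
(* Multiplying by [2^N * 3^N] makes all exponents nonnegative, so that unique factorisation of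
   natural numbers applies. *)
pose N : nat := (absz a + absz b + absz a' + absz b')%N.
have shift (x y : int) : (absz x + absz y <= N)%N ->
    mono23 x y * (2 ^+ N * 3 ^+ N) = (2 ^ absz (x + N%:Z)%R * 3 ^ absz (y + N%:Z)%R)%N%:R.
  move=> h; rewrite /mono23 !exprnP mulrACA -!expfzDr // natrM !natrX !exprnP.
  by congr (_ ^ _ * _ ^ _); lia.
move=> e; have := shift a b; rewrite e (shift a') /N; last by lia.
move=> /(_ ltac:(lia)) /eqP; rewrite eqr_nat => /eqP h.
have v2 i j : logn 2 (2 ^ i * 3 ^ j)%N = i.
  by rewrite lognM ?expn_gt0 // !lognX !logn_prime // muln1 muln0 addn0.
have v3 i j : logn 3 (2 ^ i * 3 ^ j)%N = j.
  by rewrite lognM ?expn_gt0 // !lognX !logn_prime // muln1 muln0.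
have h2 := congr1 (logn 2) h; have h3 := congr1 (logn 3) h.
rewrite !v2 in h2; rewrite !v3 in h3; lia.
Qed.

Lemma natX_exprz (z k : nat) (m : int) : (0 < z)%N ->
  ((z ^ k)%N%:R : rat) ^ m = (z%:R ^ m) ^+ k.
Proof. by move=> z0; rewrite natrX !exprnP exprzAC. Qed.

Definition transl_values (w : ext_weyl) : seq rat :=
  if dih_of w.2 is D1 then
    [seq let l := dact (dinv y) w.1.1 w.1.2 in mono23 l.1 l.2 | y <- dih_seq]
  else [::].

Definition refl_values (w : ext_weyl) : seq rat :=
  if odd_weyl w then [:: 2 ^ (- axis w.1.1 w.1.2 (dih_of w.2))] else [::].

Lemma transl_values_mk p q u : transl_values (mk p q u) = if u is D1 then
  [seq let l := dact (dinv y) p q in mono23 l.1 l.2 | y <- dih_seq] else [::].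
Proof. by rewrite /transl_values /mk /= dih_permK. Qed.

(** The finite Weyl group acts freely on the basis, so only translations have diagonal entries: the
    powers attached to their orbit. *)
Lemma tr_dih k (w : ext_weyl) :
  \tr (mono dih_enc dmul dih_wt (2 ^ k)%:R (3 ^ k)%:R w) = \sum_(m <- transl_values w) m ^+ k.
Proof.
have [p [q [u ->]]] := mk_surj w.
rewrite transl_values_mk mono_tr; have [->|nu] : u = D1 \/ u != D1
  by case: eqVneq => h; [left|right].
  rewrite big_map (big_nth D1) big_mkord; apply: eq_bigr => i _.
  by rewrite eqxx mul1r /chi !natX_exprz // exprMn.
rewrite big1 => [|i _]; first by case: u nu => //=; rewrite big_nil.
rewrite (_ : (_ == _) = false) ?mul0r //.
by move: nu; case: u => //= _; case: (dih_enc i).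
Qed.

(** A reflection fixes one of the three points, and the weight of that point is minus its axis. *)
Lemma tr_tri k (w : ext_weyl) : odd_weyl w ->
  \tr (mono tri_enc tri_act tri_wt (2 ^ k)%:R 1%:R w) = \sum_(m <- refl_values w) m ^+ k.
Proof.
have [p [q [u ->]]] := mk_surj w; rewrite odd_mk => hu.
rewrite mono_tr /refl_values odd_mk hu big_seq1 /mk /= dih_permK.
rewrite !big_ord_recl big_ord0 /tri_enc /= /chi /= !expr0z !mulr1 !natX_exprz //.
by case: u hu => // _ /=; rewrite ?mul1r ?mul0r ?addr0 ?add0r;
  congr ((exprz _ _) ^+ _); rewrite /axis; lia.
Qed.

Lemma separation (s : seq ext_weyl) (c : ext_weyl -> rat) : uniq s ->
  (forall w w' : ext_weyl, w \in s -> w' \in s -> conj_class w w' -> w = w') ->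
  (forall g g1, specialized_trace g g1 -> \sum_(w <- s) c w * g1 w = 0) ->
  forall w, w \in s -> c w = 0.
Proof.
move=> us hs hc w0 w0s; pose j := deg w0.
pose c' w := (deg w == j)%:R * c w.
suff : c' w0 = 0 by rewrite /c' eqxx mul1r.
have c't w : w \in s -> transl_values w != [::] -> c' w = 0.
  apply: moment_separation => // [k|w1 w2 m h1 h2].
    have [g hg] := trace_dih j k; rewrite -[RHS](hc _ _ hg); apply: eq_bigr => w' _.
    by rewrite /c' tr_dih mulrCA mulrA.
  move: h1 h2; have [p [q [u ->]]] := mk_surj w1; have [p' [q' [u' ->]]] := mk_surj w2.
  rewrite !transl_values_mk => h1 h2.
  case: u h1 => // h1; case: u' h2 => // h2; case/mapP => y _ -> /mapP[y' _] /mono23_inj[e1 e2].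
  apply: hs => //; apply/transl_class; split=> //; exists (dmul y' (dinv y)).
  by move: e1 e2; case: y; case: y' => /= e1 e2; congr (_, _); lia.
have c'r w : w \in s -> refl_values w != [::] -> c' w = 0.
  apply: moment_separation => // [k|w1 w2 m h1 h2].
    have [g hg] := trace_tri false j k; have [g' hg'] := trace_tri true j k.
    have e := hc _ _ hg; have e' := hc _ _ hg'.
    (* The two twists by the sign agree on translations and rotations; their difference keeps the
       reflections only, counted twice. *)
    have : \sum_(w <- s) c w * ((deg w == j)%:R * ((-1) ^+ (false && odd_weyl w) *
        \tr (mono tri_enc tri_act tri_wt (2 ^ k)%:R 1%:R w))) -
      \sum_(w <- s) c w * ((deg w == j)%:R * ((-1) ^+ (true && odd_weyl w) *
        \tr (mono tri_enc tri_act tri_wt (2 ^ k)%:R 1%:R w))) = 0 by rewrite e e' subrr.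
    rewrite -sumrB => e2; apply: (mulfI (_ : 2 != 0 :> rat)) => //.
    rewrite mulr0 -[RHS]e2 mulr_sumr; apply: eq_bigr => w' _.
    rewrite /c' /refl_values; case ho : (odd_weyl w'); last first.
      by rewrite big_nil mulr0 mulr0 /= subrr.
    have := tr_tri k ho; rewrite /refl_values ho => ->; rewrite /= expr0 expr1; ring.
  move: h1 h2; have [p [q [u ->]]] := mk_surj w1; have [p' [q' [u' ->]]] := mk_surj w2.
  rewrite /refl_values !odd_mk /mk /= !dih_permK => h1 h2.
  case: ifP => // hu; case: ifP => // hu'; rewrite !inE => /eqP -> /eqP e.
  apply: hs => //; apply/refl_class => //; split=> //.
  have : mono23 (- axis p q u) 0 = mono23 (- axis p' q' u') 0 by rewrite /mono23 e.
  by case/mono23_inj; lia.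
have [t1|t1] := boolP (transl_values w0 != [::]); first exact: c't.
have [r1|r1] := boolP (refl_values w0 != [::]); first exact: c'r.
(* [w0] is now a rotation, and by [rot_class] the only one of degree [j] in the list; the other
   terms vanish by the previous cases. *)
have [g hg] := trace_unit j; have := hc _ _ hg.
rewrite (bigD1_seq w0) //= eqxx mulr1.
suff -> : \sum_(w <- s | w != w0) c w * (deg w == j)%:R = 0.
  by rewrite addr0 => e; rewrite /c' e mulr0.
rewrite big_seq_cond big1 // => w /andP[ws nw].
have [t0|t0] := boolP (transl_values w != [::]).
  by have := c't w ws t0; rewrite /c' mulrC.
have [r0|r0] := boolP (refl_values w != [::]).
  by have := c'r w ws r0; rewrite /c' mulrC.
have [dw|] := eqVneq (deg w) j; last by rewrite mulr0.
exfalso; move/eqP: nw; apply; apply: hs => //.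
have rot_of y : ~~ (transl_values y != [::]) -> ~~ (refl_values y != [::]) ->
    exists p q u, y = mk p q u /\ is_rot u.
  have [p [q [u ->]]] := mk_surj y; rewrite transl_values_mk /refl_values odd_mk => h1 h2.
  by exists p, q, u; split=> //; case: u h1 h2.
have [p [q [u [ew hu]]]] := rot_of w t0 r0; have [p' [q' [u' [ew0 hu']]]] := rot_of w0 t1 r1.
rewrite ew ew0; apply/rot_class => //; split=> //.
move: dw; rewrite /j ew ew0 !deg_mk => dw; exists (divz (p' - q' - (p - q)) 3); lia.
Qed.

(* All coefficients vanish at v = 1, hence can be divided by v - 1. *)
Lemma poly_independence (s : seq ext_weyl) (P : ext_weyl -> {poly int}) : uniq s ->
  (forall w w' : ext_weyl, w \in s -> w' \in s -> conj_class w w' -> w = w') ->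
  (forall g g1, specialized_trace g g1 -> \sum_(w <- s) tofrac (P w) * g w = 0) ->
  forall w, w \in s -> P w = 0.
Proof.
move=> us hs; have [m hm] : exists m, forall w, w \in s -> (size (P w) <= m)%N.
  exists (\max_(w <- s) size (P w))%N => w ws.
  exact: (leq_bigmax_seq (P := xpredT) (F := fun w => size (P w)) w ws isT).
elim: m P hm => [|m IHm] P hm hP w ws.
  by apply/eqP; rewrite -size_poly_eq0 -leqn0 hm.
have root1 y : y \in s -> (P y).[1] = 0.
  move=> ys; apply/eqP; rewrite -(intr_eq0 rat); apply/eqP.
  apply: (@separation s (fun y => (P y).[1]%:~R)) => // g g1 hg.
  apply: at_one0; rewrite -[X in at_one X _](hP _ _ hg); apply: at_one_sum => y'.
  by apply: at_oneM; [exact: at_one_poly|exact: (hg.2 y')].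
have div y : exists Q : {poly int}, y \in s -> P y = Q * ('X - 1%:P).
  case: (boolP (y \in s)) => ys; last by exists 0.
  have /factor_theorem[Q e] : root (P y) 1 by apply/eqP/root1.
  by exists Q.
pose Q y := projT1 (cid (div y)).
have QE y : y \in s -> P y = Q y * ('X - 1%:P) by rewrite /Q; case: cid.
have X1 : 'X - 1%:P != 0 :> {poly int} by rewrite polyXsubC_eq0.
suff -> : P w = 0 * ('X - 1%:P) by rewrite mul0r.
rewrite QE //; congr (_ * _); apply: (IHm Q) => // [y ys|g g1 hg].
  have := hm y ys; rewrite QE //; have [->|Q0] := eqVneq (Q y) 0; first by rewrite size_poly0.
  by rewrite size_mul // size_XsubC addn2.
have X1' : tofrac ('X - 1%:P : {poly int}) != 0 by rewrite tofrac_eq0.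
apply: (mulIf X1'); rewrite mul0r -[RHS](hP _ _ hg) mulr_suml.
rewrite big_seq [RHS]big_seq; apply: eq_bigr => y ys.
by rewrite QE // tofracM mulrAC.
Qed.

Section Independence.
Variables (H : algType laurent) (T : ext_weyl -> H).
Hypothesis hT : is_hecke_algebra T.

Lemma cocenter_independence (s : seq ext_weyl) (c : ext_weyl -> laurent) : uniq s ->
  (forall w w' : ext_weyl, w \in s -> w' \in s -> conj_class w w' -> w = w') ->
  commutators (\sum_(w <- s) c w *: T w) -> forall w, w \in s -> c w = 0.
Proof.
move=> us hs hc.
have frac w : exists pn : {poly int} * nat, val (c w) = tofrac pn.1 / tofrac 'X ^+ pn.2.
  by case: (c w) => y /= /asboolP[p [n ->]]; exists (p, n).
pose p w := (projT1 (cid (frac w))).1; pose n w := (projT1 (cid (frac w))).2.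
have cE w : val (c w) = tofrac (p w) / vK ^+ n w by rewrite /p /n; case: cid.
pose N := (\max_(w <- s) n w)%N.
have nN w : w \in s -> (n w <= N)%N
  by move=> ws; exact: (leq_bigmax_seq (P := xpredT) (F := n) w ws isT).
(* A common power of [v] clears the denominators. *)
pose P w := p w * 'X^(N - n w).
have PE w : w \in s -> tofrac (P w) = val (c w) * vK ^+ N.
  move=> ws; rewrite cE tofracM tofracXn -/vK -[in RHS](subnKC (nN w ws)) exprD.
  by rewrite mulrA divfK // expf_neq0 // vK_neq0.
have P0 w : w \in s -> P w = 0.
  apply: poly_independence => // g g1 [hg _].
  have := hg H T hT _ hc; rewrite functional_sum => e.
  rewrite -[RHS](mul0r (vK ^+ N)) -[in RHS]e mulr_suml big_seq [RHS]big_seq.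
  apply: eq_bigr => y ys; rewrite functionalZ functional_T PE //; exact: mulrAC.
move=> w ws; apply: val_inj; rewrite val_laurent0.
apply: (mulIf (_ : vK ^+ N != 0)); first by rewrite expf_neq0 // vK_neq0.
by rewrite -PE // P0 // tofrac0 mul0r.
Qed.

End Independence.

(** * Uniqueness of the class polynomials *)

Lemma leastP (S : set nat) : (exists n, S n) -> S (least S).
Proof.
case=> n Sn; have ex : exists k, `[< S k >] by exists n; apply/asboolP.
have [m /asboolP Sm mm] := ex_minnP ex.
by rewrite (@least_eq S m) // => k /asboolP; exact: mm.
Qed.

Lemma exists_min_len_section : exists r, min_len_section r.
Proof.
have /choice[r hr] : forall O : set ext_weyl,
    exists w, conj_classes O -> O w /\ len w = min_len O.
  move=> O; have [/conj_classesP[y ->]|hO] := pselect (conj_classes O); last by exists 1%g.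
  have [w hw e] : (len @` conj_class y)%classic (min_len (conj_class y)).
    by apply: leastP; exists (len y), y => //; exact: conj_class_refl.
  by exists w.
by exists r => O hO; exact: hr.
Qed.

Lemma conj_class_mem (O : set ext_weyl) w : conj_classes O -> O w -> conj_class w = O.
Proof. by move=> /conj_classesP[y ->] /conj_class_eq. Qed.

Section Uniqueness.
Variables (H : algType laurent) (T : ext_weyl -> H).
Hypothesis hT : is_hecke_algebra T.

Lemma sum_classes (f : set ext_weyl -> laurent) (S : seq (set ext_weyl))
    (r : set ext_weyl -> ext_weyl) : uniq S -> (forall O, O \in S -> conj_classes O) ->
  (forall O, O \notin S -> f O = 0) ->
  \sum_(O \in conj_classes) f O *: T (r O) = \sum_(O <- S) f O *: T (r O).
Proof.
move=> uS cS fS; rewrite (fsbigE S) //; last by move=> O _ /fS ->; rewrite scale0r.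
rewrite big_seq_cond [RHS]big_seq; apply: eq_bigl => O.
case: (boolP (O \in S)) => //= /cS hO; exact/mem_set.
Qed.

Lemma class_poly_unique w f f' : is_class_poly T w f -> is_class_poly T w f' -> f = f'.
Proof.
move=> [f0 /finite_support_seq[R [uR fR]] fw] [f0' /finite_support_seq[R' [uR' fR']] fw'].
have [r hr] := exists_min_len_section.
pose S := [seq O <- undup (R ++ R') | `[< conj_classes O >]].
have uS : uniq S by rewrite filter_uniq // undup_uniq.
have cS O : O \in S -> conj_classes O by rewrite mem_filter => /andP[/asboolP].
have fS O : O \notin S -> f O = 0 /\ f' O = 0.
  rewrite mem_filter negb_and mem_undup mem_cat negb_or.
  by case/orP=> [/asboolP hO|/andP[h h']]; [rewrite f0 ?f0'|rewrite fR ?fR'].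
have d0 O : O \in S -> f O - f' O = 0.
  move=> OS; have rO := hr _ (cS _ OS).
  have cr O' : O' \in S -> conj_class (r O') = O'.
    by move=> OS'; apply: conj_class_mem; [exact: cS|case: (hr _ (cS _ OS'))].
  pose c w := f (conj_class w) - f' (conj_class w).
  suff h : forall w0, w0 \in map r S -> c w0 = 0.
    by have := h _ (map_f r OS); rewrite /c (cr _ OS).
  apply: (@cocenter_independence _ _ hT (map r S) c).
  - rewrite map_inj_in_uniq // => O1 O2 h1 h2 e.
    by rewrite -(cr _ h1) -(cr _ h2) e.
  - move=> _ _ /mapP[O1 h1 ->] /mapP[O2 h2 ->] /conj_class_eq.
    by rewrite (cr _ h1) (cr _ h2) => ->.
  - have := commutatorsD (fw' r hr) (commutatorsN (fw r hr)).
    rewrite opprB addrC subrKA => {}fw.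
    rewrite !(@sum_classes _ S) // in fw; try by move=> O' /fS[].
    rewrite big_map big_seq.
    under eq_bigr => O' hO' do rewrite /c (cr _ hO') scalerBl.
    by rewrite -big_seq sumrB.
apply/funext => O; case: (boolP (O \in S)) => [/d0/eqP|/fS[-> ->] //].
by rewrite subr_eq0 => /eqP.
Qed.

Lemma class_poly_eq w f : is_class_poly T w f -> class_poly T w = f.
Proof.
move=> hf; rewrite /class_poly; case: xgetP => [f' _ hf'|/(_ f)[]//].
exact: class_poly_unique hf' hf.
Qed.

Lemma class_poly_expands w F : expands T (T w) F ->
  (forall l, lab_ok l -> class_poly T w (cls l) = F l) /\
  (forall O, (forall l, lab_ok l -> O <> cls l) -> class_poly T w O = 0).
Proof.
case=> e [/allP e1 e2 e3].
pose f (O : set ext_weyl) : laurent := \sum_(q <- e) q.1 *+ (O == cls q.2).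
have f0 O : (forall q, q \in e -> O <> cls q.2) -> f O = 0.
  move=> h; rewrite /f big_seq big1 // => q qe.
  by case: eqP => [/h//|_]; rewrite mulr0n.
pose S := undup [seq cls q.2 | q <- e].
have fS O : O \notin S -> f O = 0.
  rewrite mem_undup => hO; apply: f0 => q qe eO; move/negP: hO; apply.
  by rewrite eO (map_f (fun q => cls q.2)).
have fP : is_class_poly T w f.
  split=> [O hO||r hr].
  - by apply: f0 => q _ eO; apply: hO; rewrite eO; exact: cls_conj.
  - by apply/finite_support_seq; exists S; split; [exact: undup_uniq|].
  - rewrite (@sum_classes _ S) ?undup_uniq //; last first.
      by move=> O; rewrite mem_undup => /mapP[q _ ->]; exact: cls_conj.
    suff -> : \sum_(O <- S) f O *: T (r O) = \sum_(q <- e) q.1 *: T (r (cls q.2)) by exact: e3.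
    rewrite /f; under eq_bigr do rewrite scaler_suml.
    rewrite exchange_big big_seq [RHS]big_seq; apply: eq_bigr => q qe.
    rewrite (bigD1_seq (cls q.2)) ?undup_uniq //=; last first.
      by rewrite mem_undup (map_f (fun q => cls q.2)).
    rewrite eqxx big1 ?addr0 // => O /negbTE ->.
    by rewrite mulr0n scale0r.
rewrite (class_poly_eq fP); split=> [l hl|O hO].
  rewrite e2 // /f /combination big_seq [RHS]big_seq; apply: eq_bigr => q qe.
  congr (_ *+ _); case: eqP => [h|h]; case: eqP => // h'.
    by case: h'; apply: (@cls_inj q.2 l) => //; exact: e1.
  by case: h; rewrite h'.
by apply: f0 => q qe; apply: hO; exact: e1.
Qed.

End Uniqueness.

(** * The tables *)

Lemma root_comb_inj a b a' b' : root_comb a b = root_comb a' b' -> a = a' /\ b = b'.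
Proof. by rewrite !root_combE => -[h1 h2]; lia. Qed.

Lemma root_combB a b a' b' : root_comb a b - root_comb a' b' = root_comb (a - a') (b - b').
Proof. by rewrite /root_comb !mulrzBr opprD addrACA. Qed.

Lemma alpha1X m : alpha1 *+ m = root_comb m%:Z 0.
Proof. by rewrite /root_comb mulr0z addr0. Qed.

Lemma alpha2X m : alpha2 *+ m = root_comb 0 m%:Z.
Proof. by rewrite /root_comb mulr0z add0r. Qed.

(** Two of the lines removed by [Q_sh] carry the walls of the dominant chamber, and the third meets
    that chamber only in 0. *)
Lemma dominant_regular (a b : int) : dominant (root_comb a b) /\ Q_sh (root_comb a b) <->
  a < 2 * b /\ b < 2 * a.
Proof.
have -> : dominant (root_comb a b) = (0 <= 2 * a - b /\ 0 <= 2 * b - a).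
  by rewrite root_combE.
split=> [[[h1 h2] [_ h]]|[h1 h2]].
  have n1 : b <> 2 * a.
    by move=> e; apply: h; exists a; apply: Or31; rewrite !root_combE; congr (_, _); lia.
  have n2 : a <> 2 * b.
    by move=> e; apply: h; exists b; apply: Or32; rewrite !root_combE; congr (_, _); lia.
  lia.
split; first lia.
split; first by exists a, b.
by move=> [k [] /root_comb_inj]; lia.
Qed.

Lemma E_setP (a b : nat) l : E_set (root_comb a%:Z b%:Z) l <-> exists a' : nat,
  [/\ l = root_comb a'%:Z b%:Z, (a' < a)%N, (a' < 2 * b)%N & (b < 2 * a')%N].
Proof.
split=> [[[[m m0 ->]]]|[a' [-> h1 h2 h3]]].
  rewrite alpha1X root_combB subr0 => hd hq; have /dominant_regular[h1 h2] := conj hd hq.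
  by exists (a - m)%N; split; [congr root_comb| | |]; lia.
have [hd hq] : dominant (root_comb a' b) /\ Q_sh (root_comb a' b) by apply/dominant_regular; lia.
do 2 split=> //; exists (a - a')%N; first by rewrite subn_gt0.
by rewrite alpha1X root_combB subr0; congr root_comb; lia.
Qed.

Lemma E'_setP (a b : nat) l : E'_set (root_comb a%:Z b%:Z) l <-> exists b' : nat,
  [/\ l = root_comb a%:Z b'%:Z, (b' < b)%N, (a < 2 * b')%N & (b' < 2 * a)%N].
Proof.
split=> [[[[m m0 ->]]]|[b' [-> h1 h2 h3]]].
  rewrite alpha2X root_combB subr0 => hd hq; have /dominant_regular[h1 h2] := conj hd hq.
  by exists (b - m)%N; split; [congr root_comb| | |]; lia.
have [hd hq] : dominant (root_comb a b') /\ Q_sh (root_comb a b') by apply/dominant_regular; lia.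
do 2 split=> //; exists (b - b')%N; first by rewrite subn_gt0.
by rewrite alpha2X root_combB subr0; congr root_comb; lia.
Qed.

Lemma Q_belowP (a b : nat) l : Q_below (root_comb a%:Z b%:Z) l <-> exists a' b' : nat,
  [/\ l = root_comb a'%:Z b'%:Z, (a' <= a)%N && (b' <= b)%N, (a', b') != (a, b),
      (a' < 2 * b')%N & (b' < 2 * a')%N].
Proof.
split=> [[[[a' [b' ->]]] hd [n0 [m [n e]]] hq]|[a' [b' [-> /andP[h1 h2] h3 h4 h5]]]].
  have /dominant_regular[h1 h2] := conj hd hq.
  move: e n0; rewrite root_combB => /root_comb_inj[e1 e2] n0.
  exists (absz a'), (absz b'); split; try lia; first by congr root_comb; lia.
  apply: contra_neq n0 => -[e3 e4]; rewrite root_combE; congr (_, _); lia.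
have [hd hq] : dominant (root_comb a' b') /\ Q_sh (root_comb a' b').
  by apply/dominant_regular; lia.
split=> //; split=> //; first by exists a', b'.
split; last first.
  by exists (a - a')%N, (b - b')%N; rewrite root_combB; congr root_comb; lia.
apply: contra_neq h3; rewrite root_combB => e.
have /root_comb_inj[e1 e2] : root_comb (a%:Z - a'%:Z) (b%:Z - b'%:Z) = root_comb 0 0.
  by rewrite e root_combE.
by congr (_, _); lia.
Qed.

(** Minimal length is strictly increasing in the index, so the length conditions of the tables
    become [j <= i] for [C_j] and [j <= 2i] for [C'_j]. *)
Lemma refl_min_len_le i j : (refl_min_len i <= refl_min_len j)%N = (i <= j)%N.
Proof.
by rewrite /refl_min_len; apply/idP/idP; [|rewrite leq_eqVlt => /orP[/eqP->//|]];
  case: (odd i); case: (odd j) => /=; lia.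
Qed.

Lemma tabulatedI (f : set ext_weyl -> laurent) (F : lab -> laurent)
    (rows : set ext_weyl -> laurent -> Prop) :
  (forall l, lab_ok l -> f (cls l) = F l) ->
  (forall O, (forall l, lab_ok l -> O <> cls l) -> f O = 0) ->
  (forall O c, rows O c -> exists2 l, lab_ok l & O = cls l /\ c = F l) ->
  (forall l, lab_ok l -> F l != 0 -> rows (cls l) (F l)) ->
  tabulated f rows.
Proof.
move=> fF f0 rF Fr O hO; split=> [c /rF[l hl [-> ->]]|nr]; first exact: fF.
have [[l hl e]|h] := pselect (exists2 l, lab_ok l & O = cls l); last first.
  by apply: f0 => l hl e; apply: h; exists l.
rewrite e fF //; apply/eqP/negPn/negP => n0; apply: (nr (F l)).
by rewrite e; exact: Fr.
Qed.

Lemma rows1_near (i n : nat) O c : (n <= 6 * i + 1)%N -> (0 < i)%N ->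
  rows1 i n O c ->
  exists2 l, lab_ok l & O = cls l /\ c = near_coef i ((n - 1) %/ 2 - i).+1 l.
Proof.
move=> hn hi; case=> [j hj|]; last by exists (LC i) => //; rewrite /= eqxx.
exists (LO j i); first by rewrite /=; lia.
split=> //=; rewrite (_ : [&& _, _ & _] = true) //; lia.
Qed.

Lemma near_rows1 (i n : nat) l : lab_ok l -> near_coef i ((n - 1) %/ 2 - i).+1 l != 0 ->
  rows1 i n (cls l) (near_coef i ((n - 1) %/ 2 - i).+1 l).
Proof.
case: l => [a b|j|j|] hl; rewrite /near_coef ?eqxx //.
  case h : [&& _, _ & _]; last by rewrite mulr0n eqxx.
  case/and3P: h => /eqP -> h1 h2 _; apply: Rows1_O; lia.
case e : (j == i) => n0; last by rewrite mulr0n eqxx in n0.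
by rewrite mulr1n (eqP e); exact: Rows1_C.
Qed.

Lemma rows2_far (i k : nat) d O c : (0 < i)%N -> (0 < k)%N -> (d = k.-1 \/ d = k) ->
  rows2 i k O c -> exists2 l, lab_ok l & O = cls l /\ c = far_coef i k d l.
Proof.
move=> hi hk hd; case=> [|| {}O [] hO nO| l [/Q_belowP[a [b [-> /andP[h1 h2] h3 h4 h5]]] nE]
  | l /E_setP[a [-> h1 h2 h3]] | j hj | j hj
  | j l hj [/E_setP[a [-> h1 h2 h3]]|/E'_setP[b [-> h1 h2 h3]]] | j hj |].
- exists (LO (2 * i) i); first by rewrite /=; lia.
  split=> //=; rewrite eqxx ltnn leqnn ltnn /= andbF mulr0n !addr0.
  by rewrite (_ : (i < _)%N = true) //; lia.
- by exists LR => //=; split=> //; rewrite mulr_natl.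
- case: hO => -[j [hj eO]]; rewrite ?(class_ts1E, class_ts2E)
      ?(min_len_C, min_len_C') ?refl_min_len_le => le.
    have nj : j <> i by move=> e; apply: nO; rewrite eO e.
    exists (LC j) => //; split=> //=; rewrite (_ : (j == i) = false); last by lia.
    rewrite addr0 mulr_natl; congr (_ *+ _); lia.
  exists (LC' j) => //; split=> //=; rewrite mulr_natl; congr (_ *+ _); lia.
- have nb : b <> i.
    move=> e; apply: nE; apply/E_setP; exists a; rewrite e in h4 h5 h3 *; split=> //; lia.
  exists (LO a b); first by rewrite /=; lia.
  split=> //=; rewrite h4 h5 /= (_ : (b == i) = false); last by lia.
  rewrite (_ : (2 * i < a)%N = false) ?andbF; last by lia.
  by rewrite add0r addr0 mulr_natl; congr (_ *+ _); lia.
- exists (LO a i); first by rewrite /=; lia.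
  split=> //=; rewrite eqxx h2 h3 /= (_ : (2 * i < a)%N = false) ?andbF; last by lia.
  rewrite addr0 addrC mulr_natl (_ : (a <= 2 * i)%N = true); last by lia.
  congr (_ + _ *+ _); lia.
- exists (LC (i + j)); first by rewrite /=; lia.
  split; first exact: class_ts1E.
  rewrite /= (_ : (_ == _) = false) ?addr0; last by lia.
  by rewrite mulr_natl; congr (_ *+ _); lia.
- exists (LC' (2 * i + j)); first by rewrite /=; lia.
  split; first exact: class_ts2E.
  by rewrite /= mulr_natl; congr (_ *+ _); lia.
- exists (LO a (i + j)); first by rewrite /=; lia.
  split=> //=; rewrite h2 h3 /= (_ : (i + j == i)%N = false); last by lia.
  rewrite (_ : [&& (_ - _ == _)%N, _, _ & _] = false); last by lia.
  by rewrite add0r addr0 mulr_natl; congr (_ *+ _); lia.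
- exists (LO (2 * i + j) b); first by rewrite /=; lia.
  split=> //=; rewrite h2 h3 /=.
  rewrite (_ : [&& (_ - _ == _)%N, _, _ & _] = false); last by lia.
  rewrite (_ : [&& b == i, _ & _] = false); last by lia.
  by rewrite add0r addr0 mulr_natl; congr (_ *+ _); lia.
- exists (LO (2 * i + j) (i + j)); first by rewrite /=; lia.
  split=> //=; rewrite (_ : (i + j == i)%N = false); last by lia.
  rewrite (_ : [&& (_ - _ == _)%N, _, _ & _] = true); last by lia.
  rewrite (_ : (2 * i + j < 2 * (i + j))%N && (i + j < 2 * (2 * i + j))%N = true); last by lia.
  by rewrite add0r mulr_natl; congr (_ *+ _ + _); lia.
- exists (LC i) => //; split=> //=; rewrite eqxx mulr_natl; congr (_ *+ _ + _); lia.
Qed.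

Lemma far_rows2 (i k d : nat) l : (0 < i)%N -> (0 < k)%N -> (d = k.-1 \/ d = k) -> lab_ok l ->
  far_coef i k d l != 0 ->
  rows2 i k (cls l) (far_coef i k d l) \/
  [/\ d = k, l = LO (2 * i + k) (i + k) & far_coef i k d l = x].
Proof.
move=> hi hk hd; case: l => [a b|j|j|] hl /=; last 3 first.
- move=> n0; left; have [e|[lt|gt]] : j = i \/ (j < i)%N \/ (i < j)%N by lia.
  + rewrite e eqxx subnn subn0 -mulr_natl; exact: Rows2_C.
  + rewrite (_ : (j == i) = false) ?addr0; last by lia.
    rewrite (_ : k - (j - i) = k)%N; last by lia.
    rewrite -mulr_natl.
    apply: Rows2_le; split.
      by left; exists j; split=> //; rewrite class_ts1E !min_len_C refl_min_len_le ltnW.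
    move=> /= e; have : LC j = LC i by apply: cls_inj.
    by case=> e'; lia.
  + move: n0; rewrite (_ : (j == i) = false) ?addr0; last by lia.
    have [->|p n0] := posnP (k - (j - i)); first by rewrite mulr0n eqxx.
    rewrite -mulr_natl -(@class_ts1E (2 * i + (j - i) + 1)).
    have := @Rows2_ts1 i k (j - i) ltac:(lia).
    by rewrite (_ : i + (j - i) = j)%N //; lia.
- have [le|gt] := leqP j (2 * i).
  + rewrite (_ : k - (j - 2 * i) = k)%N; last by lia.
    rewrite -mulr_natl => n0; left; apply: Rows2_le; split.
      by right; exists j; split=> //; rewrite class_ts2E !min_len_C' refl_min_len_le.
    move=> /= e; have : LC' j = LC i by apply: cls_inj.
    by [].
  + have [->|p n0] := posnP (k - (j - 2 * i)); first by rewrite mulr0n eqxx.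
    left; rewrite -mulr_natl -(@class_ts2E _ (i + (j - 2 * i))).
    have := @Rows2_ts2 i k (j - 2 * i) ltac:(lia).
    by rewrite (_ : 2 * i + (j - 2 * i) = j)%N //; lia.
- by move=> _; left; rewrite -mulr_natl; exact: Rows2_O2.
case reg : ((a < 2 * b)%N && (b < 2 * a)%N); last first.
  case h1 : [&& b == i, (i < 2 * a)%N & (a <= 2 * i)%N].
    (* A singular weight in the row [b = i] lies on the wall [a = 2b]; the other wall would require
       [i = 2a]. *)
    have [ea eb] : a = (2 * i)%N /\ b = i by move: hl; rewrite /=; lia.
    rewrite ea eb (_ : [&& (_ - _ == _)%N, _, _ & _] = false); last by lia.
    by move=> _; left; rewrite !mulr0n !addr0; exact: Rows2_top.
  case h2 : [&& (a - 2 * i == b - i)%N, (2 * i < a)%N, (i < b)%N & (b <= i + d)%N].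
    by exfalso; lia.
  by rewrite !mulr0n !addr0 eqxx.
case/andP: reg => r1 r2.
case h2 : [&& (a - 2 * i == b - i)%N, (2 * i < a)%N, (i < b)%N & (b <= i + d)%N].
  have [j [ea [eb hj]]] : exists j, (a = 2 * i + j /\ b = i + j /\ 1 <= j <= d)%N.
    by exists (b - i)%N; lia.
  rewrite (_ : [&& b == i, _ & _] = false); last by lia.
  have [jk|jk] : (j <= k - 1)%N \/ (d = k /\ j = k) by lia.
    move=> _; left; rewrite ea eb add0r.
    rewrite (_ : k - maxn _ _ = k - j)%N; last by lia.
    by rewrite -mulr_natl; apply: Rows2_O; lia.
  move=> _; right; split; [lia|congr LO; lia|].
  by rewrite add0r (_ : k - maxn _ _ = 0)%N ?add0r //; lia.
rewrite [x *+ false]mulr0n addr0.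
case h1 : [&& b == i, (i < 2 * a)%N & (a <= 2 * i)%N].
  move=> _; left; have eb : b = i by lia.
  rewrite (_ : k - maxn _ _ = k)%N; last by lia.
  rewrite eb addrC -mulr_natl; apply: Rows2_E; apply/E_setP; exists a; split=> //; lia.
rewrite mulr0n add0r.
have [->|p n0] := posnP (k - maxn (a - 2 * i) (b - i)); first by rewrite mulr0n eqxx.
left; rewrite -mulr_natl.
(* The maximum is the number of the first rotation containing the weight. It is 0 below
   [2i a1 + i a2]; otherwise the larger excess tells whether the weight entered with a row ([E_set])
   or a column ([E'_set]). Equal positive excesses are excluded by [h2] and [p]. *)
have [m0|[m1|m1]] : maxn (a - 2 * i) (b - i) = 0%N \/
   (0 < b - i /\ a - 2 * i < b - i)%N \/ (0 < a - 2 * i /\ b - i < a - 2 * i)%N by lia.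
- rewrite m0 subn0; apply: Rows2_Q; split.
    by apply/Q_belowP; exists a, b; split=> //; [lia|apply/eqP => -[]; lia].
  by move=> /E_setP[a' [/root_comb_inj[]]]; lia.
- rewrite (_ : maxn _ _ = b - i)%N; last by lia.
  apply: Rows2_EE'; first by lia.
  by left; apply/E_setP; exists a; split; [congr root_comb; lia|lia..].
- rewrite (_ : maxn _ _ = a - 2 * i)%N; last by lia.
  apply: Rows2_EE'; first by lia.
  by right; apply/E'_setP; exists b; split; [congr root_comb; lia|lia..].
Qed.

Theorem proposition2p16 (H : algType laurent) (T : ext_weyl -> H)
    (hT : is_hecke_algebra T) (i : nat) (hi : (0 < i)%N)
    (w : ext_weyl) (hw : class_C i w) :
  [/\ (min_len (class_C i) <= len w <= 6 * i + 1)%N ->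
        tabulated (class_poly T w) (rows1 i (len w)),
      forall k : nat, (1 <= k)%N -> len w = (6 * i - 1 + 4 * k)%N ->
        tabulated (class_poly T w) (rows2 i k)
    & forall k : nat, (1 <= k)%N -> len w = (6 * i + 1 + 4 * k)%N ->
        tabulated (class_poly T w) (rows3 i k)].
Proof.
split=> [/andP[_ hl]|k hk hl|k hk hl].
- have [f1 f2] := class_poly_expands hT (expands_near hT hi hw hl).
  apply: tabulatedI f1 f2 _ _ => [O c|l]; first exact: rows1_near.
  exact: near_rows1.
- have [f1 f2] := class_poly_expands hT ((expands_far hT hi hw hk).1 hl).
  apply: tabulatedI f1 f2 _ _ => [O c|l hl' n0]; first by apply: rows2_far => //; left.
  by case: (far_rows2 hi hk (or_introl erefl) hl' n0) => [//|[e _ _]]; exfalso; lia.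
- have [f1 f2] := class_poly_expands hT ((expands_far hT hi hw hk).2 hl).
  apply: tabulatedI f1 f2 _ _ => [O c [O' c'|]|l hl' n0].
  + by apply: rows2_far => //; right.
  + exists (LO (2 * i + k) (i + k)); first by rewrite /=; lia.
    split=> //=; rewrite (_ : (i + k == i)%N = false); last by lia.
    rewrite (_ : [&& (_ - _ == _)%N, _, _ & _] = true); last by lia.
    rewrite (_ : (if _ then _ else _) = 0%N) ?mulr0n ?add0r //.
    by case: ifP => // _; lia.
  + case: (far_rows2 hi hk (or_intror erefl) hl' n0) => [r|[_ -> ->]].
      exact: Rows3_rows2.
    exact: Rows3_O.
Qed.
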